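(* Let $S$ be a linear operator on $F^2_\alpha$ satisfying the standing assumptions. If there exists some $p>2$ such that $\|S_z1\|_p\to0$ as $z\to\infty$, then $S$ is compact on $F^2_\alpha$.
   Context: Fix $\alpha>0$. Let $d\lambda_\alpha(z)=\frac{\alpha}{\pi}e^{-\alpha|z|^2}\,dA(z)$, where $dA$ is Euclidean area measure on $\mathbb{C}$ (a probability measure). The Fock space $F^2_\alpha$ is the closed subspace of $L^2(\mathbb{C},d\lambda_\alpha)$ consisting of entire functions, with the inherited inner product $\langle f,g\rangle=\int_{\mathbb{C}}f\overline{g}\,d\lambda_\alpha$; its reproducing kernel is $K_w(z)=K(z,w)=e^{\alpha z\overline{w}}$. For $p>0$ write $\|f\|_p=\left(\int_{\mathbb{C}}|f|^p\,d\lambda_\alpha\right)^{1/p}\in[0,\infty]$. Let $\mathcal{D}$ be the set of all finite linear combinations of kernel functions $K_w$, $w\in\mathbb{C}$; it is dense in $F^2_\alpha$. Standing assumptions: a linear operator $S$ on $F^2_\alpha$ is not necessarily bounded or everywhere defined, but the domain of $S$ contains $\mathcal{D}$, the domain of its adjoint $S^*$ contains $\mathcal{D}$, and the map $z\mapsto SK_z$ is conjugate analytic. Saying that $S$ is bounded (compact) on $F^2_\alpha$ means that $S$ extends to a bounded (compact) linear operator on all of $F^2_\alpha$. For $z\in\mathbb{C}$ let $\varphi_z(w)=z-w$, let $k_z(w)=K(w,z)/\sqrt{K(z,z)}=e^{-\frac{\alpha}{2}|z|^2+\alpha w\overline{z}}$ be the normalized reproducing kernel, and let $U_z$ be the operator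 on $F^2_\alpha$ given by $U_zf=(f\circ\varphi_z)k_z$. Each $U_z$ is a self-adjoint unitary operator and maps $\mathcal{D}$ onto $\mathcal{D}$. Set $S_z=U_zSU_z$; here $1=K_0\in\mathcal{D}$ denotes the constant function. *)

(* Defs.v *)
From HB Require Import structures.
From mathcomp Require Import all_boot all_order all_algebra.
From mathcomp Require Import all_classical all_reals all_analysis measurable_realfun.
From mathcomp Require Import complex.

Set Implicit Arguments.
Unset Strict Implicit.
Unset Printing Implicit Defensive.

Import Order.TTheory GRing.Theory Num.Theory.
Import numFieldNormedType.Exports.

Local Open Scope classical_set_scope.
Local Open Scope ring_scope.
Local Open Scope complex_scope.

Section Plane.
Variable R : realType.

Definition modc (z : R[i]) : R := ComplexField.Normc.normc z.

Definition cexp (z : R[i]) : R[i] :=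
  (expR (complex.Re z))%:C *
  (cos (complex.Im z) +i* sin (complex.Im z)).

(* [derivable _ z 1] is taken over the field R[i]: the increments in the
   difference quotient are complex. *)
Definition entire (f : R[i] -> R[i]) : Prop :=
  forall z : R[i], derivable (f : R[i]^o -> R[i]^o) z 1.

(* R[i] carries no measurable structure: integrals over the complex plane are
   taken over R * R with the product sigma-algebra, through [plane]. *)
Definition plane (x : R * R) : R[i] := x.1 +i* x.2.

Definition area : {measure set (measurableTypeR R * measurableTypeR R) -> \bar R} :=
  (@lebesgue_measure R \x @lebesgue_measure R)%E.

(* The filter of neighbourhoods of infinity in the complex plane. *)
Definition cinfty : set_system R[i] :=
  [set A | \forall r \near +oo, forall z, r < modc z -> A z].

Lemma modc_real (r : R) : 0 <= r -> modc r%:C = r.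
Proof. by move=> r0; rewrite /modc /= expr0n addr0 sqrtr_sqr ger0_norm. Qed.

Global Instance cinfty_filter : Filter cinfty.
Proof.
split.
- by exists 0; split.
- move=> A B hA hB; change (\forall r \near +oo, forall z, r < modc z -> (A `&` B) z).
  near=> r => z rz; split; move: z rz; near: r.
    exact: hA.
  exact: hB.
- move=> A B AB hA; change (\forall r \near +oo, forall z, r < modc z -> B z).
  near=> r => z rz; apply: AB; move: z rz; near: r.
  exact: hA.
Unshelve. all: by end_near. Qed.

Global Instance cinfty_proper : ProperFilter cinfty.
Proof.
apply: Build_ProperFilter_ex => A [r [_ h]].
pose s := Num.max (r + 1) 0.
have rs : r < s by rewrite lt_max ltrDl ltr01.
have s0 : 0 <= s by rewrite le_max lexx orbT.
exists (s + 1)%:C; apply: (h s rs); rewrite modc_real ?ltrDl ?ltr01//.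
by rewrite addr_ge0.
Qed.

End Plane.
Arguments cinfty R : clear implicits.

Section GaussianMeasure.
Variables (R : realType) (alpha : {posnum R}).

Definition gauss_density (x : R * R) : R :=
  alpha%:num / pi * expR (- alpha%:num * modc (plane x) ^+ 2).

Lemma gauss_density_ge0 x : 0 <= gauss_density x.
Proof. by rewrite mulr_ge0 ?expR_ge0// divr_ge0 ?pi_ge0. Qed.

Lemma modc2 (x : R * R) : modc (plane x) ^+ 2 = x.1 ^+ 2 + x.2 ^+ 2.
Proof. by rewrite /modc /= sqr_sqrtr// addr_ge0// sqr_ge0. Qed.

Lemma measurable_gauss_density :
  measurable_fun (setT : set (measurableTypeR R * measurableTypeR R))
    gauss_density.
Proof.
rewrite /gauss_density; apply: measurable_funM => //.
apply: measurableT_comp => //; apply: measurable_funM => //.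
under eq_fun do rewrite modc2.
apply: measurable_funD; apply: measurable_funX.
  exact: measurable_fst.
exact: measurable_snd.
Qed.

Definition gauss_measure
    (A : set (measurableTypeR R * measurableTypeR R)) : \bar R :=
  (\int[area R]_(x in A) (gauss_density x)%:E)%E.

Let gauss_measure0 : gauss_measure set0 = 0%E.
Proof. exact: integral_set0. Qed.

Let gauss_measure_ge0 A : (0 <= gauss_measure A)%E.
Proof. by apply: integral_ge0 => x _; rewrite lee_fin gauss_density_ge0. Qed.

Let gauss_measure_sigma_additive : semi_sigma_additive gauss_measure.
Proof.
move=> A mA tA mUA.
rewrite /gauss_measure ge0_integral_bigcup//=; last 2 first.
- by apply/measurable_EFinP; apply: measurable_funTS;
    exact: measurable_gauss_density.
- by move=> x _; rewrite lee_fin gauss_density_ge0.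
apply: is_cvg_ereal_nneg_natsum_cond => n _ _.
by apply: integral_ge0 => x _; rewrite lee_fin gauss_density_ge0.
Qed.

HB.instance Definition _ := isMeasure.Build _ _ _ gauss_measure
  gauss_measure0 gauss_measure_ge0 gauss_measure_sigma_additive.

End GaussianMeasure.

Section Fock.
Variables (R : realType) (alpha : {posnum R}).
Implicit Types (z w a : R[i]) (f g h : R[i] -> R[i]).

(* The L^p "norm" for the Gaussian measure, with values in [0, +oo]. *)
Definition fnorm (p : R) f : \bar R :=
  Lnorm (gauss_measure alpha) p%:E (fun x => (modc (f (plane x)))%:E).

(* A square-integrable class has at most one entire representative, so elements
   of the Fock space are represented by genuine functions. *)
Definition fock : set (R[i] -> R[i]) :=
  [set f | entire f /\ (fnorm 2 f < +oo)%E].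

Definition fdot f g : R[i] :=
  let F x := f (plane x) * conjc (g (plane x)) in
  Rintegral (gauss_measure alpha) setT (fun x => complex.Re (F x)) +i*
  Rintegral (gauss_measure alpha) setT (fun x => complex.Im (F x)).

Definition rker w : R[i] -> R[i] :=
  fun z => cexp (alpha%:num%:C * z * conjc w).

Definition rker_span : set (R[i] -> R[i]) :=
  [set f | exists (n : nat) (c w : 'I_n -> R[i]),
     f = fun z => \sum_(i < n) c i * rker (w i) z].

(* [rker z z] is a positive real number. *)
Definition nrker z : R[i] -> R[i] :=
  fun w => rker z w / (Num.sqrt (complex.Re (rker z z)))%:C.

Definition weyl z f : R[i] -> R[i] := fun w => f (z - w) * nrker z w.

(* A linear operator on the Fock space, possibly unbounded and only defined on
   the linear subspace [dom]; the values of [op] outside [dom] are irrelevant. *)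
Record fock_operator := FockOperator {
  dom : set (R[i] -> R[i]);
  op : (R[i] -> R[i]) -> (R[i] -> R[i]);
  dom_fock : dom `<=` fock;
  dom0 : dom (fun=> 0);
  dom_lin : forall a f g, dom f -> dom g -> dom (fun w => a * f w + g w);
  op_fock : forall f, dom f -> fock (op f);
  op_lin : forall a f g, dom f -> dom g ->
    op (fun w => a * f w + g w) = (fun w => a * op f w + op g w) }.

Implicit Types S T : fock_operator.

(* [h] is the value at [g] of the adjoint of [S]. *)
Definition adjoint_dom S : set (R[i] -> R[i]) :=
  [set g | fock g /\ exists2 h, fock h &
     forall f, dom S f -> fdot (op S f) g = fdot f h].

(* Conjugate analyticity of a map into the Fock space, i.e. complex
   differentiability of [F \o conjc]: at each point the quotients by the
   conjugated (complex) increments converge in the norm of the space. *)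
Definition conj_analytic (F : R[i] -> R[i] -> R[i]) : Prop :=
  (forall z, fock (F z)) /\
  forall z : R[i], exists2 G, fock G &
    fnorm 2 (fun w => (F (z + t) w - F z w) / conjc t - G w)
      @[t --> (0 : R[i]^o)^'] --> 0%E.

Definition standing S : Prop :=
  [/\ rker_span `<=` dom S,
      rker_span `<=` adjoint_dom S &
      conj_analytic (fun z => op S (rker z))].

Definition conj_weyl S z f : R[i] -> R[i] := weyl z (op S (weyl z f)).

(* Bounded sequences have images with a norm-convergent subsequence. *)
Definition compact_operator T : Prop :=
  dom T = fock /\
  forall (u : nat -> R[i] -> R[i]) (M : R),
    (forall n, fock (u n) /\ (fnorm 2 (u n) <= M%:E)%E) ->
    exists s : nat -> nat, {homo s : m n / (m < n)%N} /\
    exists2 g, fock g &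
      fnorm 2 (fun w => op T (u (s n)) w - g w) @[n --> \oo] --> 0%E.

Definition extension S T : Prop :=
  dom S `<=` dom T /\ forall f, dom S f -> op T f = op S f.

Definition compact_on_fock S : Prop :=
  exists2 T, extension S T & compact_operator T.

End Fock.

(* Main.v *)
Require Import Defs.
From HB Require Import structures.
From mathcomp Require Import all_boot all_order all_algebra.
From mathcomp Require Import all_classical all_reals all_analysis measurable_realfun.
From mathcomp Require Import complex ring lra.

(* By reproduction and the adjoint hypothesis, [S f] is the integral of [f u] times
   the kernel [H u w = (S K_u)(w)].  Up to a Gaussian factor, [S_z 1] is the function
   [w |-> H z (z - w)], so bounding the value of an entire function at a point by
   its Gaussian [L^p] norm gives
     [|H u w| <= tau(u) exp (alpha (|u|^2 + |w|^2) / 2 - delta |u - w|^2)]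
   with [delta = alpha / 2 - alpha / p], where [tau(u)] tends to [0] at infinity;
   [delta > 0] is exactly [p > 2].  Cut the kernel at [|u| = r]: by Schur's test
   the outer part has small norm, and the inner part is Hilbert-Schmidt because
   conjugate analyticity makes [|| S K_u ||] locally bounded.  Finally a bounded
   sequence of the Fock space has a subsequence converging locally
   to a function of the space, which the inner part sends to a convergent
   sequence and the outer part changes only slightly. *)

Set Implicit Arguments.
Unset Strict Implicit.
Unset Printing Implicit Defensive.

Import Order.TTheory GRing.Theory Num.Theory.
Import numFieldNormedType.Exports.

Local Open Scope classical_set_scope.
Local Open Scope ring_scope.
Local Open Scope complex_scope.

(** * Entire functions *)

(** The rate [alpha / p] is the growth that the Gaussian [L^p] norm allows an entire function. For
    [S_u 1] at the point [u - v] it meets the identity [- Re (v conj u) = (|u - v|^2 - |u|^2 -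
    |v|^2) / 2], and [alpha / 2 - alpha / p] is what remains in front of [- |u - v|^2]. The adjoint
    hypothesis gives more than the integral formula: [H u w] is the conjugate of the value at [u] of
    [h w], the adjoint applied to [K_w], so the kernel is measurable and square integrable in [u] as
    well. The integral operator with kernel [H] is itself the extension of [S]. The recurring
    difficulty is to see that a function obtained by integration, or as a pointwise limit, is
    entire. The transform of any square-integrable function against the reproducing kernel is
    entire, and the function in question is shown to equal its own transform. The complex analysis
    behind this is the mean value property: the Gaussian measure is rotation invariant, so a
    Gaussian mean is an average of circle means. Complex integrals are bounded through real and
    imaginary parts, whence the unsharp factors [2]. *)

Section ComplexPlane.
Variable R : realType.
Implicit Types (z w h d : R[i]) (f g : R[i] -> R[i]) (x y : R).

Lemma modcE z : modc z = Num.sqrt (complex.Re z ^+ 2 + complex.Im z ^+ 2).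
Proof. by case: z. Qed.

Lemma normc_modc z : `|z| = (modc z)%:C.
Proof. by case: z => a b; rewrite normc_def. Qed.

Lemma modc_ge0 z : 0 <= modc z.
Proof. by rewrite modcE sqrtr_ge0. Qed.

Lemma modcM z w : modc (z * w) = modc z * modc w.
Proof. by rewrite /modc ComplexField.Normc.normcM. Qed.

Lemma modcN z : modc (- z) = modc z.
Proof. exact: (@normcN R). Qed.

Lemma modcV z : modc z^-1 = (modc z)^-1.
Proof. by rewrite /modc ComplexField.Normc.normcV. Qed.

Lemma modcD z w : modc (z + w) <= modc z + modc w.
Proof. exact: (@le_normcD R). Qed.

Lemma modcB z w : modc (z - w) <= modc z + modc w.
Proof. by rewrite -(modcN w); exact: modcD. Qed.

Lemma modcBC z w : modc (z - w) = modc (w - z).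
Proof. by rewrite -modcN opprB. Qed.

Lemma modcBB z w : modc z - modc w <= modc (z - w).
Proof. by rewrite lerBlDr (le_trans _ (modcD _ _))// subrK. Qed.

Lemma modc0 : modc (0 : R[i]) = 0.
Proof. exact: ComplexField.Normc.normc0. Qed.

Lemma modc1 : modc (1 : R[i]) = 1.
Proof. exact: ComplexField.Normc.normc1. Qed.

Lemma modc_eq0 z : (modc z == 0) = (z == 0).
Proof.
apply/eqP/eqP => [/ComplexField.Normc.eq0_normc//|->]; exact: modc0.
Qed.

Lemma modc_gt0 z : (0 < modc z) = (z != 0).
Proof. by rewrite lt_def modc_ge0 andbT modc_eq0. Qed.

Lemma modcX2 z : modc z ^+ 2 = complex.Re z ^+ 2 + complex.Im z ^+ 2.
Proof. by rewrite modcE sqr_sqrtr// addr_ge0// sqr_ge0. Qed.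

Lemma modcJ z : modc z^* = modc z.
Proof. by rewrite !modcE; case: z => a b /=; rewrite sqrrN. Qed.

Lemma modc_Creal x : modc x%:C = `|x|.
Proof. by rewrite /modc /= expr0n addr0 sqrtr_sqr. Qed.

Lemma modc_Re z : `|complex.Re z| <= modc z.
Proof.
rewrite -(@ler_pXn2r _ 2) ?nnegrE ?modc_ge0//.
by rewrite modcX2 real_normK ?num_real// lerDl sqr_ge0.
Qed.

Lemma modc_Im z : `|complex.Im z| <= modc z.
Proof.
rewrite -(@ler_pXn2r _ 2) ?nnegrE ?modc_ge0//.
by rewrite modcX2 real_normK ?num_real// lerDr sqr_ge0.
Qed.

Lemma modc_leReIm z : modc z <= `|complex.Re z| + `|complex.Im z|.
Proof.
rewrite -(@ler_pXn2r _ 2) ?nnegrE ?modc_ge0 ?addr_ge0//.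
rewrite modcX2 sqrrD !real_normK ?num_real//.
by rewrite [leRHS]addrAC lerDl mulrn_wge0// mulr_ge0.
Qed.

Lemma ReD z w : complex.Re (z + w) = complex.Re z + complex.Re w.
Proof. by case: z; case: w. Qed.
Lemma ImD z w : complex.Im (z + w) = complex.Im z + complex.Im w.
Proof. by case: z; case: w. Qed.
Lemma ReN z : complex.Re (- z) = - complex.Re z.
Proof. by case: z. Qed.
Lemma ImN z : complex.Im (- z) = - complex.Im z.
Proof. by case: z. Qed.
Lemma ReM z w : complex.Re (z * w) =
  complex.Re z * complex.Re w - complex.Im z * complex.Im w.
Proof. by case: z; case: w. Qed.
Lemma ImM z w : complex.Im (z * w) =
  complex.Re z * complex.Im w + complex.Im z * complex.Re w.
Proof. by case: z; case: w. Qed.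
Lemma ReJ z : complex.Re z^* = complex.Re z.
Proof. by case: z. Qed.
Lemma ImJ z : complex.Im z^* = - complex.Im z.
Proof. by case: z. Qed.
Definition ReImE := (ReD, ImD, ReN, ImN, ReM, ImM, ReJ, ImJ).

Lemma complex_ext z w : complex.Re z = complex.Re w ->
  complex.Im z = complex.Im w -> z = w.
Proof. by case: z => a b; case: w => c e /= -> ->. Qed.

Lemma modc_cexp z : modc (cexp z) = expR (complex.Re z).
Proof.
rewrite /cexp modcM modc_Creal ger0_norm ?expR_ge0// /modc /=.
by rewrite cos2Dsin2 sqrtr1 mulr1.
Qed.

Lemma cexpD z w : cexp (z + w) = cexp z * cexp w.
Proof.
by apply: complex_ext; rewrite /cexp !ReImE/= expRD cosD sinD; ring.
Qed.

Lemma cexp0 : cexp (0 : R[i]) = 1.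
Proof. by apply: complex_ext; rewrite /cexp !ReImE/= expR0 cos0 sin0; ring. Qed.

Lemma cexpJ z : cexp z^* = (cexp z)^*.
Proof. by apply: complex_ext; rewrite /cexp !ReImE/= cosN sinN; ring. Qed.

Lemma cexp_real x : cexp x%:C = (expR x)%:C.
Proof. by apply: complex_ext; rewrite /cexp !ReImE/= cos0 sin0; ring. Qed.

Lemma le_abs_sin x : `|sin x| <= `|x|.
Proof.
wlog x0 : x / 0 <= x => [H|].
  have [/H//|/ltW x0] := leP 0 x.
  by rewrite -normrN -sinN -(normrN x) H// oppr_ge0.
move: x0; rewrite le_eqVlt => /predU1P[<-|x0]; first by rewrite sin0.
have [c _] := @MVT R sin cos 0 x x0 (fun x _ => is_derive_sin x)
  (continuous_subspaceT (@continuous_sin R)).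
rewrite sin0 !subr0 => ->; rewrite normrM (ger0_norm (ltW x0)).
by rewrite ler_piMl ?cos_max// ltW.
Qed.

Lemma abs_cosB1 x : `|cos x - 1| <= `|x| ^+ 2.
Proof.
have -> : x = (x / 2) *+ 2 by rewrite -mulr_natr divfK.
rewrite cos_mulr2n -mulr_natr.
have -> : cos (x / 2) ^+ 2 * 2 - 1 - 1 = - (2 * sin (x / 2) ^+ 2).
  by rewrite sin2cos2; ring.
rewrite normrN (normrM 2) normrX ger0_norm// -(mulr_natr (x / 2)) (normrM _ 2%:R).
rewrite (@ger0_norm _ 2%:R)//; have := le_abs_sin (x / 2).
have := normr_ge0 (sin (x / 2)); nra.
Qed.

Lemma abs_sinB x : `|sin x - x| <= 2 * `|x| ^+ 2.
Proof.
wlog x0 : x / 0 <= x => [H|].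
  have [/H//|/ltW x0] := leP 0 x.
  by rewrite -normrN opprB addrC -sinN -(normrN x) -[X in `|_ + X|]opprK H// oppr_ge0.
move: x0; rewrite le_eqVlt => /predU1P[<-|x0].
  by rewrite sin0 subr0 normr0 expr0n mulr0.
have [c] := @MVT R sin cos 0 x x0 (fun x _ => is_derive_sin x)
  (continuous_subspaceT (@continuous_sin R)).
rewrite in_itv/= => /andP[c0 cx].
rewrite sin0 !subr0 => ->; rewrite -[X in _ - X]mul1r -mulrBl normrM.
rewrite (ger0_norm (ltW x0)).
(* For [x <= 1] the quadratic bound suffices, since [c^2 <= x]; for larger [x] the range of the
   cosine does. *)
have h : `|cos c - 1| <= 2 * x.
  have [x1|x1] := leP x 1.
    have := abs_cosB1 c; rewrite (ger0_norm (ltW c0)); nra.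
  have := cos_geN1 c; have := cos_le1 c; rewrite ler_norml; lra.
by rewrite expr2 mulrA ler_pM2r.
Qed.

Lemma expRB1x_ge0 x : 0 <= expR x - 1 - x.
Proof. by have := expR_ge1Dx x; lra. Qed.

Lemma expRB1x_le x : expR x - 1 - x <= x ^+ 2 * expR `|x|.
Proof.
(* This is [1 - y <= expR (- y)] multiplied by [expR y]. *)
have h y : expR y - 1 <= y * expR y.
  have := expR_ge1Dx (- y); rewrite expRN => h.
  have e0 := expR_gt0 y.
  have : (1 - y) * expR y <= (expR y)^-1 * expR y by rewrite ler_pM2r.
  by rewrite mulVf ?gt_eqF//; lra.
have [x0|x0] := leP 0 x.
  rewrite ger0_norm//; have := h x; have := expR_ge1Dx x.
  have : 1 <= expR x by rewrite -expR0 ler_expR.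
  nra.
rewrite ltr0_norm//; have := h x; have := expR_ge1Dx x.
have : 1 <= expR (- x) by rewrite -expR0 ler_expR oppr_ge0 ltW.
nra.
Qed.

Lemma abs_expRB1 x : `|expR x - 1| <= `|x| * expR `|x|.
Proof.
have h y : expR y - 1 <= y * expR y.
  have := expR_ge1Dx (- y); rewrite expRN => h.
  have e0 := expR_gt0 y.
  have : (1 - y) * expR y <= (expR y)^-1 * expR y by rewrite ler_pM2r.
  by rewrite mulVf ?gt_eqF//; lra.
have [x0|x0] := leP 0 x.
  have := h x; have := expR_ge1Dx x; rewrite (ger0_norm x0) => ? ?.
  by rewrite ger0_norm//; lra.
rewrite (ltr0_norm x0); have := expR_ge1Dx x.
have : 1 <= expR (- x) by rewrite -expR0 ler_expR oppr_ge0 ltW.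
have : expR x <= 1 by rewrite -expR0 ler_expR ltW.
by move=> h1 h2 h3; rewrite ler0_norm; nra.
Qed.

(** The factor [expR (modc h)] makes the remainder bound valid for all [h], not only small ones.
    This matters under the integral sign, where [h] is [alpha * t * conj u] with [u] running through
    the whole plane. *)
Lemma cexp_taylor1 h :
  modc (cexp h - 1 - h) <= 8 * modc h ^+ 2 * expR (modc h).
Proof.
case: h => x y; set m := modc (x +i* y).
have xm : `|x| <= m by exact: (modc_Re (x +i* y)).
have ym : `|y| <= m by exact: (modc_Im (x +i* y)).
have m0 : 0 <= m by exact: modc_ge0.
have exm : expR `|x| <= expR m by rewrite ler_expR.
have em1 : 1 <= expR m by rewrite -expR0 ler_expR.
have x0 := normr_ge0 x; have y0 := normr_ge0 y.
have e0 := expR_ge0 `|x|.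
have A1 : `|expR x - 1 - x| <= m ^+ 2 * expR m.
  rewrite ger0_norm ?expRB1x_ge0//; apply: le_trans (expRB1x_le x) _.
  rewrite -(real_normK (num_real x)); apply: ler_pM; rewrite ?exprn_ge0//.
  by rewrite ler_pXn2r ?nnegrE.
have A2 : `|expR x - 1| <= m * expR m.
  by apply: le_trans (abs_expRB1 x) _; apply: ler_pM.
have A3 : `|1 + x| <= expR m.
  apply: le_trans (ler_normD _ _) _; rewrite normr1.
  by apply: le_trans exm; exact: expR_ge1Dx.
have B1 : `|cos y - 1| <= m ^+ 2.
  by apply: le_trans (abs_cosB1 y) _; rewrite ler_pXn2r ?nnegrE.
have B2 : `|sin y - y| <= 2 * m ^+ 2.
  by apply: le_trans (abs_sinB y) _; rewrite ler_pM2l// ler_pXn2r ?nnegrE.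
have B3 : `|sin y| <= m by apply: le_trans (le_abs_sin y) _.
apply: le_trans (modc_leReIm _) _.
rewrite /cexp !ReImE/=.
have -> : expR x * cos y - 0 * sin y - 1 - x =
  (expR x - 1 - x) * cos y + (1 + x) * (cos y - 1) by ring.
have -> : expR x * sin y + 0 * cos y - 0 - y =
  (expR x - 1) * sin y + (sin y - y) by ring.
have C1 : `|(expR x - 1 - x) * cos y + (1 + x) * (cos y - 1)| <=
    m ^+ 2 * expR m + expR m * m ^+ 2.
  apply: le_trans (ler_normD _ _) _; rewrite !normrM; apply: lerD.
    by rewrite -[leRHS]mulr1; apply: ler_pM => //; exact: cos_max.
  exact: ler_pM.
have C2 : `|(expR x - 1) * sin y + (sin y - y)| <=
    m * expR m * m + 2 * m ^+ 2.
  apply: le_trans (ler_normD _ _) _; rewrite !normrM; apply: lerD => //.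
  exact: ler_pM.
nra.
Qed.

(** Complex differentiability without division and with real radii: the case [h = 0] is included,
    and the derivative is carried as explicit data. *)
Definition cdiff f z d : Prop := forall e : R, 0 < e -> exists2 r : R, 0 < r &
  forall h, modc h < r -> modc (f (z + h) - f z - d * h) <= e * modc h.

Definition ccont f z : Prop := forall e : R, 0 < e -> exists2 r : R, 0 < r &
  forall h, modc h < r -> modc (f (z + h) - f z) < e.

Lemma nbhs0_modc (P : set R[i]) :
  (\forall h \near (0 : R[i]^o)^', P h) <->
  exists2 r : R, 0 < r & forall h, h != 0 -> modc h < r -> P h.
Proof.
split.
  move=> /nbhs_ballP[e /= e0 H].
  (* In the order of [R[i]], [0 < e] forces [e] to be real. *)
  have [er ee] : exists r : R, e = r%:C.
    by exists (complex.Re e); apply/complex_ext => //=; move: e0; rewrite ltcE => /andP[/eqP].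
  subst e; exists er; first by move: e0; rewrite ltcR.
  move=> h h0 hr; apply: H => //.
  by rewrite /ball/= sub0r normrN normc_modc ltcR.
move=> [r r0 H]; apply/nbhs_ballP; exists r%:C => /=; first by rewrite ltcR.
move=> h; rewrite /ball/= sub0r normrN normc_modc ltcR => hr h0.
exact: H.
Qed.

Lemma entireP f : entire f <-> forall z, exists d, cdiff f z d.
Proof.
split=> H z; have := H z.
  rewrite /derivable => /cvg_ex[d /cvgrPdist_lt D]; exists d => e e0.
  have e0' : 0 < e%:C by rewrite ltcR.
  have /nbhs0_modc[r r0 K] := D _ e0'.
  exists r => // h hr; have [->|h0] := eqVneq h 0.
    by rewrite addr0 mulr0 subr0 subrr modc0 mulr0.
  have := K h h0 hr; rewrite /= normc_modc ltcR => Kh.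
  rewrite -(modc_gt0) in h0.
  have hh : h != 0 by rewrite -modc_gt0.
  have -> : f (z + h) - f z - d * h = - (h * (d - h^-1 *: (f (h *: (1 : R[i]^o) + z) - f z))).
    rewrite mulrBr /GRing.scale/= mulrA divff// mul1r mulr1 (addrC z) (mulrC h).
    ring.
  by rewrite modcN modcM mulrC ler_pM2r// ltW.
move=> [d D]; apply/cvg_ex; exists d; apply/cvgrPdist_lt => e e0.
have [er ee] : exists r : R, e = r%:C.
  by exists (complex.Re e); apply/complex_ext => //=; move: e0; rewrite ltcE => /andP[/eqP].
subst e; rewrite ltcR in e0.
have [r r0 K] := D _ (divr_gt0 e0 (@ltr0n R 2)).
apply/nbhs0_modc; exists r => // h h0 hr /=.
rewrite normc_modc ltcR.
have := K h hr.
have -> : f (z + h) - f z - d * h = - (h * (d - h^-1 *: (f (h *: (1 : R[i]^o) + z) - f z))).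
  rewrite mulrBr /GRing.scale/= mulrA divff// mul1r mulr1 (addrC z) (mulrC h).
  ring.
rewrite modcN modcM mulrC ler_pM2r ?modc_gt0// => /le_lt_trans; apply.
by rewrite ltr_pdivrMr// ltr_pMr// ltr1n.
Qed.

Lemma cdiff_ccont f z d : cdiff f z d -> ccont f z.
Proof.
move=> D e e0; have [r r0 K] := D 1 ltr01.
have k0 : 0 < 2 + modc d by have := modc_ge0 d; lra.
exists (Num.min r (e / (2 + modc d))); first by rewrite lt_min r0 divr_gt0.
move=> h; rewrite lt_min => /andP[hr he].
have -> : f (z + h) - f z = (f (z + h) - f z - d * h) + d * h by ring.
apply: le_lt_trans (modcD _ _) _; rewrite modcM.
have := K h hr; move: he; rewrite ltr_pdivlMr//.
have := modc_ge0 h; nra.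
Qed.

Lemma entire_ccont f : entire f -> forall z, ccont f z.
Proof. by move=> /entireP E z; have [d] := E z; exact: cdiff_ccont. Qed.

Lemma cdiff_cst c z : cdiff (fun=> c) z 0.
Proof.
move=> e e0; exists 1 => // h _; rewrite subrr mul0r subrr modc0.
by rewrite mulr_ge0 ?modc_ge0// ltW.
Qed.

Lemma cdiff_id z : cdiff (fun w => w) z 1.
Proof.
move=> e e0; exists 1 => // h _; have -> : z + h - z - 1 * h = 0 by ring.
by rewrite modc0 mulr_ge0 ?modc_ge0// ltW.
Qed.

Lemma cdiffD f g z a b : cdiff f z a -> cdiff g z b ->
  cdiff (fun w => f w + g w) z (a + b).
Proof.
move=> F G e e0; have e2 : 0 < e / 2 by rewrite divr_gt0.
have [r r0 K] := F _ e2; have [s s0 L] := G _ e2.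
exists (Num.min r s); first by rewrite lt_min r0.
move=> h; rewrite lt_min => /andP[/K Kh /L Lh].
have -> : f (z + h) + g (z + h) - (f z + g z) - (a + b) * h =
  (f (z + h) - f z - a * h) + (g (z + h) - g z - b * h) by ring.
apply: le_trans (modcD _ _) _; lra.
Qed.

Lemma cdiffM f g z a b : cdiff f z a -> cdiff g z b ->
  cdiff (fun w => f w * g w) z (a * g z + f z * b).
Proof.
(* The increment splits into three terms, each a factor of size at most [M] times one controlled by
   [e / (3 * M)]. The [+ 1] covers [f (z + h)], which is why the radius [t'] is taken. *)
move=> F G e e0; pose M := modc (f z) + modc (g z) + modc b + 1.
have M1 : 1 <= M by rewrite /M lerDr !addr_ge0 ?modc_ge0.
have M0 : 0 < M by exact: lt_le_trans M1.
have e3 : 0 < e / (3 * M) by rewrite divr_gt0 ?mulr_gt0.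
have [r r0 K] := F _ e3; have [s s0 L] := G _ e3.
have [t t0 N] := cdiff_ccont F e3.
have [t' t0' N'] := cdiff_ccont F ltr01.
exists (Num.min (Num.min r s) (Num.min t t')); first by rewrite !lt_min r0 s0 t0.
move=> h; rewrite !lt_min => /andP[/andP[/K Kh /L Lh] /andP[/N Nh /N' Nh']].
have -> : f (z + h) * g (z + h) - f z * g z - (a * g z + f z * b) * h =
  (f (z + h) - f z) * (b * h) + f (z + h) * (g (z + h) - g z - b * h)
  + g z * (f (z + h) - f z - a * h) by ring.
have h0 := modc_ge0 h.
have [f0 g0 b0] : [/\ 0 <= modc (f z), 0 <= modc (g z) & 0 <= modc b].
  by split; exact: modc_ge0.
have fM : modc (f (z + h)) <= M.
  have -> : f (z + h) = f z + (f (z + h) - f z) by ring.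
  by apply: le_trans (modcD _ _) _; rewrite /M; lra.
have bM : modc b <= M by rewrite /M; lra.
have gM : modc (g z) <= M by rewrite /M; lra.
set ee := e / (3 * M) in e3 Kh Lh Nh.
have -> : e * modc h = ee * (M * modc h) + M * (ee * modc h) + M * (ee * modc h).
  by rewrite /ee; field; rewrite gt_eqF.
apply: le_trans (modcD _ _) _; apply: lerD.
  apply: le_trans (modcD _ _) _; rewrite !modcM; apply: lerD.
    by apply: ler_pM; rewrite ?mulr_ge0 ?modc_ge0// ?(ltW Nh)// ler_wpM2r.
  by apply: ler_pM; rewrite ?modc_ge0.
by rewrite modcM; apply: ler_pM; rewrite ?modc_ge0.
Qed.

Lemma cdiff_comp f g z a b : cdiff f z a -> cdiff g (f z) b ->
  cdiff (g \o f) z (b * a).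
Proof.
move=> F G e e0; pose M := modc a + 1.
have M1 : 1 <= M by rewrite lerDr modc_ge0.
have M0 : 0 < M by exact: lt_le_trans M1.
pose B := modc b + 1.
have B0 : 0 < B by rewrite ltr_pwDr// modc_ge0.
have e3 : 0 < e / (2 * M) by rewrite divr_gt0 ?mulr_gt0.
have e4 : 0 < e / (2 * B) by rewrite divr_gt0 ?mulr_gt0.
have [s s0 L] := G _ e3.
have [r r0 K] := F _ e4; have [r' r0' K'] := F _ ltr01.
have [t t0 N] := cdiff_ccont F s0.
exists (Num.min (Num.min r r') t); first by rewrite !lt_min r0 r0' t0.
move=> h; rewrite !lt_min => /andP[/andP[/K Kh /K' Kh'] /N/L].
rewrite subrKC => Lh /=.
have -> : g (f (z + h)) - g (f z) - b * a * h =
  (g (f (z + h)) - g (f z) - b * (f (z + h) - f z)) + b * (f (z + h) - f z - a * h) by ring.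
apply: le_trans (modcD _ _) _; rewrite modcM.
have fM : modc (f (z + h) - f z) <= M * modc h.
  have -> : f (z + h) - f z = (f (z + h) - f z - a * h) + a * h by ring.
  apply: le_trans (modcD _ _) _; rewrite modcM; rewrite /M; lra.
have P1 : modc (g (f (z + h)) - g (f z) - b * (f (z + h) - f z)) <= e / 2 * modc h.
  apply: le_trans Lh _.
  have -> : e / 2 * modc h = e / (2 * M) * (M * modc h).
    by field; rewrite gt_eqF.
  by rewrite ler_pM2l.
have P2 : modc b * modc (f (z + h) - f z - a * h) <= e / 2 * modc h.
  have -> : e / 2 * modc h = B * (e / (2 * B) * modc h).
    by field; rewrite gt_eqF.
  by apply: ler_pM; rewrite ?modc_ge0// lerDl.
lra.
Qed.

Lemma cdiff_cexp z : cdiff (@cexp R) z (cexp z).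
Proof.
move=> e e0; pose M := modc (cexp z) * 8 * expR 1.
have M0 : 0 < M by rewrite /M modc_cexp !mulr_gt0 ?expR_gt0.
exists (Num.min 1 (e / M)); first by rewrite lt_min ltr01 divr_gt0.
move=> h; rewrite lt_min => /andP[h1 he].
have -> : cexp (z + h) - cexp z - cexp z * h = cexp z * (cexp h - 1 - h).
  by rewrite cexpD; ring.
rewrite modcM.
have := cexp_taylor1 h.
have : expR (modc h) <= expR 1 by rewrite ler_expR ltW.
move: he; rewrite ltr_pdivlMr// => he he1 he2.
have h0 := modc_ge0 h.
apply: (@le_trans _ _ (modc (cexp z) * (8 * modc h ^+ 2 * expR 1))).
  rewrite ler_wpM2l ?modc_ge0//; apply: le_trans he2 _.
  by rewrite ler_wpM2l// mulr_ge0// exprn_ge0.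
have -> : modc (cexp z) * (8 * modc h ^+ 2 * expR 1) = M * modc h * modc h.
  by rewrite /M; ring.
by rewrite ler_wpM2r// mulrC ltW.
Qed.

Lemma entire_cst (c : R[i]) : entire (fun=> c).
Proof. by apply/entireP => z; exists 0; exact: cdiff_cst. Qed.

Lemma entire_id : entire (fun z : R[i] => z).
Proof. by apply/entireP => z; exists 1; exact: cdiff_id. Qed.

Lemma entireD f g : entire f -> entire g -> entire (fun z => f z + g z).
Proof.
move=> /entireP F /entireP G; apply/entireP => z.
by have [a A] := F z; have [b B] := G z; exists (a + b); exact: cdiffD.
Qed.

Lemma entireM f g : entire f -> entire g -> entire (fun z => f z * g z).
Proof.
move=> /entireP F /entireP G; apply/entireP => z.
by have [a A] := F z; have [b B] := G z; exists (a * g z + f z * b); exact: cdiffM.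
Qed.

Lemma entireB f g : entire f -> entire g -> entire (fun z => f z - g z).
Proof.
move=> eF eG; have := entireD eF (entireM (@entire_cst (-1)) eG).
by congr (entire _); apply/funext => z; rewrite mulN1r.
Qed.

Lemma entire_comp f g : entire f -> entire g -> entire (g \o f).
Proof.
move=> /entireP F /entireP G; apply/entireP => z.
by have [a A] := F z; have [b B] := G (f z); exists (b * a); exact: cdiff_comp.
Qed.

Lemma entire_cexp : entire (@cexp R).
Proof. by apply/entireP => z; exists (cexp z); exact: cdiff_cexp. Qed.

Lemma entire_affine (a b : R[i]) : entire (fun z => a + b * z).
Proof.
apply: entireD; first exact: entire_cst.
by apply: entireM; [exact: entire_cst|exact: entire_id].
Qed.

End ComplexPlane.

(** * Cauchy's theorem on rectangles and circle means *)

Section LineIntegral.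
Variable R : realType.
Notation mu := (@lebesgue_measure R).
Implicit Types (a b m x y M : R) (f g : R -> R) (phi psi : R -> R[i]).

Lemma integrable_segment f a b : continuous f ->
  mu.-integrable `[a, b] (EFin \o f).
Proof.
move=> cf; apply: continuous_compact_integrable; first exact: segment_compact.
exact: continuous_subspaceT.
Qed.

Definition rint f a b : R := (\int[mu]_(t in `[a, b]) f t)%R.

Lemma rintD f g a b : continuous f -> continuous g ->
  rint (fun t => f t + g t) a b = rint f a b + rint g a b.
Proof. by move=> cf cg; rewrite /rint RintegralD//; exact: integrable_segment. Qed.

Lemma rintN f a b : continuous f ->
  rint (fun t => - f t) a b = - rint f a b.
Proof.
move=> cf; rewrite /rint -mulN1r -RintegralZl//; last exact: integrable_segment.
by under [in RHS]eq_Rintegral do rewrite mulN1r.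
Qed.

Lemma rint_split f a m b : continuous f -> a <= m -> m <= b ->
  rint f a b = rint f a m + rint f m b.
Proof.
move=> cf am mb; apply/eqP; rewrite addrC -subr_eq; apply/eqP.
rewrite /rint Rintegral_itvB ?bnd_simp//; last exact: integrable_segment.
apply: Rintegral_itv_obnd_cbnd.
apply: integrableS (@integrable_segment _ m b cf) => //.
by apply: subset_itvr; rewrite bnd_simp.
Qed.

Lemma rint_affine p q a b : a <= b ->
  rint (fun t => p + q * t) a b = p * (b - a) + q * (b ^+ 2 - a ^+ 2) / 2.
Proof.
rewrite le_eqVlt => /predU1P[->|ab].
  by rewrite /rint set_itv1 Rintegral_set1 !subrr !mulr0 mul0r addr0.
pose F (x : R) := p * x + q / 2 * x ^+ 2.
have dF (x : R) : is_derive x 1 F (p + q * x).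
  rewrite /F; apply: is_derive_eq.
  by rewrite /GRing.scale/= !mulr1 -mulr_natr; field.
have cF : continuous F.
  by move=> x; apply/differentiable_continuous/derivable1_diffP.
rewrite /rint /Rintegral (@continuous_FTC2 _ _ F)//.
- by rewrite /F -EFinB /=; field.
- apply: continuous_subspaceT => x; apply: cvgD; first exact: cvg_cst.
  by apply: cvgM; [exact: cvg_cst|exact: cvg_id].
- split.
  + by move=> x _; apply: ex_derive.
  + by apply: cvg_at_right_filter; exact: cF.
  + by apply: cvg_at_left_filter; exact: cF.
- by move=> x _; rewrite derive1E; apply: derive_val.
Qed.

Lemma rint_le f a b M : continuous f -> a <= b ->
  (forall t, a <= t <= b -> `|f t| <= M) -> `|rint f a b| <= M * (b - a).
Proof.
move=> cf ab fM.
have mab : measurable (`[a, b]%classic : set (measurableTypeR R)).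
  exact: measurable_itv.
have h := le_normr_Rintegral mab (@integrable_segment f a b cf).
apply: (le_trans h); clear h.
have -> : M * (b - a) = rint (fun t => M + 0 * t) a b.
  by rewrite rint_affine// !mul0r addr0.
apply: le_Rintegral => //.
- by apply: integrable_segment => t; apply: cvg_norm; exact: cf.
- apply: integrable_segment => t; apply: cvgD; first exact: cvg_cst.
  by apply: cvgM; [exact: cvg_cst|exact: cvg_id].
- by move=> t tab; rewrite mul0r addr0; exact: fM.
Qed.

Definition ccurve phi := continuous (fun t => complex.Re (phi t)) /\
  continuous (fun t => complex.Im (phi t)).

Definition iint phi a b : R[i] :=
  rint (fun t => complex.Re (phi t)) a b +i* rint (fun t => complex.Im (phi t)) a b.

Lemma eq_iint phi psi a b : phi =1 psi -> iint phi a b = iint psi a b.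
Proof. by move=> /funext ->. Qed.

Lemma ccurveP phi :
  (forall t e, 0 < e -> exists2 r : R, 0 < r &
     forall h, `|h| < r -> modc (phi (t + h) - phi t) < e) -> ccurve phi.
Proof.
move=> H; split=> t; apply/cvgrPdist_lt => e e0; have [r r0 K] := H t e e0;
  apply/nbhs_ballP; exists r => //= s; rewrite /ball/= => ts.
  have := K (s - t); rewrite subrKC distrC => /(_ ts).
  by apply: le_lt_trans; rewrite distrC -ReN -ReD modc_Re.
have := K (s - t); rewrite subrKC distrC => /(_ ts).
by apply: le_lt_trans; rewrite distrC -ImN -ImD modc_Im.
Qed.

Lemma ccurveB phi psi : ccurve phi -> ccurve psi ->
  ccurve (fun t => phi t - psi t).
Proof.
move=> [p1 p2] [q1 q2]; split=> t; rewrite /continuous_at.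
  rewrite ReD ReN; under eq_fun do rewrite ReD ReN.
  by apply: cvgB; [exact: p1|exact: q1].
rewrite ImD ImN; under eq_fun do rewrite ImD ImN.
by apply: cvgB; [exact: p2|exact: q2].
Qed.

Lemma iintB phi psi a b : ccurve phi -> ccurve psi ->
  iint (fun t => phi t - psi t) a b = iint phi a b - iint psi a b.
Proof.
move=> [p1 p2] [q1 q2]; apply: complex_ext; rewrite !ReImE/=.
  under eq_fun do rewrite ReD ReN.
  by rewrite rintD// ?rintN// => t; apply: cvgN; exact: q1.
under eq_fun do rewrite ImD ImN.
by rewrite rintD// ?rintN// => t; apply: cvgN; exact: q2.
Qed.

(** The real and imaginary parts are bounded separately, hence the factor [2]. *)
Lemma iint_le phi a b M : ccurve phi -> a <= b ->
  (forall t, a <= t <= b -> modc (phi t) <= M) ->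
  modc (iint phi a b) <= 2 * M * (b - a).
Proof.
move=> [p1 p2] ab H; apply: le_trans (modc_leReIm _) _.
rewrite -mulrA mulr_natl mulr2n; apply: lerD; apply: rint_le => // t /H.
  exact/le_trans/modc_Re.
exact/le_trans/modc_Im.
Qed.

Lemma iint_split phi a m b : ccurve phi -> a <= m -> m <= b ->
  iint phi a b = iint phi a m + iint phi m b.
Proof.
by move=> [p1 p2] am mb; apply: complex_ext; rewrite !ReImE/=; exact: rint_split.
Qed.

Lemma iint_affine (p q : R[i]) a b : a <= b ->
  iint (fun t => p + q * t%:C) a b =
  p * (b - a)%:C + q * ((b ^+ 2 - a ^+ 2) / 2)%:C.
Proof.
move=> ab; apply: complex_ext; rewrite !ReImE/= !mulr0 ?subr0 ?add0r mulrA.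
  by rewrite -rint_affine//; congr rint; apply/funext => t; rewrite !ReImE/= mulr0 subr0.
by rewrite -rint_affine//; congr rint; apply/funext => t; rewrite !ReImE/= mulr0 add0r.
Qed.

End LineIntegral.

(** * Nested squares *)

Section Bisection.
Variable R : realType.
Implicit Types (x y k : R).

(* Either [P] holds or one quarter of the square violates it; the nested
   squares obtained by iterating shrink to a point at which the local
   hypothesis applies. *)
Lemma bisection (W H : R) (P : R -> R -> R -> Prop) : 0 < W -> 0 < H ->
  (forall x y k, 0 < k -> P x y (k / 2) -> P (x + k / 2 * W) y (k / 2) ->
     P x (y + k / 2 * H) (k / 2) -> P (x + k / 2 * W) (y + k / 2 * H) (k / 2) ->
     P x y k) ->
  (forall x0 y0, exists2 r, 0 < r & forall x y k, 0 < k -> k < r ->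
     x <= x0 <= x + k * W -> y <= y0 <= y + k * H -> P x y k) ->
  forall x y k, 0 < k -> P x y k.
Proof.
move=> W0 H0 split4 loc x0 y0 k0 k0_gt0; apply: contrapT => nP.
pose st := (R * R)%type.
(* The hypotheses stand under the existential so that [choice] yields a total selection function. *)
have step (k : R) (s : st) : exists s' : st, 0 < k -> ~ P s.1 s.2 k ->
    [/\ ~ P s'.1 s'.2 (k / 2), s.1 <= s'.1 <= s.1 + k / 2 * W &
        s.2 <= s'.2 <= s.2 + k / 2 * H].
  case: (pselect (0 < k)) => [kk|]; last by exists s.
  case: (pselect (P s.1 s.2 k)) => [|nPs]; first by exists s.
  have kW : 0 < k / 2 * W by rewrite mulr_gt0// divr_gt0.
  have kH : 0 < k / 2 * H by rewrite mulr_gt0// divr_gt0.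
  apply: contrapT => /forallNP no; apply: nPs.
  by apply: split4 => //; apply: contrapT => nP'; [apply: (no (s.1, s.2))|
    apply: (no (s.1 + k / 2 * W, s.2))|apply: (no (s.1, s.2 + k / 2 * H))|
    apply: (no (s.1 + k / 2 * W, s.2 + k / 2 * H))] => _ _; split => //=;
    rewrite ?lexx ?lerDl ?(ltW kW) ?(ltW kH).
have /choice[nx nxP] : forall ks : R * st, exists s' : st, 0 < ks.1 -> ~ P ks.2.1 ks.2.2 ks.1 ->
    [/\ ~ P s'.1 s'.2 (ks.1 / 2), ks.2.1 <= s'.1 <= ks.2.1 + ks.1 / 2 * W &
        ks.2.2 <= s'.2 <= ks.2.2 + ks.1 / 2 * H].
  by case=> k s; exact: step.
pose K n := k0 / 2 ^+ n.
have Kgt n : 0 < K n by rewrite divr_gt0// exprn_gt0.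
have KS n : K n.+1 = K n / 2 by rewrite /K exprS; field; rewrite expf_neq0.
pose fix s (n : nat) : st := if n is m.+1 then nx (K m, s m) else (x0, y0).
have Q n : ~ P (s n).1 (s n).2 (K n).
  elim: n => [|n IH]; first by rewrite /K expr0 divr1.
  by have [] := nxP (K n, s n) (Kgt n) IH; rewrite KS.
have S1 n : (s n).1 <= (s n.+1).1 <= (s n).1 + K n / 2 * W.
  by have [] := nxP (K n, s n) (Kgt n) (Q n).
have S2 n : (s n).2 <= (s n.+1).2 <= (s n).2 + K n / 2 * H.
  by have [] := nxP (K n, s n) (Kgt n) (Q n).
(* The left endpoints increase and the right endpoints [u n + K n * V] decrease, so the supremum of
   the left endpoints lies in every interval. *)
have lim (V : R) (u : nat -> R) : 0 < V ->
    (forall n, u n <= u n.+1 <= u n + K n / 2 * V) ->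
    exists X, forall n, u n <= X <= u n + K n * V.
  move=> V0 hu.
  have mono n d : u n <= u (n + d)%N.
    elim: d => [|d IH]; first by rewrite addn0.
    by rewrite addnS (le_trans IH)//; have /andP[] := hu (n + d)%N.
  have bd n d : u (n + d)%N + K (n + d)%N * V <= u n + K n * V.
    elim: d => [|d IH]; first by rewrite addn0.
    rewrite addnS; apply: le_trans IH.
    by have /andP[_] := hu (n + d)%N; rewrite KS; lra.
  have ub n m : u m <= u n + K n * V.
    have [nm|mn] := leqP n m.
      rewrite -(subnKC nm); apply: le_trans (bd n (m - n)%N).
      by rewrite lerDl mulr_ge0// ltW.
    apply: (@le_trans _ _ (u n)); last by rewrite lerDl mulr_ge0 ?ltW// Kgt.
    by rewrite -(subnKC (ltnW mn)).
  exists (sup (range u)) => n; apply/andP; split.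
    apply: ub_le_sup; last by exists n.
    by exists (u 0%N + K 0%N * V) => _ [m _ <-].
  by apply: ge_sup; [exists (u 0%N); exists 0%N|move=> _ [m _ <-]].
have [X hX] := lim W _ W0 S1; have [Y hY] := lim H _ H0 S2.
have [r r0 Pr] := loc X Y.
have [n Kn] : exists n, K n < r.
  have [n hn] : exists n : nat, k0 / r < n%:R.
    by exists (Num.bound (k0 / r)); rewrite archi_boundP// divr_ge0// ltW.
  exists n; rewrite /K ltr_pdivrMr ?exprn_gt0// mulrC -ltr_pdivrMr//.
  apply: lt_trans hn _; rewrite -natrX ltr_nat; exact: ltn_expl.
exact: (Q n) (Pr _ _ _ (Kgt n) Kn (hX n) (hY n)).
Qed.

End Bisection.

Section CauchyGoursat.
Variable R : realType.
Implicit Types (a b c d x y M : R) (F G : R[i] -> R[i]).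

Definition hline F y a b := iint (fun s => F (s +i* y)) a b.
Definition vline F x c d := iint (fun t => F (x +i* t)) c d.
(** The counterclockwise boundary integral of [[a, b] x [c, d]]; the factor ['i] is [dz / dt] on the
    vertical sides. *)
Definition rect_int F a b c d : R[i] :=
  hline F c a b - hline F d a b + 'i * (vline F b c d - vline F a c d).

Lemma ccurve_hline F y : (forall z, ccont F z) -> ccurve (fun s => F (s +i* y)).
Proof.
move=> cF; apply: ccurveP => t e e0; have [r r0 K] := cF (t +i* y) e e0.
exists r => // h hr; have := K h%:C; rewrite modc_Creal => /(_ hr).
by rewrite (_ : t +i* y + h%:C = (t + h) +i* y)//; apply: complex_ext; rewrite !ReImE/= ?addr0.
Qed.

Lemma ccurve_vline F x : (forall z, ccont F z) -> ccurve (fun t => F (x +i* t)).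
Proof.
move=> cF; apply: ccurveP => t e e0; have [r r0 K] := cF (x +i* t) e e0.
exists r => // h hr; have := K (0 +i* h).
have -> : modc (0 +i* h) = `|h| by rewrite modcE/= expr0n add0r sqrtr_sqr.
move=> /(_ hr).
by rewrite (_ : x +i* t + 0 +i* h = x +i* (t + h))//; apply: complex_ext; rewrite !ReImE/= ?addr0.
Qed.

Lemma rect_intB F G a b c d : (forall z, ccont F z) -> (forall z, ccont G z) ->
  rect_int (fun z => F z - G z) a b c d = rect_int F a b c d - rect_int G a b c d.
Proof.
move=> cF cG; rewrite /rect_int /hline /vline.
have hF y := ccurve_hline y cF; have hG y := ccurve_hline y cG.
have vF x := ccurve_vline x cF; have vG x := ccurve_vline x cG.
by rewrite !iintB//; ring.
Qed.

Lemma rect_int_le F a b c d M : (forall z, ccont F z) -> a <= b -> c <= d ->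
  (forall x y, a <= x <= b -> c <= y <= d -> modc (F (x +i* y)) <= M) ->
  modc (rect_int F a b c d) <= 4 * M * ((b - a) + (d - c)).
Proof.
move=> cF ab cd H; rewrite /rect_int.
have aa : a <= a <= b by rewrite lexx.
have bb : a <= b <= b by rewrite lexx ab.
have cc : c <= c <= d by rewrite lexx.
have dd : c <= d <= d by rewrite lexx cd.
have i1 : modc ('i : R[i]) = 1 by rewrite modcE/= expr0n add0r sqrtr_sqr normr1.
apply: le_trans (modcD _ _) _; rewrite modcM i1 mul1r.
have h1 : modc (hline F c a b) <= 2 * M * (b - a).
  by apply: iint_le => // [|t tt]; [exact: ccurve_hline|exact: H].
have h2 : modc (hline F d a b) <= 2 * M * (b - a).
  by apply: iint_le => // [|t tt]; [exact: ccurve_hline|exact: H].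
have h3 : modc (vline F b c d) <= 2 * M * (d - c).
  by apply: iint_le => // [|t tt]; [exact: ccurve_vline|exact: H].
have h4 : modc (vline F a c d) <= 2 * M * (d - c).
  by apply: iint_le => // [|t tt]; [exact: ccurve_vline|exact: H].
have := modcB (hline F c a b) (hline F d a b).
have := modcB (vline F b c d) (vline F a c d).
lra.
Qed.

(** This allows the first-order Taylor polynomial of the integrand to be subtracted for free in
    [goursat]. *)
Lemma rect_int_affine (p q : R[i]) a b c d : a <= b -> c <= d ->
  rect_int (fun z => p + q * z) a b c d = 0.
Proof.
move=> ab cd; rewrite /rect_int /hline /vline.
have H y : iint (fun s => p + q * (s +i* y)) a b =
    (p + q * 'i * y%:C) * (b - a)%:C + q * ((b ^+ 2 - a ^+ 2) / 2)%:C.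
  rewrite -iint_affine//; apply: eq_iint => t.
  by apply: complex_ext; rewrite !ReImE/=; ring.
have V x : iint (fun t => p + q * (x +i* t)) c d =
    (p + q * x%:C) * (d - c)%:C + q * 'i * ((d ^+ 2 - c ^+ 2) / 2)%:C.
  rewrite -iint_affine//; apply: eq_iint => t.
  by apply: complex_ext; rewrite !ReImE/=; ring.
rewrite !H !V; clear H V; case: p => p1 p2; case: q => q1 q2.
by apply/eqP; rewrite eq_complex/=; apply/andP; split; apply/eqP; field.
Qed.

Lemma rect_int_split F a m b c n d : (forall z, ccont F z) ->
  a <= m -> m <= b -> c <= n -> n <= d ->
  rect_int F a b c d = rect_int F a m c n + rect_int F m b c n +
    rect_int F a m n d + rect_int F m b n d.
Proof.
move=> cF am mb cn nd; rewrite /rect_int /hline /vline.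
have hF y := ccurve_hline y cF; have vF x := ccurve_vline x cF.
rewrite (iint_split (hF c) am mb) (iint_split (hF d) am mb).
by rewrite (iint_split (vF a) cn nd) (iint_split (vF b) cn nd); ring.
Qed.

(* Goursat: pointwise complex differentiability suffices, without continuity
   of the derivative. *)
Lemma goursat F a b c d : entire F -> a < b -> c < d -> rect_int F a b c d = 0.
Proof.
move=> eF ab cd; have cF := entire_ccont eF.
apply/eqP; rewrite -modc_eq0 eq_le modc_ge0 andbT.
apply/ler_addgt0Pl => e e0; rewrite addr0.
pose W := b - a; pose H := d - c.
have W0 : 0 < W by rewrite subr_gt0.
have H0 : 0 < H by rewrite subr_gt0.
(* A bound quadratic in the scale survives the subdivision: the four quarters contribute
   [4 * e * (k / 2)^2 = e * k^2]. *)
suff : forall x y k, 0 < k ->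
    modc (rect_int F x (x + k * W) y (y + k * H)) <= e * k ^+ 2.
  by move=> /(_ a c 1 ltr01); rewrite !mul1r expr1n mulr1 /W /H !subrKC.
apply: (@bisection R W H) => //.
  move=> x y k k0 A B C D.
  have kW : 0 < k / 2 * W by rewrite mulr_gt0// divr_gt0.
  have kH : 0 < k / 2 * H by rewrite mulr_gt0// divr_gt0.
  have Ex : x + k * W = x + k / 2 * W + k / 2 * W by field.
  have Ey : y + k * H = y + k / 2 * H + k / 2 * H by field.
  rewrite (@rect_int_split F x (x + k / 2 * W) _ y (y + k / 2 * H))//; last 4 first.
  - by rewrite lerDl ltW.
  - by rewrite Ex lerDl ltW.
  - by rewrite lerDl ltW.
  - by rewrite Ey lerDl ltW.
  rewrite Ex Ey.
  have -> : e * k ^+ 2 = e * (k / 2) ^+ 2 + e * (k / 2) ^+ 2 + e * (k / 2) ^+ 2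
     + e * (k / 2) ^+ 2 by field.
  do 3 (apply: le_trans (modcD _ _) _; apply: lerD => //).
move=> x0 y0; pose z0 := x0 +i* y0.
have [dz D] := (entireP F).1 eF z0.
have WH : 0 < W + H by rewrite addr_gt0.
(* Points of the rectangle are within [k * (W + H)] of [z0], and [rect_int_le] contributes another
   [4 * k * (W + H)]; this choice makes the product exactly [e * k ^+ 2]. *)
have e1 : 0 < e / (4 * (W + H) ^+ 2).
  by rewrite divr_gt0// mulr_gt0// exprn_gt0.
have [r r0 K] := D _ e1.
exists (r / (W + H)); first by rewrite divr_gt0.
move=> x y k k0 kr hx hy.
have xk : x <= x + k * W by rewrite lerDl mulr_ge0 ?ltW.
have yk : y <= y + k * H by rewrite lerDl mulr_ge0 ?ltW.
pose L z := (F z0 - dz * z0) + dz * z.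
have cL z : ccont L z by apply: entire_ccont; exact: entire_affine.
have -> : rect_int F x (x + k * W) y (y + k * H) =
    rect_int (fun z => F z - L z) x (x + k * W) y (y + k * H).
  by rewrite rect_intB// rect_int_affine// subr0.
pose M := e / (4 * (W + H) ^+ 2) * (k * (W + H)).
have cFL := entire_ccont (entireB eF (@entire_affine R (F z0 - dz * z0) dz)).
apply: le_trans (rect_int_le (M := M) cFL xk yk _) _.
  move=> s t /andP[xs sx] /andP[yt ty].
  have [/andP[x1 x2] /andP[y1 y2]] := (hx, hy).
  have m1 : modc (s +i* t - z0) <= k * (W + H).
    apply: le_trans (modc_leReIm _) _; rewrite mulrDr !ReImE/=.
    by apply: lerD; rewrite ler_norml; lra.
  have := K (s +i* t - z0); rewrite subrKC => /(_ _)/le_trans h.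
  rewrite /L (_ : _ - _ = F (s +i* t) - F z0 - dz * (s +i* t - z0)); last by ring.
  apply: h; last by rewrite ler_pM2l.
  by apply: le_lt_trans m1 _; rewrite -ltr_pdivlMr.
rewrite /M; move: (W) (H) WH => w h wh.
have -> // : 4 * (e / (4 * (w + h) ^+ 2) * (k * (w + h))) *
  (x + k * w - x + (y + k * h - y)) = e * k ^+ 2.
by field; rewrite gt_eqF.
Qed.

Lemma iint_cst (c : R[i]) a b : a <= b -> iint (fun=> c) a b = c * (b - a)%:C.
Proof.
move=> ab; have := iint_affine c 0 ab; rewrite mul0r addr0 => <-.
by apply: eq_iint => t; rewrite mul0r addr0.
Qed.

(* In the logarithmic coordinate [z = exp (s + i t)] circles become vertical
   segments, and Goursat's theorem on rectangles makes the circle mean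
   independent of the radius. *)
Lemma circle_mean G : entire G ->
  iint (fun t => G (cos t +i* sin t)) 0 (pi *+ 2) = (pi *+ 2)%:C * G 0.
Proof.
move=> eG; pose F := G \o @cexp R; pose T : R := pi *+ 2.
have T0 : 0 < T by rewrite pmulrn_rgt0// pi_gt0.
have eF : entire F by exact: (entire_comp (@entire_cexp R) eG).
have cF := entire_ccont eF.
(* The horizontal sides cancel by the period [2 pi i] of [cexp]. *)
have hper s : hline F 0 s 0 = hline F T s 0.
  apply: eq_iint => t; rewrite /F/=; congr (G (_ * _)); rewrite /=.
  by rewrite /T cos2pi sin2pi cos0 sin0.
have E s : s < 0 -> vline F s 0 T = iint (fun t => G (cos t +i* sin t)) 0 T.
  move=> s0; have := goursat eF s0 T0; rewrite /rect_int hper subrr add0r.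
  move/eqP; rewrite mulf_eq0 => /orP[/eqP[]|].
    by move/eqP; rewrite oner_eq0.
  rewrite subr_eq0 => /eqP <-; apply: eq_iint => t.
  by rewrite /F/= /cexp/= expR0 mul1r.
apply/eqP; rewrite -subr_eq0 -modc_eq0 eq_le modc_ge0 andbT.
apply/ler_addgt0Pl => e e0; rewrite addr0.
have [r r0 K] := entire_ccont eG 0 (divr_gt0 e0 (mulr_gt0 (@ltr0n R 2) T0)).
(* The circle of radius [expR s] lies in the disc where [G] is close to [G 0]; the cap [-1] keeps
   [s] negative, as [E] requires. *)
pose s := Num.min (-1) (ln (r / 2)).
have s0 : s < 0 by rewrite gt_min ltrN10.
rewrite -/T -(E _ s0) mulrC.
have -> : G 0 * T%:C = iint (fun=> G 0) 0 T by rewrite iint_cst ?subr0// ltW.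
rewrite /vline -iintB; last 2 first.
  exact: ccurve_vline.
  by split=> t /=; exact: cst_continuous.
apply: le_trans (iint_le (M := e / (2 * T)) _ (ltW T0) _) _.
- apply: ccurveB; first exact: ccurve_vline.
  by split=> t /=; exact: cst_continuous.
- move=> t _; have := K (cexp (s +i* t)); rewrite add0r modc_cexp/= => h.
  apply/ltW/h; apply: (@le_lt_trans _ _ (r / 2)); last by rewrite ltr_pdivrMr// ltr_pMr// ltr1n.
  have r2 : 0 < r / 2 by rewrite divr_gt0.
  by rewrite -[leRHS]lnK ?posrE// ler_expR ge_min lexx orbT.
have -> // : 2 * (e / (2 * T)) * (T - 0) = e.
by move: (T) T0 => U U0; field; rewrite gt_eqF.
Qed.

Lemma circle_mean_at G (v : R[i]) : entire G ->
  iint (fun t => G (v * (cos t +i* sin t))) 0 (pi *+ 2) = (pi *+ 2)%:C * G 0.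
Proof.
move=> eG.
have eGv : entire (G \o (fun z => 0 + v * z)).
  exact: (entire_comp (@entire_affine R 0 v) eG).
rewrite -[X in G X](_ : 0 + v * 0 = 0); last by rewrite mulr0 addr0.
rewrite -(circle_mean eGv); apply: eq_iint => t /=.
by rewrite add0r.
Qed.

End CauchyGoursat.

(** * Complex-valued integrals *)

Section ComplexMeasurable.
Context d (T : measurableType d) (R : realType).
Implicit Types (phi psi : T -> R[i]).

Definition cmeas phi :=
  measurable_fun setT (fun x => complex.Re (phi x) : measurableTypeR R) /\
  measurable_fun setT (fun x => complex.Im (phi x) : measurableTypeR R).

Lemma cmeas_cst (c : R[i]) : cmeas (fun=> c).
Proof. by split; exact: measurable_cst. Qed.

Lemma cmeasD phi psi : cmeas phi -> cmeas psi -> cmeas (fun x => phi x + psi x).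
Proof.
move=> [p1 p2] [q1 q2]; split.
  by under eq_fun do rewrite ReD; exact: measurable_funD.
by under eq_fun do rewrite ImD; exact: measurable_funD.
Qed.

Lemma cmeasM phi psi : cmeas phi -> cmeas psi -> cmeas (fun x => phi x * psi x).
Proof.
move=> [p1 p2] [q1 q2]; split.
  under eq_fun do rewrite ReM.
  by apply: measurable_funB; exact: measurable_funM.
under eq_fun do rewrite ImM.
by apply: measurable_funD; exact: measurable_funM.
Qed.

Lemma cmeasB phi psi : cmeas phi -> cmeas psi -> cmeas (fun x => phi x - psi x).
Proof.
move=> p q; have := cmeasD p (cmeasM (cmeas_cst (-1)) q).
by congr cmeas; apply/funext => x; rewrite mulN1r.
Qed.

Lemma cmeasJ phi : cmeas phi -> cmeas (fun x => (phi x)^*).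
Proof.
move=> [p1 p2]; split; first by under eq_fun do rewrite ReJ.
by under eq_fun do rewrite ImJ; apply: measurableT_comp.
Qed.

Lemma cmeas_real (f : T -> R) :
  measurable_fun setT (f : T -> measurableTypeR R) -> cmeas (fun x => (f x)%:C).
Proof. by move=> mf; split => //=; exact: measurable_cst. Qed.

Lemma measurable_modc phi : cmeas phi ->
  measurable_fun setT (fun x => modc (phi x) : measurableTypeR R).
Proof.
move=> [p1 p2]; under eq_fun do rewrite modcE.
apply: measurableT_comp => //; first exact: (continuous_measurable_fun (@sqrt_continuous R)).
by apply: measurable_funD; apply: measurable_funX.
Qed.

Lemma cmeas_comp d' (U : measurableType d') (g : U -> T) phi :
  measurable_fun setT g -> cmeas phi ->
  measurable_fun setT (fun x => complex.Re (phi (g x)) : measurableTypeR R) /\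
  measurable_fun setT (fun x => complex.Im (phi (g x)) : measurableTypeR R).
Proof.
move=> mg [p1 p2]; split.
  exact: (measurableT_comp p1 mg).
exact: (measurableT_comp p2 mg).
Qed.

End ComplexMeasurable.

(** * Joint measurability of Caratheodory functions *)

Section Caratheodory.
Context d (T : measurableType d) (R : realType).

(** Once the second variable is rounded down to a grid, a preimage is a countable union of
    measurable rectangles, one for each value [k] of the floor. *)
Lemma measurable_floor_comp (f : T * measurableTypeR R -> R) (N : nat) :
  (forall y, measurable_fun setT (fun x => f (x, y) : measurableTypeR R)) ->
  measurable_fun setT
    (fun xy => f (xy.1, (Num.floor (N%:R * (xy.2 : R)))%:~R / N%:R) : measurableTypeR R).
Proof.
move=> mf _ B mB; rewrite setTI.
rewrite (_ : _ @^-1` _ = \bigcup_(k : int)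
   (((fun x => f (x, k%:~R / N%:R)) @^-1` B) `*`
    ((fun y : R => N%:R * y) @^-1` `[k%:~R, k%:~R + 1[))); last first.
  apply/seteqP; split => [[x y] /= Bxy|[x y] /= [k _ [/= Bk]]].
    exists (Num.floor (N%:R * (y : R))) => //; split => //=.
    by rewrite in_itv/=; have := floor_itv (N%:R * (y : R)); rewrite intrD mulr1z.
  rewrite in_itv/= => h; suff -> : Num.floor (N%:R * (y : R)) = k by [].
  by apply: floor_def; rewrite intrD mulr1z.
apply: countable_bigcupT_measurable => [|k]; first exact: countableP.
apply: measurableX.
  by rewrite -[X in measurable X]setTI; exact: mf.
rewrite -[X in measurable X]setTI.
have h : measurable_fun setT (fun y : measurableTypeR R => (N%:R * (y : R) : measurableTypeR R)).
  exact: measurable_funM.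
apply: h => //; exact: measurable_itv.
Qed.

(** By continuity in the second variable, [f] is the pointwise limit of its roundings on finer and
    finer grids. *)
Lemma measurable_caratheodory (f : T * measurableTypeR R -> R) :
  (forall y, measurable_fun setT (fun x => f (x, y) : measurableTypeR R)) ->
  (forall x, continuous (fun y : R => f (x, y))) ->
  measurable_fun setT (f : _ -> measurableTypeR R).
Proof.
move=> mf cf.
pose q (n : nat) (y : R) : R := (Num.floor (n.+1%:R * y))%:~R / n.+1%:R.
have qy n y : `|q n y - y| <= n.+1%:R^-1.
  have n0 : (0 : R) < n.+1%:R by [].
  have := floor_itv (n.+1%:R * y); rewrite intrD /q.
  move: (Num.floor _)%:~R => k /andP[h1 h2].
  have -> : k / n.+1%:R - y = (k - n.+1%:R * y) / n.+1%:R.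
    by field; rewrite gt_eqF.
  rewrite normrM normfV [X in _ / X]ger0_norm// ler_piMl ?invr_ge0//.
  by rewrite ler_norml; move: h2; rewrite mulr1z; lra.
apply: (@measurable_fun_cvg _ _ _ _ (fun n xy => f (xy.1, q n xy.2))).
  by move=> n; exact: measurable_floor_comp.
move=> [x y] _ /=.
have qcvg : (fun n => q n y) @ \oo --> (y : R).
  apply/cvgrPdist_le => e e0; near=> n.
  rewrite distrC (le_trans (qy n y))// ltW//.
  by near: n; exact: (near_infty_natSinv_lt (PosNum e0)).
by apply: (@cvg_comp _ _ _ (fun n => q n y) (fun t : R => f (x, t)) _ _ _ qcvg); exact: (cf x).
Unshelve. all: by end_near. Qed.

End Caratheodory.

Section ComplexIntegral.
Context d (T : measurableType d) (R : realType) (mu : {measure set T -> \bar R}).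
Implicit Types (phi psi : T -> R[i]).

Definition cint phi : R[i] :=
  Rintegral mu setT (fun x => complex.Re (phi x)) +i*
  Rintegral mu setT (fun x => complex.Im (phi x)).

Definition cintegrable phi :=
  mu.-integrable setT (EFin \o (fun x => complex.Re (phi x))) /\
  mu.-integrable setT (EFin \o (fun x => complex.Im (phi x))).

Lemma eq_cint phi psi : phi =1 psi -> cint phi = cint psi.
Proof. by move=> /funext ->. Qed.

Lemma cintegrable_le phi (g : T -> \bar R) : cmeas phi ->
  (forall x, ((modc (phi x))%:E <= g x)%E) ->
  measurable_fun setT g -> (\int[mu]_x g x < +oo)%E -> cintegrable phi.
Proof.
move=> [p1 p2] hg mg ig.
have ig' : mu.-integrable setT g.
  apply/integrableP; split => //; under eq_integral => x _.
    rewrite gee0_abs; last by apply: le_trans (hg x); rewrite lee_fin modc_ge0.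
    over.
  by [].
split; apply: le_integrable ig' => //.
- exact/measurable_EFinP.
- move=> x _ /=; apply: le_trans (lee_abs _).
  by apply: le_trans (hg x); rewrite lee_fin modc_Re.
- exact/measurable_EFinP.
- move=> x _ /=; apply: le_trans (lee_abs _).
  by apply: le_trans (hg x); rewrite lee_fin modc_Im.
Qed.

Lemma cintegrableP phi : cmeas phi ->
  (\int[mu]_x (modc (phi x))%:E < +oo)%E -> cintegrable phi.
Proof.
move=> mp ip; apply: (cintegrable_le mp _ _ ip) => //.
exact/measurable_EFinP/measurable_modc.
Qed.

Lemma cintegrable_cmeas phi : cintegrable phi -> cmeas phi.
Proof.
by move=> [i1 i2]; split; apply/measurable_EFinP; exact: (measurable_int mu).
Qed.

Lemma cintegrable_lty phi : cintegrable phi ->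
  (\int[mu]_x (modc (phi x))%:E < +oo)%E.
Proof.
move=> ip; have [m1 m2] := cintegrable_cmeas ip; case: ip => i1 i2.
apply: (@le_lt_trans _ _ (\int[mu]_x
   (`|(complex.Re (phi x))%:E| + `|(complex.Im (phi x))%:E|))%E).
  apply: ge0_le_integral => //.
  - by move=> x _; rewrite lee_fin modc_ge0.
  - by apply/measurable_EFinP/measurable_modc.
  - by apply: emeasurable_funD; apply: measurableT_comp => //; apply/measurable_EFinP.
  - by move=> x _; rewrite /= -EFinD lee_fin modc_leReIm.
rewrite ge0_integralD//.
- by move/integrableP: i1 => [_ i1]; move/integrableP: i2 => [_ i2]; exact: lte_add_pinfty.
- by apply: measurableT_comp => //; exact/measurable_EFinP.
- by apply: measurableT_comp => //; exact/measurable_EFinP.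
Qed.

Lemma cintD phi psi : cintegrable phi -> cintegrable psi ->
  cint (fun x => phi x + psi x) = cint phi + cint psi.
Proof.
move=> [p1 p2] [q1 q2]; apply: complex_ext; rewrite !ReImE/=.
  by rewrite -RintegralD//; apply: eq_Rintegral => x _; rewrite ReD.
by rewrite -RintegralD//; apply: eq_Rintegral => x _; rewrite ImD.
Qed.

Lemma cintZ (c : R[i]) phi : cintegrable phi ->
  cint (fun x => c * phi x) = c * cint phi.
Proof.
move=> [p1 p2].
have iZ (a : R) (f : T -> R) : mu.-integrable setT (EFin \o f) ->
    mu.-integrable setT (EFin \o (fun x => a * f x)).
  by move=> fi; exact: (integrableZl measurableT a fi).
apply: complex_ext; rewrite !ReImE/=.
  rewrite -!RintegralZl// -RintegralB//; try exact: iZ.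
  by apply: eq_Rintegral => x _; rewrite ReM.
rewrite -!RintegralZl// -RintegralD//; try exact: iZ.
by apply: eq_Rintegral => x _; rewrite ImM.
Qed.

Lemma cintegrableZ (c : R[i]) phi : cintegrable phi -> cintegrable (fun x => c * phi x).
Proof.
move=> ip; have mp := cintegrable_cmeas ip.
apply: cintegrableP; first by apply: cmeasM => //; exact: cmeas_cst.
under eq_integral do rewrite modcM EFinM.
rewrite ge0_integralZl//.
- by rewrite lte_mul_pinfty ?cintegrable_lty// lee_fin modc_ge0.
- exact/measurable_EFinP/measurable_modc.
- by move=> x _; rewrite lee_fin modc_ge0.
- by rewrite lee_fin modc_ge0.
Qed.

Lemma cintegrableD phi psi : cintegrable phi -> cintegrable psi ->
  cintegrable (fun x => phi x + psi x).
Proof.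
move=> [p1 p2] [q1 q2]; split.
  have := integrableD measurableT p1 q1.
  by apply: eq_integrable => // x _ /=; rewrite ReD.
have := integrableD measurableT p2 q2.
by apply: eq_integrable => // x _ /=; rewrite ImD.
Qed.

Lemma cintegrableB phi psi : cintegrable phi -> cintegrable psi ->
  cintegrable (fun x => phi x - psi x).
Proof.
move=> p q; have := cintegrableD p (cintegrableZ (-1) q).
by congr cintegrable; apply/funext => x; rewrite mulN1r.
Qed.

Lemma cintB phi psi : cintegrable phi -> cintegrable psi ->
  cint (fun x => phi x - psi x) = cint phi - cint psi.
Proof.
move=> p q; rewrite -mulN1r -cintZ// -cintD//; last exact: cintegrableZ.
by apply: eq_cint => x; rewrite mulN1r.
Qed.

Lemma cintJ phi : cintegrable phi -> cint (fun x => (phi x)^*) = (cint phi)^*.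
Proof.
move=> [_ i2]; apply: complex_ext; rewrite !ReImE/=.
  by apply: eq_Rintegral => x _; rewrite ReJ.
rewrite -mulN1r -RintegralZl//; apply: eq_Rintegral => x _.
by rewrite ImJ mulN1r.
Qed.

(** Stated in [\bar R] so that measurability suffices: when the right side is infinite there is
    nothing to prove. *)
Lemma modc_cint_le phi : cmeas phi ->
  ((modc (cint phi))%:E <= 2%:E * \int[mu]_x (modc (phi x))%:E)%E.
Proof.
move=> mp; have [->|ip] := eqVneq (\int[mu]_x (modc (phi x))%:E)%E +oo%E.
  by rewrite gt0_muley ?leey// lte_fin.
have ip' : (\int[mu]_x (modc (phi x))%:E < +oo)%E by rewrite ltey.
have [i1 i2] := cintegrableP mp ip'; case: (mp) => m1 m2.
have H (f : T -> R) : mu.-integrable setT (EFin \o f) ->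
    (forall x, `|f x| <= modc (phi x)) ->
    ((`|Rintegral mu setT f|)%:E <= \int[mu]_x (modc (phi x))%:E)%E.
  move=> fi fle; have mf := measurable_int mu fi.
  rewrite EFin_normr_Rintegral//; apply: le_trans (le_abse_integral _ _ _) _ => //.
  apply: ge0_le_integral => //; first exact: measurableT_comp.
    exact/measurable_EFinP/measurable_modc.
  by move=> x _; rewrite /= lee_fin.
apply: (@le_trans _ _ (`|Rintegral mu setT (fun x => complex.Re (phi x))|%:E +
   `|Rintegral mu setT (fun x => complex.Im (phi x))|%:E)%E).
  by rewrite -EFinD lee_fin; exact: (modc_leReIm (cint phi)).
rewrite (_ : 2%:E = 1 + 1)%E; last by rewrite -EFinD.
rewrite ge0_muleDl//; apply: leeD; rewrite mul1e; apply: H => // x.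
  exact: modc_Re.
exact: modc_Im.
Qed.

End ComplexIntegral.

(** * Fubini's theorem for complex integrands *)

Section ComplexFubini.
Context d1 d2 (T1 : measurableType d1) (T2 : measurableType d2) (R : realType).
Variables (m1 : {sigma_finite_measure set T1 -> \bar R})
          (m2 : {sigma_finite_measure set T2 -> \bar R}).

(** Integrability of every section, and not just of almost every one, makes all inner integrals
    finite, so that [fine] can be undone pointwise. *)
Lemma Rintegral_fubini (f : T1 * T2 -> R) :
  measurable_fun setT (f : _ -> measurableTypeR R) ->
  (forall x, m2.-integrable setT (fun y => (f (x, y))%:E)) ->
  (forall y, m1.-integrable setT (fun x => (f (x, y))%:E)) ->
  (\int[m1]_x \int[m2]_y `|(f (x, y))%:E| < +oo)%E ->
  Rintegral m1 setT (fun x => Rintegral m2 setT (fun y => f (x, y))) =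
  Rintegral m2 setT (fun y => Rintegral m1 setT (fun x => f (x, y))).
Proof.
move=> mf i2 i1 fin; rewrite /Rintegral; congr fine.
have If : (m1 \x m2)%E.-integrable setT (EFin \o f).
  by apply/integrable12ltyP => //; exact/measurable_EFinP.
transitivity (\int[m1]_x \int[m2]_y (f (x, y))%:E)%E.
  apply: eq_integral => x _; rewrite fineK//; exact: integrable_fin_num.
rewrite (Fubini If); apply: eq_integral => y _.
by rewrite fineK//; exact: integrable_fin_num.
Qed.

Lemma measurable_Rintegral2 (f : T1 * T2 -> R) :
  measurable_fun setT (f : _ -> measurableTypeR R) ->
  (\int[m1]_x \int[m2]_y `|(f (x, y))%:E| < +oo)%E ->
  measurable_fun setT (fun x => Rintegral m2 setT (fun y => f (x, y)) : measurableTypeR R).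
Proof.
move=> mf fin.
have If : (m1 \x m2)%E.-integrable setT (EFin \o f).
  by apply/integrable12ltyP => //; exact/measurable_EFinP.
apply: measurableT_comp => //; exact: (measurable_fubini_F If).
Qed.

Lemma cint_fubini (f : T1 * T2 -> R[i]) : cmeas f ->
  (forall x, cintegrable m2 (fun y => f (x, y))) ->
  (forall y, cintegrable m1 (fun x => f (x, y))) ->
  (\int[m1]_x \int[m2]_y (modc (f (x, y)))%:E < +oo)%E ->
  cint m1 (fun x => cint m2 (fun y => f (x, y))) =
  cint m2 (fun y => cint m1 (fun x => f (x, y))).
Proof.
move=> mf i2 i1 fin; case: (mf) => mf1 mf2.
have lt (h : R[i] -> R) : measurable_fun setT (h \o f : _ -> measurableTypeR R) ->
    (forall z, `|h z| <= modc z) ->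
    (\int[m1]_x \int[m2]_y `|(h (f (x, y)))%:E| < +oo)%E.
  move=> mh hz; apply: le_lt_trans fin.
  have m1f : measurable_fun setT (fun xy => `|(h (f xy))%:E|%E).
    by apply: measurableT_comp => //; exact/measurable_EFinP.
  have m2f : measurable_fun setT (fun xy => (modc (f xy))%:E).
    exact/measurable_EFinP/measurable_modc.
  apply: ge0_le_integral => //.
  - by move=> x _; exact: integral_ge0.
  - by apply: (measurable_fun_fubini_tonelli_F (fun xy => `|(h (f xy))%:E|%E)).
  - apply: (measurable_fun_fubini_tonelli_F (fun xy => (modc (f xy))%:E)) => //.
    by move=> xy; rewrite lee_fin modc_ge0.
  - move=> x _; apply: ge0_le_integral => //.
    + exact: (measurable_fun_pair2 x m1f).
    + exact: (measurable_fun_pair2 x m2f).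
    + by move=> y _; rewrite /= lee_fin.
apply: complex_ext; rewrite /=.
  apply: (Rintegral_fubini mf1 _ _ (lt _ mf1 (@modc_Re R))).
    by move=> x; have [] := i2 x.
  by move=> y; have [] := i1 y.
apply: (Rintegral_fubini mf2 _ _ (lt _ mf2 (@modc_Im R))).
  by move=> x; have [] := i2 x.
by move=> y; have [] := i1 y.
Qed.

End ComplexFubini.

(** * Area measure and plane isometries *)

Section PlaneMeasure.
Variable R : realType.
Notation Pl := (measurableTypeR R * measurableTypeR R)%type.
Notation leb := (@lebesgue_measure R).

Lemma measurable_EFin d (T : measurableType d) (f : T -> R) :
  measurable_fun setT f -> measurable_fun setT (fun x => (f x)%:E).
Proof. by move=> mf; exact/measurable_EFinP. Qed.

(** Continuity along each coordinate line makes both parts of [f] Caratheodory functions of the two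
    coordinates. *)
Lemma cmeas_plane (f : R[i] -> R[i]) : (forall z, ccont f z) ->
  cmeas (fun x : Pl => f (plane x)).
Proof.
move=> cf.
have M (h : R[i] -> R) :
    (forall y, continuous (fun s => h (f (s +i* y)))) ->
    (forall x, continuous (fun t => h (f (x +i* t)))) ->
    measurable_fun setT (fun x : Pl => h (f (plane x)) : measurableTypeR R).
  move=> hx hy; apply: (measurable_caratheodory (f := fun x : Pl => h (f (plane x)))) => [y|x].
    exact: (continuous_measurable_fun (hx y)).
  exact: hy.
split; apply: M => [y|x].
- by have [] := ccurve_hline y cf.
- by have [] := ccurve_vline x cf.
- by have [] := ccurve_hline y cf.
- by have [] := ccurve_vline x cf.
Qed.

Lemma measurable_translation (a : R) :
  measurable_fun setT (fun x : measurableTypeR R => (x + a : measurableTypeR R)).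
Proof. exact: measurable_funD. Qed.

Section translation.
Variable a : R.
Let tr (x : measurableTypeR R) : measurableTypeR R := x + a.
Let tr_mixin := isMeasurableFun.Build _ _ _ _ tr (measurable_translation a).
Let tr_mfun : {mfun measurableTypeR R >-> measurableTypeR R} := HB.pack tr tr_mixin.

(** The pushforward of Lebesgue measure under a translation gives half-open intervals their length,
    so the two measures agree by uniqueness. *)
Lemma ge0_integral_translation (f : measurableTypeR R -> \bar R) :
  measurable_fun setT f -> (forall x, (0 <= f x)%E) ->
  (\int[leb]_x f ((x : R) + a)%R = \int[leb]_x f x)%E.
Proof.
move=> mf f0.
transitivity (\int[pushforward leb tr_mfun]_x f x)%E.
  by rewrite (ge0_integral_pushforward (measurable_translation a)).
apply: eq_measure_integral => A mA _.
apply/esym/(@lebesgue_measure_unique _ (pushforward leb tr_mfun)) => // X.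
move=> [[u v] /= _ <-]; rewrite /pushforward.
rewrite (_ : _ @^-1` _ = [set` `]u - a, v - a]]); last first.
  apply/seteqP; split=> x /=; rewrite !in_itv/= /tr => /andP[h1 h2];
    apply/andP; split; move: h1 h2; rewrite ?ltrBlDr ?lerBrDr//.
rewrite !lebesgue_measure_itv/= !lte_fin ltrD2r.
by case: ifPn => // _; rewrite -!EFinD; congr (_%:E); rewrite opprB addrA subrK.
Qed.

End translation.

Lemma ge0_integral_areaE (f : Pl -> \bar R) :
  measurable_fun setT f -> (forall x, (0 <= f x)%E) ->
  (\int[area R]_x f x = \int[leb]_x \int[leb]_y f (x, y))%E.
Proof. by move=> mf f0; exact: (fubini_tonelli1 f mf f0). Qed.

Lemma ge0_integral_areaE2 (f : Pl -> \bar R) :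
  measurable_fun setT f -> (forall x, (0 <= f x)%E) ->
  (\int[area R]_x f x = \int[leb]_y \int[leb]_x f (x, y))%E.
Proof. by move=> mf f0; exact: (fubini_tonelli2 f mf f0). Qed.

(** For a fixed second coordinate the shear translates the first one, so Tonelli reduces the claim
    to the line. Plane translations and rotations are then composed from shears. *)
Lemma ge0_integral_shear1 (t b : R) (f : Pl -> \bar R) :
  measurable_fun setT f -> (forall x, (0 <= f x)%E) ->
  (\int[area R]_x f ((x.1 : R) + t * (x.2 : R) + b, x.2)%R = \int[area R]_x f x)%E.
Proof.
move=> mf f0.
have ms : measurable_fun setT
    (fun x : Pl => ((x.1 : R) + t * (x.2 : R) + b, x.2) : Pl).
  apply: measurable_fun_pair => //; apply: measurable_funD => //.
  by apply: measurable_funD => //; apply: measurable_funM.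
rewrite (ge0_integral_areaE2 (measurableT_comp mf ms) (fun x => f0 _)).
rewrite (ge0_integral_areaE2 mf f0); apply: eq_integral => y _ /=.
rewrite -(@ge0_integral_translation (t * (y : R) + b) (fun x => f (x, y))).
- by apply: eq_integral => x _; rewrite addrA.
- exact: measurable_fun_pair1.
- by move=> x; exact: f0.
Qed.

Lemma ge0_integral_shear2 (t b : R) (f : Pl -> \bar R) :
  measurable_fun setT f -> (forall x, (0 <= f x)%E) ->
  (\int[area R]_x f (x.1, (x.2 : R) + t * (x.1 : R) + b)%R = \int[area R]_x f x)%E.
Proof.
move=> mf f0.
have ms : measurable_fun setT
    (fun x : Pl => (x.1, (x.2 : R) + t * (x.1 : R) + b) : Pl).
  apply: measurable_fun_pair => //; apply: measurable_funD => //.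
  by apply: measurable_funD => //; apply: measurable_funM.
rewrite (ge0_integral_areaE (measurableT_comp mf ms) (fun x => f0 _)).
rewrite (ge0_integral_areaE mf f0); apply: eq_integral => x _ /=.
rewrite -(@ge0_integral_translation (t * (x : R) + b) (fun y => f (x, y))).
- by apply: eq_integral => y _; rewrite addrA.
- exact: measurable_fun_pair2.
- by move=> y; exact: f0.
Qed.

Definition plane_translation (a : R * R) (x : Pl) : Pl :=
  ((x.1 : R) + a.1, (x.2 : R) + a.2).

Lemma measurable_plane_translation a :
  measurable_fun setT (plane_translation a).
Proof. by apply: measurable_fun_pair; apply: measurable_funD. Qed.

Lemma ge0_integral_plane_translation a (f : Pl -> \bar R) :
  measurable_fun setT f -> (forall x, (0 <= f x)%E) ->
  (\int[area R]_x f (plane_translation a x) = \int[area R]_x f x)%E.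
Proof.
move=> mf f0.
have m2 : measurable_fun setT
    (fun x : Pl => (x.1, (x.2 : R) + 0 * (x.1 : R) + a.2) : Pl).
  apply: measurable_fun_pair => //; apply: measurable_funD => //.
  by apply: measurable_funD => //; apply: measurable_funM.
rewrite -(ge0_integral_shear2 0 a.2 mf f0).
rewrite -[RHS](ge0_integral_shear1 0 a.1 (measurableT_comp mf m2) (fun x => f0 _)).
by apply: eq_integral => x _; rewrite /plane_translation/= !mul0r !addr0.
Qed.

Definition plane_rotation (c s : R) (x : Pl) : Pl :=
  (c * (x.1 : R) - s * (x.2 : R), s * (x.1 : R) + c * (x.2 : R)).

Lemma measurable_plane_rotation c s : measurable_fun setT (plane_rotation c s).
Proof.
apply: measurable_fun_pair.
  by apply: measurable_funB; apply: measurable_funM.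
by apply: measurable_funD; apply: measurable_funM.
Qed.

(* A rotation of angle [u] other than [pi] is a product of three shears, with
   parameters [- tan (u / 2)], [sin u], [- tan (u / 2)]. *)
Lemma ge0_integral_plane_rotation c s (f : Pl -> \bar R) :
  c ^+ 2 + s ^+ 2 = 1 -> measurable_fun setT f -> (forall x, (0 <= f x)%E) ->
  (\int[area R]_x f (plane_rotation c s x) = \int[area R]_x f x)%E.
Proof.
have main c' s' (g : Pl -> \bar R) : c' != -1 ->
    c' ^+ 2 + s' ^+ 2 = 1 -> measurable_fun setT g -> (forall x, (0 <= g x)%E) ->
    (\int[area R]_x g (plane_rotation c' s' x) = \int[area R]_x g x)%E.
  move=> c1 cs mg g0.
  have c1' : 1 + c' != 0 by rewrite addrC -subr_eq0 opprK in c1 *.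
  pose t := - (s' / (1 + c')).
  have m1 u : measurable_fun setT (fun x : Pl => ((x.1 : R) + u * (x.2 : R) + 0, x.2) : Pl).
    apply: measurable_fun_pair => //; apply: measurable_funD => //.
    by apply: measurable_funD => //; apply: measurable_funM.
  have m2 u : measurable_fun setT (fun x : Pl => (x.1, (x.2 : R) + u * (x.1 : R) + 0) : Pl).
    apply: measurable_fun_pair => //; apply: measurable_funD => //.
    by apply: measurable_funD => //; apply: measurable_funM.
  have mg1 := measurableT_comp mg (m1 t); have mg2 := measurableT_comp mg1 (m2 s').
  rewrite -[RHS](ge0_integral_shear1 t 0 mg g0).
  rewrite -[RHS](ge0_integral_shear2 s' 0 mg1 (fun x => g0 _)).
  rewrite -[RHS](ge0_integral_shear1 t 0 mg2 (fun x => g0 _)).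
  have B : s' + t * (1 + c') = 0 by rewrite /t; field.
  have A : 1 + t * s' - c' = 0.
    apply: (mulIf c1'); rewrite mul0r.
    have -> : (1 + t * s' - c') * (1 + c') = s' * (s' + t * (1 + c')) + 1 - (c' ^+ 2 + s' ^+ 2) by ring.
    by rewrite B cs mulr0 add0r subrr.
  apply: eq_integral => -[x y] _; rewrite /plane_rotation/=; congr (g (_, _)).
    have -> : c' * x - s' * y = x + t * y + 0 + t * (y + s' * (x + t * y + 0) + 0) + 0
       - (x * (1 + t * s' - c') + y * (s' + t * (1 + c')) + y * t * (1 + t * s' - c')) by ring.
    by rewrite A B !mulr0 !addr0 subr0.
  have -> : s' * x + c' * y = y + s' * (x + t * y + 0) + 0 - y * (1 + t * s' - c') by ring.
  by rewrite A mulr0 subr0.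
(* For the half turn the tangent of the half angle is infinite; it is done as two quarter turns
   instead. *)
have [->|c1] := eqVneq c (-1); last by move=> *; exact: main.
rewrite sqrrN expr1n -[RHS]addr0 => /addrI/eqP; rewrite sqrf_eq0 => /eqP -> mf f0.
have n1 : (0 : R) != -1 by rewrite eq_sym oppr_eq0 oner_eq0.
have e1 : (0 : R) ^+ 2 + 1 ^+ 2 = 1 by rewrite expr0n expr1n add0r.
have mf1 := measurableT_comp mf (measurable_plane_rotation 0 1).
rewrite -[RHS](main 0 1 f n1 e1 mf f0) -[RHS](main 0 1 _ n1 e1 mf1 (fun x => f0 _)).
apply: eq_integral => -[x y] _; rewrite /plane_rotation/=; congr (f (_, _)); ring.
Qed.

Lemma integral_preserving d (T : measurableType d) (mu : {measure set T -> \bar R})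
    (g : T -> T) :
  (forall f : T -> \bar R, measurable_fun setT f -> (forall x, (0 <= f x)%E) ->
    (\int[mu]_x f (g x) = \int[mu]_x f x)%E) ->
  forall f : T -> \bar R, measurable_fun setT f ->
    (\int[mu]_x f (g x) = \int[mu]_x f x)%E.
Proof.
move=> H f mf; rewrite integralE [RHS]integralE.
congr (_ - _)%E.
  rewrite -(H (f^\+)%E)//; last exact: measurable_funepos.
  by apply: eq_integral => x _; rewrite !funeposE.
rewrite -(H (f^\-)%E)//; last exact: measurable_funeneg.
by apply: eq_integral => x _; rewrite !funenegE.
Qed.

Lemma cint_preserving d (T : measurableType d) (mu : {measure set T -> \bar R})
    (g : T -> T) :
  (forall f : T -> \bar R, measurable_fun setT f -> (forall x, (0 <= f x)%E) ->
    (\int[mu]_x f (g x) = \int[mu]_x f x)%E) ->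
  forall phi, cmeas phi -> cint mu (fun x => phi (g x)) = cint mu phi.
Proof.
move=> H phi [m1 m2]; apply: complex_ext; rewrite /= /Rintegral; congr fine.
  apply: (integral_preserving H (f := fun x => (complex.Re (phi x))%:E)).
  exact/measurable_EFinP.
apply: (integral_preserving H (f := fun x => (complex.Im (phi x))%:E)).
exact/measurable_EFinP.
Qed.

Lemma integral_expR_sqr (b : R) : 0 < b ->
  (\int[leb]_x (expR (- b * (x : R) ^+ 2))%:E = (Num.sqrt (pi / b))%:E)%E.
Proof.
(* The centred normal density of variance [1 / (2 * b)] is a multiple of [expR (- b * x ^+ 2)], and
   its integral is one. *)
move=> b0; pose s := Num.sqrt ((2 * b)^-1).
have s0 : s != 0 by rewrite gt_eqF// sqrtr_gt0 invr_gt0 mulr_gt0.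
have s2 : s ^+ 2 = (2 * b)^-1 by rewrite sqr_sqrtr// invr_ge0 mulr_ge0// ltW.
have ps := normal_peak_gt0 s0.
have E x : expR (- b * x ^+ 2) = (normal_peak s)^-1 * normal_pdf 0 s x.
  rewrite normal_pdfE// mulKf ?gt_eqF// /normal_fun subr0; congr expR.
  by rewrite s2 -mulr_natr; field; rewrite gt_eqF.
under eq_integral do rewrite E EFinM.
rewrite ge0_integralZl//.
- rewrite integral_normal_pdf mule1 /normal_peak invrK s2; congr (Num.sqrt _)%:E.
  by rewrite -mulr_natr; field; rewrite gt_eqF.
- by apply: measurable_EFin; exact: measurable_normal_pdf.
- by move=> x _; rewrite lee_fin normal_pdf_ge0.
- by rewrite lee_fin invr_ge0 ltW.
Qed.

Definition sqn (x : R * R) : R := x.1 ^+ 2 + x.2 ^+ 2.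

Lemma sqnE x : sqn x = modc (plane x) ^+ 2.
Proof. by rewrite modc2. Qed.

Lemma measurable_sqn : measurable_fun setT (sqn : Pl -> R).
Proof.
by apply: measurable_funD; apply: measurable_funX; [exact: measurable_fst|exact: measurable_snd].
Qed.

Lemma measurable_gauss (b : R) :
  measurable_fun setT (fun x : Pl => expR (- b * sqn x) : measurableTypeR R).
Proof.
by apply: measurableT_comp => //; apply: measurable_funM => //; exact: measurable_sqn.
Qed.

Lemma integral_gauss (b : R) : 0 < b ->
  (\int[area R]_x (expR (- b * sqn x))%:E = (pi / b)%:E)%E.
Proof.
move=> b0; rewrite ge0_integral_areaE//; last exact: (measurable_EFin (measurable_gauss b)).
have m1 : measurable_fun setT (fun x : measurableTypeR R => (expR (- b * (x : R) ^+ 2))%:E).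
  apply: measurable_EFin; apply: measurableT_comp => //.
  by apply: measurable_funM => //; exact: measurable_funX.
under eq_integral => x _.
  under eq_integral => y _ do rewrite /sqn/= mulrDr expRD EFinM.
  rewrite (ge0_integralZl leb measurableT m1)//.
  over.
rewrite (ge0_integralZr leb measurableT m1)//; last first.
  by apply: integral_ge0 => x _; rewrite lee_fin expR_ge0.
rewrite integral_expR_sqr// -EFinM -expr2 sqr_sqrtr//.
by rewrite divr_ge0 ?pi_ge0// ltW.
Qed.

End PlaneMeasure.

(** * The Gaussian measure and the reproducing formula *)

Section Density.
Context d (T : measurableType d) (R : realType).
Variables (mu nu : {measure set T -> \bar R}) (rho : T -> R).
Hypotheses (rho0 : forall x, 0 <= rho x) (mrho : measurable_fun setT rho).
Hypothesis nuE : forall A, measurable A -> nu A = (\int[mu]_(x in A) (rho x)%:E)%E.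
Import HBNNSimple.

(** The relation between [nu] and [rho] is given on sets only; simple functions are the first step
    towards integrals, and monotone convergence is the second. *)
Lemma ge0_integral_density_nnsfun (h : {nnsfun T >-> R}) :
  (\int[nu]_x (h x)%:E = \int[mu]_x ((h x)%:E * (rho x)%:E))%E.
Proof.
have mrho' : measurable_fun setT (EFin \o rho) by exact/measurable_EFinP.
have hE x : ((h x)%:E = \sum_(y \in range h) (y * \1_(h @^-1` [set y]) x)%:E)%E.
  by rewrite fsumEFin// -fimfunE.
have mi y : measurable_fun setT (fun x => (y * \1_(h @^-1` [set y]) x)%:E).
  by apply/measurable_EFinP; apply: measurable_funM.
have h0 y x : (0 <= (y * \1_(h @^-1` [set y]) x)%:E)%E.
  by rewrite EFinM; exact: nnfun_muleindic_ge0.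
transitivity (\sum_(y \in range h) \int[nu]_x (y * \1_(h @^-1` [set y]) x)%:E)%E.
  by rewrite -ge0_integral_fsum//; apply: eq_integral => x _; exact: hE.
transitivity (\sum_(y \in range h) \int[mu]_x ((y * \1_(h @^-1` [set y]) x)%:E * (rho x)%:E))%E; last first.
  rewrite -ge0_integral_fsum//; last 2 first.
  - by move=> y; exact: emeasurable_funM.
  - by move=> y x _; rewrite mule_ge0// lee_fin.
  by apply: eq_integral => x _; rewrite hE ge0_mule_fsuml.
apply: eq_fsbigr => y _.
rewrite integralZl_indic_nnsfun// integral_indic// setIT nuE//.
rewrite [in LHS]integral_mkcond.
have [->|y0] := eqVneq y 0.
  by rewrite mul0e integral0_eq// => x _; rewrite mul0r mul0e.
(* The sign of [y] is known only for values of [h]; for any other [y] the level set is empty and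
   both sides vanish. *)
have [iy|niy] := boolP (y \in range h); last first.
  have -> : h @^-1` [set y] = set0.
    by apply/seteqP; split => // x /= hx; move: niy; rewrite -hx mem_set//; exists x.
  rewrite (@integral0_eq _ _ _ _ _ (_ \_ _)) ?mule0.
    by rewrite integral0_eq// => x _; rewrite indic0 mulr0 mul0e.
  by move=> x _; rewrite patch_set0.
have yge0 : 0 <= y by move: iy; rewrite inE => -[x _ <-].
rewrite -ge0_integralZl//; last 2 first.
- have mA : measurable (h @^-1` [set y]) by [].
  by apply/(measurable_restrictT (EFin \o rho) mA); exact: (measurable_funTS mrho').
- by move=> x _; rewrite patchE; case: ifPn => // _; rewrite lee_fin.
apply: eq_integral => x _; rewrite patchE indicE.
by case: ifPn => _; rewrite ?mulr1// mule0 mulr0 mul0e.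
Qed.

Lemma ge0_integral_density (f : T -> \bar R) :
  measurable_fun setT f -> (forall x, (0 <= f x)%E) ->
  (\int[nu]_x f x = \int[mu]_x (f x * (rho x)%:E))%E.
Proof.
move=> mf f0; pose h := nnsfun_approx measurableT mf.
have mrho' : measurable_fun setT (EFin \o rho) by exact/measurable_EFinP.
have hf x : EFin \o h^~ x @ \oo --> f x by exact: cvg_nnsfun_approx.
have nd x : {homo (fun n => (h n x)%:E) : m n / (m <= n)%N >-> (m <= n)%E}.
  by move=> m n mn; rewrite lee_fin; exact/lefP/nd_nnsfun_approx.
have -> : (\int[nu]_x f x = \int[nu]_x limn (fun n => (h n x)%:E))%E.
  by apply: eq_integral => x _; apply/esym/cvg_lim => //; exact: hf.
have -> : (\int[mu]_x (f x * (rho x)%:E) =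
    \int[mu]_x limn (fun n => (h n x)%:E * (rho x)%:E))%E.
  apply: eq_integral => x _; apply/esym/cvg_lim => //.
  by apply: cvgeZr => //; exact: hf.
rewrite !monotone_convergence//.
- by congr (limn _); apply/funext => n; exact: ge0_integral_density_nnsfun.
- move=> n; apply: emeasurable_funM => //; exact/measurable_EFinP.
- by move=> n x _; rewrite mule_ge0// lee_fin.
- by move=> x _ m n mn; rewrite lee_wpmul2r ?lee_fin//; exact: nd.
- by move=> n; exact/measurable_EFinP.
- by move=> n x _; rewrite lee_fin.
Qed.

Lemma integral_density (f : T -> \bar R) : measurable_fun setT f ->
  (\int[nu]_x f x = \int[mu]_x (f x * (rho x)%:E))%E.
Proof.
move=> mf; rewrite integralE [RHS]integralE; congr (_ - _)%E.
  rewrite ge0_integral_density//; last exact: measurable_funepos.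
  apply: eq_integral => x _; rewrite !funeposE.
  by rewrite maxe_pMl ?mul0e// lee_fin.
rewrite ge0_integral_density//; last exact: measurable_funeneg.
apply: eq_integral => x _; rewrite !funenegE.
by rewrite maxe_pMl ?mul0e ?mulNe// lee_fin.
Qed.

Lemma cint_density phi : cmeas phi ->
  cint nu phi = cint mu (fun x => phi x * (rho x)%:C).
Proof.
move=> [m1 m2]; apply: complex_ext; rewrite /= /Rintegral; congr fine.
  rewrite integral_density; last exact/measurable_EFinP.
  by apply: eq_integral => x _; rewrite ReM/= mulr0 subr0 EFinM.
rewrite integral_density; last exact/measurable_EFinP.
by apply: eq_integral => x _; rewrite ImM/= mulr0 add0r EFinM.
Qed.

End Density.

Section Gauss.
Variables (R : realType) (alpha : {posnum R}).
Notation Pl := (measurableTypeR R * measurableTypeR R)%type.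
Notation al := (alpha%:num).
Notation gauss := (gauss_measure alpha).

Lemma gauss_densityE (x : Pl) :
  gauss_density alpha x = al / pi * expR (- al * sqn x).
Proof. by rewrite /gauss_density sqnE. Qed.

Lemma ge0_integral_gauss (f : Pl -> \bar R) :
  measurable_fun setT f -> (forall x, (0 <= f x)%E) ->
  (\int[gauss]_x f x = \int[area R]_x (f x * (gauss_density alpha x)%:E))%E.
Proof.
apply: ge0_integral_density => //.
- exact: gauss_density_ge0.
- exact: measurable_gauss_density.
Qed.

Lemma cint_gauss (phi : Pl -> R[i]) : cmeas phi ->
  cint gauss phi = cint (area R) (fun x => phi x * (gauss_density alpha x)%:C).
Proof.
apply: cint_density => //.
- exact: gauss_density_ge0.
- exact: measurable_gauss_density.
Qed.

Lemma gauss_setT : gauss [set: Pl] = 1%E.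
Proof.
rewrite /gauss_measure.
under eq_integral do rewrite gauss_densityE EFinM.
rewrite ge0_integralZl//.
- rewrite integral_gauss// -EFinM; congr (_%:E).
  by rewrite mulrA divfK ?divff// gt_eqF// pi_gt0.
- exact: (measurable_EFin (measurable_gauss al)).
- by rewrite lee_fin divr_ge0 ?pi_ge0.
Qed.

(** This supplies the sigma-finiteness that the Fubini and Schur lemmas ask of [gauss]. *)
HB.instance Definition _ := @Measure_isProbability.Build _ _ R gauss gauss_setT.

Lemma cmeas_gauss_density (phi : Pl -> R[i]) : cmeas phi ->
  cmeas (fun x => phi x * (gauss_density alpha x)%:C).
Proof.
move=> mp; apply: cmeasM => //; apply: cmeas_real.
exact: measurable_gauss_density.
Qed.

Lemma sqn_rotation c s (x : Pl) : c ^+ 2 + s ^+ 2 = 1 ->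
  sqn (plane_rotation c s x) = sqn x.
Proof.
move=> cs; rewrite /sqn/=.
have -> : (c * x.1 - s * x.2) ^+ 2 + (s * x.1 + c * x.2) ^+ 2 =
  (c ^+ 2 + s ^+ 2) * (x.1 ^+ 2 + x.2 ^+ 2) by ring.
by rewrite cs mul1r.
Qed.

Lemma plane_rotationE c s (x : Pl) :
  plane (plane_rotation c s x) = plane x * (c +i* s).
Proof. by apply: complex_ext; rewrite !ReImE/=; ring. Qed.

Lemma ge0_integral_gauss_rotation c s (f : Pl -> \bar R) :
  c ^+ 2 + s ^+ 2 = 1 -> measurable_fun setT f -> (forall x, (0 <= f x)%E) ->
  (\int[gauss]_x f (plane_rotation c s x) = \int[gauss]_x f x)%E.
Proof.
move=> cs mf f0.
have mfr := measurableT_comp mf (measurable_plane_rotation c s).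
rewrite (ge0_integral_gauss mfr (fun x => f0 _)) (ge0_integral_gauss mf f0).
rewrite -[RHS](ge0_integral_plane_rotation cs).
- by apply: eq_integral => x _; rewrite !gauss_densityE sqn_rotation.
- apply: emeasurable_funM => //; apply: measurable_EFin; exact: measurable_gauss_density.
- by move=> x; rewrite mule_ge0// lee_fin gauss_density_ge0.
Qed.

Lemma cint_gauss_rotation c s (phi : Pl -> R[i]) : c ^+ 2 + s ^+ 2 = 1 ->
  cmeas phi -> cint gauss (fun x => phi (plane_rotation c s x)) = cint gauss phi.
Proof.
move=> cs; apply: cint_preserving => f mf f0; exact: ge0_integral_gauss_rotation.
Qed.

Lemma cint_cst (c : R[i]) : cint gauss (fun=> c) = c.
Proof.
apply: complex_ext; rewrite /= Rintegral_cst//.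
  by rewrite [X in fine X]gauss_setT mulr1.
by rewrite [X in fine X]gauss_setT mulr1.
Qed.

(** Spreading a segment integral over the whole line puts it in the form that [cint_fubini]
    accepts. *)
Lemma cint_indic_itv (a b : R) (phi : R -> R[i]) :
  cint (@lebesgue_measure R) (fun t : measurableTypeR R => (\1_(`[a, b]%classic : set R) (t : R))%:C * phi t) =
  iint phi a b.
Proof.
apply: complex_ext; rewrite /= /rint Rintegral_mkcond; apply: eq_Rintegral => t _;
  rewrite patchE !ReImE/= indicE; case: (_ \in _); rewrite ?mul1r ?mul0r ?subr0 ?addr0//.
Qed.

(** Integrate [G] at the rotated point over the plane and over all angles in [[0, 2 pi]]. Taking the
    angle first gives circle means, each equal to [2 pi * G 0]; taking the plane first gives [2 pi]
    times the Gaussian mean, by rotation invariance. Fubini equates the two, in place of polar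
    coordinates. *)
Lemma gauss_mean (G : R[i] -> R[i]) : entire G ->
  (\int[gauss]_x (modc (G (plane x)))%:E < +oo)%E ->
  cint gauss (fun x => G (plane x)) = G 0.
Proof.
move=> eG fin; pose T : R := pi *+ 2.
have T0 : 0 < T by rewrite pmulrn_rgt0// pi_gt0.
have mG : cmeas (fun x : Pl => G (plane x)) by apply: cmeas_plane; exact: entire_ccont.
pose leb := @lebesgue_measure R.
pose I : set R := `[0, T]%classic.
pose f (xt : Pl * measurableTypeR R) : R[i] :=
  (\1_I (xt.2 : R))%:C * G (plane (plane_rotation (cos (xt.2 : R)) (sin (xt.2 : R)) xt.1)).
have mrot : measurable_fun setT (fun xt : Pl * measurableTypeR R =>
    plane_rotation (cos (xt.2 : R)) (sin (xt.2 : R)) xt.1 : Pl).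
  have mc : measurable_fun setT (fun xt : Pl * measurableTypeR R => cos (xt.2 : R)).
    apply: measurableT_comp => //; exact: (continuous_measurable_fun (@continuous_cos R)).
  have ms : measurable_fun setT (fun xt : Pl * measurableTypeR R => sin (xt.2 : R)).
    apply: measurableT_comp => //; exact: (continuous_measurable_fun (@continuous_sin R)).
  have m1 : measurable_fun setT (fun xt : Pl * measurableTypeR R => (xt.1.1 : R)).
    by apply: measurableT_comp => //; exact: measurable_fst.
  have m2 : measurable_fun setT (fun xt : Pl * measurableTypeR R => (xt.1.2 : R)).
    by apply: measurableT_comp => //; exact: measurable_snd.
  apply: measurable_fun_pair.
    by apply: measurable_funB; apply: measurable_funM.
  by apply: measurable_funD; apply: measurable_funM.
have mI : measurable_fun setT (\1_I : measurableTypeR R -> R).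
  by apply: measurable_indic; exact: measurable_itv.
have mI' : measurable (I : set (measurableTypeR R)) by exact: measurable_itv.
have mf : cmeas f.
  apply: cmeasM; first by apply: cmeas_real; exact: measurableT_comp.
  by apply: (cmeas_comp mrot mG).
have modf x t : modc (f (x, t)) <= modc (G (plane (plane_rotation (cos t) (sin t) x))).
  rewrite /f modcM modc_Creal ger0_norm// ler_piMl ?modc_ge0//.
pose K := (\int[gauss]_x (modc (G (plane x)))%:E)%E.
have mmodG : measurable_fun setT (fun x : Pl => (modc (G (plane x)))%:E).
  exact: measurable_EFin (measurable_modc mG).
have cs t : cos t ^+ 2 + sin t ^+ 2 = 1 :> R by exact: cos2Dsin2.
have rotK t : (\int[gauss]_x (modc (G (plane (plane_rotation (cos t) (sin t) x))))%:E)%E = K.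
  apply: (ge0_integral_gauss_rotation (cs t) mmodG) => x.
  by rewrite lee_fin modc_ge0.
have mmodf : measurable_fun setT (fun xt => (modc (f xt))%:E).
  exact: measurable_EFin (measurable_modc mf).
have i1 t : cintegrable gauss (fun x => f (x, t)).
  apply: (@cintegrable_le _ _ _ _ _
    (fun x => (modc (G (plane (plane_rotation (cos t) (sin t) x))))%:E)).
  - case: mf => mf1 mf2; split.
      exact: (measurable_fun_pair1 t mf1).
    exact: (measurable_fun_pair1 t mf2).
  - by move=> x; rewrite lee_fin modf.
  - exact: measurableT_comp mmodG (measurable_plane_rotation _ _).
  - by rewrite rotK.
have fE x t : f (x, t) = (\1_I t)%:C * G (plane x * (cos t +i* sin t)).
  by rewrite /f plane_rotationE.
have cur x : ccurve (fun t => G (plane x * (cos t +i* sin t))).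
  have eGx := entire_comp (@entire_cexp R) (entire_comp (@entire_affine R 0 (plane x)) eG).
  have := ccurve_vline 0 (entire_ccont eGx).
  congr ccurve; apply/funext => t; rewrite /=/cexp/= add0r.
  by rewrite expR0 mul1r.
have i2 x : cintegrable leb (fun t => f (x, t)).
  have [c1 c2] := cur x; split.
    have := @integrable_segment _ _ 0 T c1.
    move/(integrable_mkcond _ mI').
    apply: eq_integrable => // t _ /=; rewrite patchE fE/= ReM/= indicE.
    by case: (_ \in _); rewrite ?mul1r ?mul0r subr0.
  have := @integrable_segment _ _ 0 T c2.
  move/(integrable_mkcond _ mI').
  apply: eq_integrable => // t _ /=; rewrite patchE fE/= ImM/= indicE.
  by case: (_ \in _); rewrite ?mul1r ?mul0r addr0.
have fin2 : (\int[gauss]_x \int[leb]_t (modc (f (x, t)))%:E < +oo)%E.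
  rewrite (fubini_tonelli (m1 := gauss) (m2 := leb) (fun xt => (modc (f xt))%:E))//; last first.
    by move=> xt; rewrite lee_fin modc_ge0.
  apply: (@le_lt_trans _ _ (\int[leb]_t ((\1_I t)%:E * K))%E).
    apply: ge0_le_integral => //.
    - by move=> t _; apply: integral_ge0 => x _; rewrite lee_fin modc_ge0.
    - apply: (measurable_fun_fubini_tonelli_G (m1 := gauss) (fun xt => (modc (f xt))%:E)) => //.
      by move=> xt; rewrite lee_fin modc_ge0.
    - by apply: emeasurable_funM => //; exact/measurable_EFinP.
    - move=> t _; rewrite -(rotK t) -ge0_integralZl//.
      + apply: ge0_le_integral => //.
        * by move=> x _; rewrite lee_fin modc_ge0.
        * exact: (measurable_fun_pair1 t mmodf).
        * by apply: emeasurable_funM => //; exact: measurableT_comp mmodG (measurable_plane_rotation _ _).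
        * by move=> x _; rewrite -EFinM lee_fin fE modcM modc_Creal plane_rotationE ger0_norm.
      + exact: measurableT_comp mmodG (measurable_plane_rotation _ _).
      + by move=> x _; rewrite lee_fin modc_ge0.
  have K0 : (0 <= K)%E by apply: integral_ge0 => x _; rewrite lee_fin modc_ge0.
  rewrite ge0_integralZr//.
  - have lI : @lebesgue_measure R I = (T%:E - 0%:E)%E.
      have := @lebesgue_measure_itv R `[0, T].
      by rewrite /= lte_fin T0 => <-.
    rewrite (integral_indic _ measurableT mI') setIT [X in (X * _)%E]lI lte_mul_pinfty//.
    by rewrite -EFinD lee_fin subr0 ltW.
  - exact/measurable_EFinP.
have := cint_fubini mf i2 i1 fin2.
have -> : cint gauss (fun x => cint leb (fun t => f (x, t))) = T%:C * G 0.
  rewrite -[RHS]cint_cst; apply: eq_cint => x.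
  rewrite -(circle_mean_at (plane x) eG) -cint_indic_itv.
  by apply: eq_cint => t; rewrite fE.
have -> : cint leb (fun t => cint gauss (fun x => f (x, t))) =
    cint gauss (fun x => G (plane x)) * T%:C.
  rewrite -[in RHS](subr0 T) -iint_cst; last exact: ltW.
  rewrite -cint_indic_itv; apply: eq_cint => t.
  rewrite -(cint_gauss_rotation (cs t) mG) -cintZ//.
  apply: (@cintegrable_le _ _ _ _ _
    (fun x => (modc (G (plane (plane_rotation (cos t) (sin t) x))))%:E)) => //.
  - exact: cmeas_comp (measurable_plane_rotation _ _) mG.
  - exact: measurableT_comp mmodG (measurable_plane_rotation _ _).
  - by rewrite rotK.
rewrite mulrC => /mulIf ->//.
by rewrite -modc_gt0 modc_Creal normr_gt0 gt_eqF.
Qed.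

Lemma rkerE (u w : R[i]) : rker alpha u w = cexp (al%:C * w * u^*).
Proof. by []. Qed.

Lemma plane_translationE (w : R[i]) (x : Pl) :
  plane (plane_translation (- complex.Re w, - complex.Im w) x) = plane x - w.
Proof. by apply: complex_ext; rewrite !ReImE/=. Qed.

(** Expanding [|x - w|^2] produces [alpha * (x conj w + w conj x)]. The extra exponential cancels
    the part holomorphic in [x], and the other part is the exponent of [rker alpha (plane x) w]. *)
Lemma gauss_density_translation (w : R[i]) (x : Pl) :
  (gauss_density alpha (plane_translation (- complex.Re w, - complex.Im w) x))%:C *
    cexp (- (al%:C * w^*) * (plane x - w)) =
  rker alpha (plane x) w * (gauss_density alpha x)%:C.
Proof.
rewrite !gauss_densityE.
set A := - al * _; set B := _ * (plane x - w); set D := - al * _.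
have H : (expR A)%:C * cexp B = rker alpha (plane x) w * (expR D)%:C.
  rewrite -!cexp_real /rker -!cexpD; congr cexp; rewrite /A /B /D.
  case: w {A B D} => a b; case: x => x y.
  by apply/eqP; rewrite eq_complex/= /sqn/=; apply/andP; split; apply/eqP; ring.
rewrite (rmorphM _ (al / pi) (expR A)) (rmorphM _ (al / pi) (expR D)) /=.
by rewrite -(mulrA (al / pi)%:C) H mulrCA.
Qed.

Lemma rkerJ (u w : R[i]) : (rker alpha u w)^* = rker alpha w u.
Proof.
rewrite /rker -cexpJ; congr cexp.
by apply: complex_ext; rewrite !ReImE/=; ring.
Qed.

Lemma entire_rker (w : R[i]) : entire (rker alpha w).
Proof.
have := entire_comp (@entire_affine R 0 (al%:C * w^*)) (@entire_cexp R).
congr entire; apply/funext => z.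
by rewrite /comp/= /rker add0r mulrAC.
Qed.

Lemma cmeas_rker (w : R[i]) : cmeas (fun x : Pl => rker alpha (plane x) w).
Proof.
have := cmeasJ (cmeas_plane (entire_ccont (@entire_rker w))).
by congr cmeas; apply/funext => x; rewrite rkerJ.
Qed.

(* The reproducing formula at [w] is the mean value property at [0] of
   [v |-> g (w + v) * cexp (- alpha * conj w * v)]. *)
Lemma gauss_reproducing (g : R[i] -> R[i]) (w : R[i]) : entire g ->
  (\int[gauss]_x (modc (g (plane x) * rker alpha (plane x) w))%:E < +oo)%E ->
  cint gauss (fun x => g (plane x) * rker alpha (plane x) w) = g w.
Proof.
move=> eg fin; pose G v := g (w + 1 * v) * cexp (0 + - (al%:C * w^*) * v).
have eG : entire G.
  apply: entireM.
    exact: (entire_comp (@entire_affine R w 1) eg).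
  exact: (entire_comp (@entire_affine R 0 (- (al%:C * w^*))) (@entire_cexp R)).
pose a := (- complex.Re w, - complex.Im w).
have GE x : G (plane (plane_translation a x)) * (gauss_density alpha (plane_translation a x))%:C =
    (g (plane x) * rker alpha (plane x) w) * (gauss_density alpha x)%:C.
  rewrite /G plane_translationE mul1r add0r subrKC.
  rewrite -(mulrA (g (plane x))) (mulrC (cexp _)) gauss_density_translation.
  by rewrite (mulrA (g (plane x))).
have mG : cmeas (fun x : Pl => G (plane x)) by apply: cmeas_plane; exact: entire_ccont.
have mk : cmeas (fun x : Pl => g (plane x) * rker alpha (plane x) w).
  apply: cmeasM; first by apply: cmeas_plane; exact: entire_ccont.
  exact: cmeas_rker.
have mGd := cmeas_gauss_density mG; have mkd := cmeas_gauss_density mk.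
have tr := @ge0_integral_plane_translation R a.
have dge x : 0 <= gauss_density alpha x := gauss_density_ge0 alpha x.
have modd (z : R[i]) x : ((modc z)%:E * (gauss_density alpha x)%:E = (modc (z * (gauss_density alpha x)%:C))%:E)%E.
  by rewrite modcM modc_Creal ger0_norm.
have -> : cint gauss (fun x => g (plane x) * rker alpha (plane x) w) =
    cint gauss (fun x => G (plane x)).
  rewrite (cint_gauss mk) (cint_gauss mG) -(cint_preserving tr mGd).
  by apply: eq_cint => x; rewrite GE.
rewrite (gauss_mean eG).
  by rewrite /G !mulr0 !addr0 cexp0 mulr1.
rewrite ge0_integral_gauss; last 2 first.
- exact: measurable_EFin (measurable_modc mG).
- by move=> x; rewrite lee_fin modc_ge0.
under eq_integral do rewrite modd.
rewrite -tr; last 2 first.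
- exact: measurable_EFin (measurable_modc mGd).
- by move=> x; rewrite lee_fin modc_ge0.
under eq_integral do rewrite GE -modd.
rewrite -ge0_integral_gauss//.
- exact: measurable_EFin (measurable_modc mk).
- by move=> x; rewrite lee_fin modc_ge0.
Qed.

End Gauss.

(** * Pointwise bounds *)

Section Pointwise.
Variables (R : realType) (alpha : {posnum R}).
Notation Pl := (measurableTypeR R * measurableTypeR R)%type.
Notation al := (alpha%:num).
Notation gauss := (gauss_measure alpha).

Lemma integral_gauss_shift (b : R) (w : R[i]) : 0 < b ->
  (\int[area R]_x (expR (- b * modc (plane x - w) ^+ 2))%:E = (pi / b)%:E)%E.
Proof.
move=> b0; rewrite -integral_gauss//.
rewrite -(@ge0_integral_plane_translation R (- complex.Re w, - complex.Im w)
  (fun x => (expR (- b * sqn x))%:E)).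
- by apply: eq_integral => x _; rewrite sqnE plane_translationE.
- exact: (measurable_EFin (measurable_gauss b)).
- by move=> x; rewrite lee_fin expR_ge0.
Qed.

(** The common form of the Gaussian integrals below: the hypothesis records the square completed
    after the weight has been included, and it also yields the measurability of [A]. *)
Lemma integral_gauss_expR (A : Pl -> R) (C b : R) (w : R[i]) : 0 < b ->
  (forall x, A x - al * sqn x = C - b * modc (plane x - w) ^+ 2) ->
  (\int[gauss]_x (expR (A x))%:E = (al / b * expR C)%:E)%E.
Proof.
move=> b0 hA.
have AE x : A x = C + al * sqn x - b * sqn (plane_translation (- complex.Re w, - complex.Im w) x).
  by rewrite (sqnE (plane_translation _ _)) plane_translationE; have := hA x; lra.
have mA : measurable_fun setT (fun x : Pl => (expR (A x))%:E).
  apply: measurable_EFin; apply: measurableT_comp => //.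
  rewrite (funext AE); apply: measurable_funB; last first.
    apply: measurable_funM => //.
    exact: measurableT_comp (@measurable_sqn R) (measurable_plane_translation _).
  by apply: measurable_funD => //; apply: measurable_funM => //; exact: measurable_sqn.
rewrite (ge0_integral_gauss alpha mA); last by move=> x; rewrite lee_fin expR_ge0.
have k0 : 0 <= al / pi * expR C by rewrite mulr_ge0 ?expR_ge0// divr_ge0 ?pi_ge0.
under eq_integral => x _.
  rewrite -EFinM gauss_densityE mulrCA -expRD mulNr hA expRD mulrA EFinM -mulNr.
  over.
rewrite ge0_integralZl//.
- rewrite integral_gauss_shift// -EFinM; congr (_%:E).
  have p0 : (pi : R) != 0 by rewrite gt_eqF// pi_gt0.
  by rewrite -[RHS]mulr1 -(divff p0); ring.
- apply: measurable_EFin; apply: measurableT_comp => //; apply: measurable_funM => //.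
  under eq_fun do rewrite -plane_translationE -sqnE.
  exact: measurableT_comp (@measurable_sqn R) (measurable_plane_translation _).
Qed.

(** Needed because the reproducing formula will be used with parameter [beta], whereas the norm is
    taken for [alpha]. *)
Lemma gauss_change (beta : {posnum R}) (h : Pl -> R) :
  measurable_fun setT h -> (forall x, 0 <= h x) ->
  (\int[gauss_measure beta]_x (h x)%:E =
   (beta%:num / al)%:E * \int[gauss]_x (h x * expR ((al - beta%:num) * sqn x))%:E)%E.
Proof.
move=> mh h0.
have mhe : measurable_fun setT (fun x : Pl => h x * expR ((al - beta%:num) * sqn x)).
  apply: measurable_funM => //; apply: measurableT_comp => //.
  by apply: measurable_funM => //; exact: measurable_sqn.
have he0 x : 0 <= h x * expR ((al - beta%:num) * sqn x) by rewrite mulr_ge0 ?expR_ge0.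
have he0' x : setT x -> (0 <= (h x * expR ((al - beta%:num) * sqn x))%:E)%E by rewrite lee_fin.
have k0 : (0 <= (beta%:num / al)%:E)%E by rewrite lee_fin.
rewrite -(ge0_integralZl gauss measurableT (measurable_EFin mhe) he0' k0).
have h0' x : (0 <= (h x)%:E)%E by rewrite lee_fin.
rewrite (ge0_integral_gauss beta (measurable_EFin mh) h0') (ge0_integral_gauss alpha).
- apply: eq_integral => x _; rewrite -!EFinM; congr (_%:E).
  rewrite !gauss_densityE (_ : - beta%:num * sqn x = (al - beta%:num) * sqn x + - al * sqn x); last by ring.
  have a0 : al != 0 by rewrite gt_eqF.
  by rewrite expRD -{1}(divfK a0 beta%:num); ring.
- apply: emeasurable_funM => //; exact: measurable_EFin mhe.
- by move=> x; rewrite mule_ge0// lee_fin.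
Qed.

Lemma modc_rker (beta : {posnum R}) (u w : R[i]) :
  modc (rker beta u w) = expR (beta%:num * complex.Re (w * u^*)).
Proof. by rewrite /rker modc_cexp; congr expR; rewrite !ReImE/=; ring. Qed.

(** The factor [2 / p] is [beta / alpha] from the change of weight. The other one is
    [(p / q)^(1 / q)] for the conjugate exponent [q], and comes from the [L^q] norm of a
    Gaussian. *)
Definition pt_const (p : R) : R := 2 / p * (p - 1) `^ ((p - 1) / p).

(* Hoelder's inequality against the reproducing kernel of parameter
   [beta = 2 alpha / p], for which the Gaussian weights match exactly. *)
Lemma rker_integral_le (p : R) (beta : {posnum R}) (g : R[i] -> R[i]) (w : R[i]) :
  1 < p -> beta%:num = 2 * al / p -> entire g ->
  (\int[gauss_measure beta]_x (modc (g (plane x) * rker beta (plane x) w))%:E <=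
   (pt_const p * expR (al / p * modc w ^+ 2))%:E * fnorm alpha p g)%E.
Proof.
move=> p1 hb eg.
have p0 : 0 < p by exact: lt_trans p1.
have p10 : 0 < p - 1 by rewrite subr_gt0.
pose q := p / (p - 1).
have q0 : 0 < q by rewrite divr_gt0.
have mg : cmeas (fun x : Pl => g (plane x)) by apply: cmeas_plane; exact: entire_ccont.
have mmg : measurable_fun setT (fun x : Pl => modc (g (plane x))) := measurable_modc mg.
have mk := cmeas_rker beta w.
pose A x := beta%:num * complex.Re (w * (plane x)^*) + (al - beta%:num) * sqn x.
have AE x : modc (rker beta (plane x) w) * expR ((al - beta%:num) * sqn x) = expR (A x).
  by rewrite modc_rker -expRD.
have mA : measurable_fun setT (fun x : Pl => expR (A x)).
  under eq_fun do rewrite -AE.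
  apply: measurable_funM; first exact: measurable_modc.
  apply: measurableT_comp => //.
  by apply: measurable_funM => //; exact: measurable_sqn.
rewrite gauss_change; last 2 first.
- by apply: measurable_modc; exact: cmeasM.
- by move=> x; exact: modc_ge0.
under eq_integral do rewrite modcM -mulrA AE.
have pq : p^-1 + q^-1 = 1 by rewrite /q; field; rewrite !gt_eqF.
have := hoelder gauss mmg mA p0 q0 pq.
rewrite Lnorm1 => H.
have H1 : (\int[gauss]_x (modc (g (plane x)) * expR (A x))%:E <=
    fnorm alpha p g * Lnorm gauss q%:E (EFin \o (fun x => expR (A x))))%E.
  apply: le_trans H; apply: ge0_le_integral => //.
  - by move=> x _; rewrite lee_fin mulr_ge0 ?modc_ge0 ?expR_ge0.
  - by apply: measurable_EFin; exact: measurable_funM.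
  - apply: measurableT_comp => //; apply: measurable_EFin.
    exact: measurable_funM.
  - by move=> x _; exact: lee_abs.
have H2 : Lnorm gauss q%:E (EFin \o (fun x => expR (A x))) =
    ((p - 1) `^ ((p - 1) / p) * expR (al / p * modc w ^+ 2))%:E.
  rewrite unlock.
  under eq_integral => x _ do rewrite /= ger0_norm ?expR_ge0// -expRM mulrC.
  (* Here the value of [beta] matters: since [q - q / p = 1], the total exponent is exactly
     [q * (al / p) * (|w|^2 - |x - w|^2)]. *)
  rewrite (@integral_gauss_expR _ (q * (al / p) * modc w ^+ 2) (q * (al / p)) w); last 2 first.
  - by rewrite mulr_gt0// divr_gt0.
  - move=> x; rewrite /A hb /q /sqn modcX2; case: (w) => c d; case: x => s t.
    by rewrite modcX2/= ; field; rewrite !gt_eqF.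
  rewrite poweR_EFin powRM ?expR_ge0//; last first.
    by rewrite divr_ge0// mulr_ge0 ?divr_ge0 ?ltW.
  rewrite -expRM; congr (_ * expR _)%:E.
    by congr (_ `^ _); rewrite /q; field; rewrite !gt_eqF.
  by field; rewrite !gt_eqF.
rewrite H2 in H1.
rewrite /pt_const -(mulrA (2 / p)) (EFinM (2 / p)) -(muleA (2 / p)%:E) (muleC _ (fnorm _ _ _)).
have -> : beta%:num / al = 2 / p by rewrite hb; field; rewrite !gt_eqF.
by apply: lee_wpmul2l => //; rewrite lee_fin divr_ge0// ltW.
Qed.

End Pointwise.

Section SquareNorm.
Variables (R : realType) (alpha : {posnum R}).
Notation Pl := (measurableTypeR R * measurableTypeR R)%type.
Notation al := (alpha%:num).
Notation gauss := (gauss_measure alpha).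

Lemma pt_const_gt0 (p : R) : 1 < p -> 0 < pt_const p.
Proof.
move=> p1; have p0 : 0 < p by exact: lt_trans p1.
by rewrite mulr_gt0 ?divr_gt0// powR_gt0// subr_gt0.
Qed.

(** The reproducing formula of parameter [2 * al / p] is estimated by [rker_integral_le]. The
    exponent [p] of the theorem gives the decay of the kernel, and [p = 2] bounds functions of the
    Fock space. *)
Lemma entire_pointwise (p : R) (g : R[i] -> R[i]) (w : R[i]) : 1 < p -> entire g ->
  ((modc (g w))%:E <= (2 * pt_const p * expR (al / p * modc w ^+ 2))%:E * fnorm alpha p g)%E.
Proof.
move=> p1 eg; have p0 : 0 < p by exact: lt_trans p1.
have c0 : 0 < pt_const p * expR (al / p * modc w ^+ 2).
  by rewrite mulr_gt0 ?expR_gt0// pt_const_gt0.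
have [->|fg] := eqVneq (fnorm alpha p g) +oo%E.
  by rewrite gt0_muley ?leey// lte_fin -mulrA mulr_gt0.
have b0 : 0 < 2 * al / p by rewrite divr_gt0// mulr_gt0.
pose beta := PosNum b0.
have H := rker_integral_le w p1 (erefl : beta%:num = 2 * al / p) eg.
have Hlt : (\int[gauss_measure beta]_x (modc (g (plane x) * rker beta (plane x) w))%:E < +oo)%E.
  apply: le_lt_trans H _; rewrite lte_mul_pinfty ?lee_fin ?(ltW c0)//.
  by rewrite ltey.
rewrite -(gauss_reproducing eg Hlt); apply: le_trans (modc_cint_le _ _) _.
  apply: cmeasM; last exact: cmeas_rker.
  by apply: cmeas_plane; exact: entire_ccont.
by rewrite -mulrA EFinM -muleA; apply: lee_wpmul2l.
Qed.

(** The square of the norm avoids the power [2^-1] of [fnorm]. It is defined for arbitrary functions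
    on the plane because it is also applied to sections such as [H (plane x) w] as functions of [x],
    which are not entire. *)
Definition sqnorm (f : Pl -> R[i]) : \bar R :=
  (\int[gauss]_x (modc (f x) ^+ 2)%:E)%E.

Lemma sqnorm_ge0 f : (0 <= sqnorm f)%E.
Proof. by apply: integral_ge0 => x _; rewrite lee_fin sqr_ge0. Qed.

Lemma fnorm2E (g : R[i] -> R[i]) :
  fnorm alpha 2 g = (sqnorm (fun x => g (plane x)) `^ 2^-1)%E.
Proof.
rewrite /fnorm unlock; congr (_ `^ _)%E; apply: eq_integral => x _.
by rewrite /= ger0_norm ?modc_ge0// -powR_mulrn// modc_ge0.
Qed.

Lemma fnorm2_lty (g : R[i] -> R[i]) :
  (fnorm alpha 2 g < +oo)%E <-> (sqnorm (fun x => g (plane x)) < +oo)%E.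
Proof.
rewrite fnorm2E; split; last exact: poweR_lty.
by apply: lty_poweRy; rewrite invr_neq0.
Qed.

Lemma fnorm2_le (g : R[i] -> R[i]) (M : R) : 0 <= M ->
  (fnorm alpha 2 g <= M%:E)%E <-> (sqnorm (fun x => g (plane x)) <= (M ^+ 2)%:E)%E.
Proof.
move=> M0; rewrite fnorm2E; have := sqnorm_ge0 (fun x => g (plane x)).
case: (sqnorm _) => [s||]//; last first.
  by rewrite poweRyr ?invr_neq0//; split; rewrite leye_eq.
rewrite lee_fin => s0; rewrite poweR_EFin !lee_fin powR12_sqrt//; split => h.
  by rewrite -(sqr_sqrtr s0) ler_pXn2r ?nnegrE ?sqrtr_ge0.
by rewrite -(@ler_pXn2r _ 2) ?nnegrE ?sqrtr_ge0// sqr_sqrtr.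
Qed.

End SquareNorm.

Section CauchySchwarz.
Context d (T : measurableType d) (R : realType) (mu : {measure set T -> \bar R}).

(** Hoelder's inequality at [p = q = 2], multiplied by itself so that no roots of extended reals
    remain. *)
Lemma cauchy_schwarz (f g : T -> R) :
  measurable_fun setT f -> measurable_fun setT g ->
  (forall x, 0 <= f x) -> (forall x, 0 <= g x) ->
  ((\int[mu]_x (f x * g x)%:E) * (\int[mu]_x (f x * g x)%:E) <=
   (\int[mu]_x (f x ^+ 2)%:E) * (\int[mu]_x (g x ^+ 2)%:E))%E.
Proof.
move=> mf mg f0 g0.
have h2 : (2^-1 + 2^-1 = 1 :> R) by field.
have H := hoelder mu mf mg (ltr0n R 2) (ltr0n R 2) h2.
have sq (h : T -> R) : (forall x, 0 <= h x) ->
    (Lnorm mu 2%:E (EFin \o h) * Lnorm mu 2%:E (EFin \o h) = \int[mu]_x (h x ^+ 2)%:E)%E.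
  move=> h0; have i0 : (0 <= \int[mu]_x (h x ^+ 2)%:E)%E.
    by apply: integral_ge0 => x _; rewrite lee_fin sqr_ge0.
  have -> : Lnorm mu 2%:E (EFin \o h) = ((\int[mu]_x (h x ^+ 2)%:E) `^ 2^-1)%E.
    rewrite unlock; congr (_ `^ _)%E; apply: eq_integral => x _.
    by rewrite /= ger0_norm// -powR_mulrn.
  by rewrite -poweRD ?h2 ?poweRe1// add_neq0_poweRD_def// h2.
rewrite -(sq f f0) -(sq g g0) muleACA.
have -> : (\int[mu]_x (f x * g x)%:E = Lnorm mu 1 (EFin \o (f \* g)%R))%E.
  rewrite Lnorm1; apply: eq_integral => x _ /=.
  by rewrite ger0_norm// mulr_ge0.
by apply: lee_pmul => //; exact: Lnorm_ge0.
Qed.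

End CauchySchwarz.

(** * The kernel transform *)

Section KernelTransform.
Variables (R : realType) (alpha : {posnum R}).
Notation Pl := (measurableTypeR R * measurableTypeR R)%type.
Notation al := (alpha%:num).
Notation gauss := (gauss_measure alpha).

Lemma sqr_le_expR (x : R) : 0 <= x -> x ^+ 2 <= 4 * expR x.
Proof.
move=> x0; have -> : x = x / 2 + x / 2 by exact: splitr.
rewrite expRD; have := expR_ge1Dx (x / 2); nra.
Qed.

(** Finite for every [c], because the Gaussian weight beats [2 * c * |x|]; reproducing kernels are
    dominated by such exponentials. *)
Definition exp_moment (c : R) : \bar R :=
  (\int[gauss]_x ((expR (c * modc (plane x))) ^+ 2)%:E)%E.

Lemma measurable_expR_modc (c : R) :
  measurable_fun setT (fun x : Pl => expR (c * modc (plane x))).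
Proof.
apply: measurableT_comp => //; apply: measurable_funM => //.
exact: measurable_modc (cmeas_plane (entire_ccont (@entire_id R))).
Qed.

Lemma exp_moment_lty (c : R) : (exp_moment c < +oo)%E.
Proof.
apply: (@le_lt_trans _ _ (\int[gauss]_x (expR (2 * c ^+ 2 / al + al / 2 * sqn x))%:E)%E).
  apply: ge0_le_integral => //.
  - by apply: measurable_EFin; apply: measurable_funX; exact: measurable_expR_modc.
  - apply: measurable_EFin; apply: measurableT_comp => //; apply: measurable_funD => //.
    by apply: measurable_funM => //; exact: measurable_sqn.
  - move=> x _; rewrite lee_fin expr2 -expRD ler_expR sqnE.
    set m := modc _; rewrite -subr_ge0.
    have -> : 2 * c ^+ 2 / al + al / 2 * m ^+ 2 - (c * m + c * m) =
       (2 * c - al * m) ^+ 2 / (2 * al) by field; rewrite gt_eqF.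
    by rewrite divr_ge0 ?sqr_ge0.
rewrite (@integral_gauss_expR _ alpha _ (2 * c ^+ 2 / al) (al / 2) 0) ?ltry//.
by move=> x; rewrite subr0 -sqnE; field; rewrite gt_eqF.
Qed.

Lemma exp_moment_ge0 c : (0 <= exp_moment c)%E.
Proof. by apply: integral_ge0 => x _; rewrite lee_fin sqr_ge0. Qed.

Lemma integral_exp_le (g : Pl -> R[i]) (c : R) : cmeas g ->
  (\int[gauss]_x (modc (g x) * expR (c * modc (plane x)))%:E <=
   sqnorm alpha g + exp_moment c)%E.
Proof.
move=> mg; have mm := measurable_modc mg.
rewrite /sqnorm /exp_moment -ge0_integralD//; first last.
- by apply: measurable_EFin; apply: measurable_funX; exact: measurable_expR_modc.
- by apply: measurable_EFin; apply: measurable_funX.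
- by move=> x _; rewrite lee_fin sqr_ge0.
apply: ge0_le_integral => //.
- by move=> x _; rewrite lee_fin mulr_ge0 ?modc_ge0 ?expR_ge0.
- by apply: measurable_EFin; apply: measurable_funM => //; exact: measurable_expR_modc.
- apply: emeasurable_funD; apply: measurable_EFin; apply: measurable_funX => //.
  exact: measurable_expR_modc.
- move=> x _; rewrite -EFinD lee_fin.
  have := modc_ge0 (g x); have := expR_ge0 (c * modc (plane x)); nra.
Qed.

(** Bounds the integral of [|g| expR (c |x|)] by [a b <= a^2 + b^2]. It depends on [g] through its
    norm alone, so it is uniform over bounded sequences. *)
Definition l1_const (g : Pl -> R[i]) c := fine (sqnorm alpha g) + fine (exp_moment c).

Lemma integral_exp_scale_le (phi g : Pl -> R[i]) (c K : R) :
  cmeas phi -> cmeas g -> (sqnorm alpha g < +oo)%E -> 0 <= K ->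
  (forall x, modc (phi x) <= K * (modc (g x) * expR (c * modc (plane x)))) ->
  (\int[gauss]_x (modc (phi x))%:E <= (K * l1_const g c)%:E)%E.
Proof.
move=> mphi mg ng K0 H; have mm := measurable_modc mg.
have mge : measurable_fun setT (fun x => (modc (g x) * expR (c * modc (plane x)))%:E).
  by apply: measurable_EFin; apply: measurable_funM => //; exact: measurable_expR_modc.
apply: (@le_trans _ _ (K%:E * \int[gauss]_x (modc (g x) * expR (c * modc (plane x)))%:E)%E).
  rewrite -ge0_integralZl//; last first.
    by move=> x _; rewrite lee_fin mulr_ge0 ?modc_ge0 ?expR_ge0.
  apply: ge0_le_integral => //.
  - by move=> x _; rewrite lee_fin modc_ge0.
  - exact: measurable_EFin (measurable_modc mphi).
  - exact: emeasurable_funM.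
  - by move=> x _; rewrite -EFinM lee_fin.
rewrite EFinM; apply: lee_wpmul2l; first by rewrite lee_fin.
apply: le_trans (integral_exp_le c mg) _.
rewrite /l1_const EFinD !fineK//.
  by rewrite ge0_fin_numE ?exp_moment_lty// exp_moment_ge0.
by rewrite ge0_fin_numE// sqnorm_ge0.
Qed.

Lemma cintegrable_exp (phi g : Pl -> R[i]) (c K : R) :
  cmeas phi -> cmeas g -> (sqnorm alpha g < +oo)%E -> 0 <= K ->
  (forall x, modc (phi x) <= K * (modc (g x) * expR (c * modc (plane x)))) ->
  cintegrable gauss phi.
Proof.
move=> mphi mg ng K0 H; apply: cintegrableP => //.
by apply: le_lt_trans (integral_exp_scale_le mphi mg ng K0 H) _; rewrite ltry.
Qed.

Lemma cint_exp_le (phi g : Pl -> R[i]) (c K : R) :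
  cmeas phi -> cmeas g -> (sqnorm alpha g < +oo)%E -> 0 <= K ->
  (forall x, modc (phi x) <= K * (modc (g x) * expR (c * modc (plane x)))) ->
  modc (cint gauss phi) <= 2 * K * l1_const g c.
Proof.
move=> mphi mg ng K0 H; rewrite -lee_fin; apply: le_trans (modc_cint_le _ mphi) _.
rewrite -mulrA (EFinM 2); apply: lee_wpmul2l; first by rewrite lee_fin.
exact: integral_exp_scale_le.
Qed.

Lemma l1_const_ge0 g c : 0 <= l1_const g c.
Proof. by rewrite addr_ge0// fine_ge0 ?sqnorm_ge0 ?exp_moment_ge0. Qed.

Lemma modc_rker_le (u w : R[i]) : modc (rker alpha u w) <= expR (al * modc w * modc u).
Proof.
rewrite modc_rker ler_expR -mulrA ler_pM2l//.
apply: le_trans (ler_norm _) _; apply: le_trans (modc_Re _) _.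
by rewrite modcM modcJ.
Qed.

Lemma rkerD (u w t : R[i]) :
  rker alpha u (w + t) = rker alpha u w * cexp (al%:C * t * u^*).
Proof. by rewrite /rker -cexpD; congr cexp; ring. Qed.

(** With [m = al * modc u], the factor [m ^+ 2] of the Taylor remainder is absorbed by [4 * expR m],
    so [32 = 8 * 4] and the exponent doubles. The linear term adds one more to give [33]. *)
Lemma cexp_increment (u t : R[i]) : modc t <= 1 ->
  modc (cexp (al%:C * t * u^*) - 1 - al%:C * t * u^*) <=
    32 * modc t ^+ 2 * expR (2 * al * modc u) /\
  modc (cexp (al%:C * t * u^*) - 1) <= 33 * modc t * expR (2 * al * modc u).
Proof.
move=> t1; set h := al%:C * t * u^*; pose m := al * modc u.
have m0 : 0 <= m by rewrite mulr_ge0 ?modc_ge0.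
have t0 := modc_ge0 t.
have hE : modc h = modc t * m.
  by rewrite /h !modcM modcJ modc_Creal ger0_norm// /m; ring.
have hm : modc h <= m by rewrite hE ler_piMl.
have e1 : expR (modc h) <= expR m by rewrite ler_expR.
have E2 : expR (2 * al * modc u) = expR m * expR m by rewrite -expRD /m; congr expR; ring.
have em : 1 <= expR m by rewrite -expR0 ler_expR.
have sq := sqr_le_expR m0.
have A : modc (cexp h - 1 - h) <= 32 * modc t ^+ 2 * (expR m * expR m).
  apply: le_trans (cexp_taylor1 h) _; rewrite hE.
  have -> : 32 * modc t ^+ 2 * (expR m * expR m) = 8 * modc t ^+ 2 * (4 * expR m) * expR m by ring.
  have -> : 8 * (modc t * m) ^+ 2 = 8 * modc t ^+ 2 * m ^+ 2 by ring.
  apply: ler_pM => //; rewrite -?hE//.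
    by rewrite mulr_ge0 ?sqr_ge0// mulr_ge0 ?sqr_ge0.
  by rewrite ler_wpM2l// mulr_ge0 ?sqr_ge0.
rewrite E2; split=> //.
have -> : cexp h - 1 = (cexp h - 1 - h) + h by ring.
apply: le_trans (modcD _ _) _.
have hle : modc h <= modc t * (expR m * expR m).
  rewrite hE ler_wpM2l//; have := expR_ge1Dx m; nra.
have tt : modc t ^+ 2 <= modc t by rewrite expr2 ler_piMr.
have ee : 0 <= expR m * expR m by rewrite mulr_ge0 ?expR_ge0.
have : 32 * modc t ^+ 2 * (expR m * expR m) <= 32 * modc t * (expR m * expR m).
  by rewrite ler_wpM2r// ler_wpM2l.
lra.
Qed.

(** As an integral operator, this is the orthogonal projection of [L^2] onto the Fock space. An
    equality [ktrans f = f] serves below as a certificate that [f] is entire. *)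
Definition ktrans (g : Pl -> R[i]) (w : R[i]) : R[i] :=
  cint gauss (fun x => g x * rker alpha (plane x) w).

Section fixed_g.
Variable g : Pl -> R[i].
Hypotheses (mg : cmeas g) (ng : (sqnorm alpha g < +oo)%E).

Lemma cmeas_grker w : cmeas (fun x => g x * rker alpha (plane x) w).
Proof. by apply: cmeasM => //; exact: cmeas_rker. Qed.

Lemma cintegrable_grker w : cintegrable gauss (fun x => g x * rker alpha (plane x) w).
Proof.
apply: (cintegrable_exp (cmeas_grker w) mg ng ler01 (c := al * modc w)) => x.
by rewrite mul1r modcM ler_wpM2l ?modc_ge0// modc_rker_le.
Qed.

Lemma ktrans_le w : modc (ktrans g w) <= 2 * l1_const g (al * modc w).
Proof.
have := cint_exp_le (cmeas_grker w) mg ng ler01 (c := al * modc w).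
rewrite mulr1; apply => x.
by rewrite mul1r modcM ler_wpM2l ?modc_ge0// modc_rker_le.
Qed.

Lemma rker_exp_le (u w : R[i]) c : modc (rker alpha u w) * expR (c * modc u) <=
  expR ((c + al * modc w) * modc u).
Proof.
by rewrite mulrDl expRD mulrC ler_wpM2l ?expR_ge0// modc_rker_le.
Qed.

(** For functions of bounded norm this is local equicontinuity, the source of the convergent
    subsequences. *)
Lemma ktrans_lipschitz w t : modc t <= 1 ->
  modc (ktrans g (w + t) - ktrans g w) <=
  66 * modc t * l1_const g (2 * al + al * modc w).
Proof.
move=> t1; rewrite /ktrans -cintB; try exact: cintegrable_grker.
have -> : 66 * modc t = 2 * (33 * modc t) by ring.
apply: (cint_exp_le _ mg ng).
- by apply: cmeasB; exact: cmeas_grker.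
- by rewrite mulr_ge0 ?modc_ge0.
move=> x; rewrite -mulrBr rkerD -[X in _ - X]mulr1 -mulrBr (modcM (g x)) (modcM (rker _ _ _)).
have [_ h] := cexp_increment (plane x) t1.
rewrite [leRHS]mulrCA ler_wpM2l ?modc_ge0//.
apply: (@le_trans _ _ (modc (rker alpha (plane x) w) * (33 * modc t * expR (2 * al * modc (plane x))))).
  by rewrite ler_wpM2l ?modc_ge0.
by rewrite mulrCA ler_wpM2l ?mulr_ge0 ?modc_ge0// rker_exp_le.
Qed.

(** Differentiation under the integral sign: [psi] is the derivative of the integrand in [w], and by
    [cexp_increment] the remainder is [modc t ^+ 2] times an integrable exponential. *)
Lemma entire_ktrans : entire (ktrans g).
Proof.
apply/entireP => w.
pose psi (x : Pl) := al%:C * (plane x)^* * (g x * rker alpha (plane x) w).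
have mpl : cmeas (fun x : Pl => plane x) := cmeas_plane (entire_ccont (@entire_id R)).
have mpsi : cmeas psi.
  apply: cmeasM; last exact: cmeas_grker.
  by apply: cmeasM; [exact: cmeas_cst|exact: cmeasJ].
have ipsi : cintegrable gauss psi.
  apply: (cintegrable_exp mpsi mg ng ler01 (c := al + al * modc w)) => x.
  rewrite mul1r /psi (modcM (_ * _)) (modcM al%:C) (modcM (g x)) modcJ modc_Creal ger0_norm//.
  rewrite mulrCA ler_wpM2l ?modc_ge0//.
  apply: le_trans (rker_exp_le _ _ _).
  rewrite mulrC ler_wpM2l ?modc_ge0//.
  by have := expR_ge1Dx (al * modc (plane x)); lra.
exists (cint gauss psi) => e e0.
pose L := 64 * l1_const g (2 * al + al * modc w).
have L0 : 0 <= L by rewrite mulr_ge0// l1_const_ge0.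
have L1 : 0 < L + 1 by rewrite ltr_wpDl.
exists (Num.min 1 (e / (L + 1))); first by rewrite lt_min ltr01 divr_gt0.
move=> t; rewrite lt_min => /andP[/ltW t1 te].
apply: (@le_trans _ _ (modc t * L * modc t)); last first.
  rewrite ler_wpM2r ?modc_ge0//; move: te; rewrite ltr_pdivlMr// => te.
  by have := modc_ge0 t; nra.
rewrite mulrC -cintZ// /ktrans -!cintB; try exact: cintegrable_grker; last 2 first.
- by apply: cintegrableB; exact: cintegrable_grker.
- exact: cintegrableZ.
have -> : modc t * L * modc t = 2 * (32 * modc t ^+ 2) * l1_const g (2 * al + al * modc w).
  by rewrite /L; ring.
apply: (cint_exp_le _ mg ng).
- apply: cmeasB; first by apply: cmeasB; exact: cmeas_grker.
  by apply: cmeasM => //; exact: cmeas_cst.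
- by rewrite mulr_ge0 ?sqr_ge0.
move=> x; have -> : g x * rker alpha (plane x) (w + t) - g x * rker alpha (plane x) w - t * psi x =
  g x * (rker alpha (plane x) w * (cexp (al%:C * t * (plane x)^*) - 1 - al%:C * t * (plane x)^*)).
  by rewrite rkerD /psi; ring.
rewrite (modcM (g x)) (modcM (rker _ _ _)); have [h _] := cexp_increment (plane x) t1.
rewrite [leRHS]mulrCA ler_wpM2l ?modc_ge0//.
apply: (@le_trans _ _ (modc (rker alpha (plane x) w) * (32 * modc t ^+ 2 * expR (2 * al * modc (plane x))))).
  by rewrite ler_wpM2l ?modc_ge0.
rewrite mulrCA; apply: ler_wpM2l; first by rewrite mulr_ge0 ?sqr_ge0.
exact: rker_exp_le.
Qed.

End fixed_g.

Lemma fockP (f : R[i] -> R[i]) : fock alpha f <->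
  entire f /\ (sqnorm alpha (fun x => f (plane x)) < +oo)%E.
Proof. by split=> -[ef nf]; split=> //; apply/fnorm2_lty. Qed.

Lemma fock_ktrans (f : R[i] -> R[i]) : fock alpha f ->
  forall w, ktrans (fun x => f (plane x)) w = f w.
Proof.
move=> /fockP[ef nf] w; apply: gauss_reproducing => //.
apply: cintegrable_lty; apply: cintegrable_grker => //.
by apply: cmeas_plane; exact: entire_ccont.
Qed.

End KernelTransform.

(** * Pointwise compactness of bounded sequences *)

Section Subsequence.
Variable R : realType.

(** The image ultrafilter lives on a compact segment, so it has a cluster point and converges to
    it. *)
Lemma ultrafilter_real_limit (G : set_system nat) (x : nat -> R) (B : R) :
  UltraFilter G -> (forall n, `|x n| <= B) ->
  exists l, forall e, 0 < e -> G [set n | `|x n - l| < e].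
Proof.
move=> UG xB.
have PG : ProperFilter G by exact: ultra_proper.
have FB : (x @ G) `[- B, B]%classic.
  have : G (x @^-1` `[- B, B]) => //.
  by apply: filterS filterT => n _ /=; rewrite in_itv/= -ler_norml; exact: xB.
have [l [_ cl]] := segment_compact (fmap_proper_filter x PG) FB.
exists l => e e0.
have [//|Gc] := in_ultra_setVsetC [set n | `|x n - l| < e] UG.
have Gi : (x @ G) (x @` (~` [set n | `|x n - l| < e])).
  rewrite /= /fmap /=; apply: filterS Gc => n hn; exists n => //.
have [y [[n hn <-]]] := cl _ (ball l e) Gi (nbhsx_ballx _ _ e0).
by rewrite /ball/= distrC => /hn.
Qed.

(** One ultrafilter finer than the tails gives limits [l j] for all coordinates at once, so no
    nested subsequences are required. The index [s k] is chosen with the first [k] coordinates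
    within [1 / (k + 1)] of their limits. *)
Lemma diagonal_subsequence (x : nat -> nat -> R) (B : nat -> R) :
  (forall j n, `|x j n| <= B j) ->
  exists2 s : nat -> nat, {homo s : m n / (m < n)%N} &
    forall j, cvgn (fun n => x j (s n)).
Proof.
move=> xB; have [G [UG sG]] := ultraFilterLemma (eventually_filter : ProperFilter \oo).
have PG : ProperFilter G by exact: ultra_proper.
have /choice[l lP] : forall j, exists l, forall e, 0 < e -> G [set n | `|x j n - l| < e].
  by move=> j; apply: ultrafilter_real_limit (xB j).
have fin (k : nat) (e : R) : 0 < e -> G [set n | forall j, (j < k)%N -> `|x j n - l j| < e].
  move=> e0; elim: k => [|k IH]; first by apply: filterS filterT => n _ j.
  apply: filterS2 IH (lP k e e0) => n /= h1 h2 j; rewrite ltnS leq_eqVlt.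
  by move=> /predU1P[->//|]; exact: h1.
have step (m k : nat) : exists n, (m < n)%N /\ forall j, (j < k)%N -> `|x j n - l j| < k.+1%:R^-1.
  have : G ([set n | (m < n)%N] `&` [set n | forall j, (j < k)%N -> `|x j n - l j| < k.+1%:R^-1]).
    apply: filterI; last by apply: fin; rewrite invr_gt0.
    by apply: sG; exact: nbhs_infty_gt.
  by move=> /filter_ex[n [h1 h2]]; exists n.
have /choice[f fP] : forall mk : nat * nat, exists n, (mk.1 < n)%N /\
    forall j, (j < mk.2)%N -> `|x j n - l j| < mk.2.+1%:R^-1.
  by case=> m k; exact: step.
pose fix s (k : nat) : nat := if k is k'.+1 then f (s k', k'.+1) else f (0%N, 0%N).
have sP k j : (j < k)%N -> `|x j (s k) - l j| < k.+1%:R^-1.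
  case: k => // k jk; have [_ h] := fP (s k, k.+1); exact: h.
exists s.
  apply: homo_ltn; first exact: ltn_trans.
  by move=> k; have [] := fP (s k, k.+1).
move=> j; apply/cvg_ex; exists (l j); apply/cvgrPdist_lt => e e0; near=> k.
rewrite distrC; apply: lt_trans (sP k j _) _.
  by near: k; exact: nbhs_infty_gt.
by near: k; exact: (near_infty_natSinv_lt (PosNum e0)).
Unshelve. all: by end_near. Qed.

Definition dense_seq (k : nat) : R[i] :=
  if unpickle k is Some ab then ratr (ab : rat * rat).1 +i* ratr ab.2 else 0.

Lemma dense_seqP (w : R[i]) (e : R) : 0 < e -> exists k, modc (dense_seq k - w) < e.
Proof.
move=> e0; case: w => a b.
have [p] : exists q : rat, ratr q \in `]a - e / 2, a + e / 2[.
  by apply: rat_in_itvoo; lra.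
have [q] : exists q : rat, ratr q \in `]b - e / 2, b + e / 2[.
  by apply: rat_in_itvoo; lra.
rewrite !in_itv/= => /andP[q1 q2] /andP[p1 p2].
exists (pickle (p, q)); rewrite /dense_seq pickleK.
apply: le_lt_trans (modc_leReIm _) _; rewrite /= (splitr e).
by apply: ltrD; rewrite ltr_norml; apply/andP; split; lra.
Qed.

End Subsequence.

Section Dominated.
Context d (T : measurableType d) (R : realType) (mu : {measure set T -> \bar R}).

Lemma dominated_to0 (h : nat -> T -> R) (g : T -> R) :
  (forall n, measurable_fun setT (h n)) -> measurable_fun setT g ->
  (forall n x, 0 <= h n x <= g x) -> (forall x, h n x @[n --> \oo] --> 0) ->
  (\int[mu]_x (g x)%:E < +oo)%E ->
  (\int[mu]_x (h n x)%:E)%E @[n --> \oo] --> 0%E.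
Proof.
move=> mh mg hg h0 ig.
have g0 x : 0 <= g x by have /andP[a b] := hg 0%N x; exact: le_trans a b.
have ig' : mu.-integrable setT (EFin \o g).
  apply/integrableP; split; first exact/measurable_EFinP.
  by under eq_integral => x _ do rewrite /= ger0_norm//.
have := @dominated_cvg _ _ _ mu setT measurableT (fun n x => (h n x)%:E) (cst 0%E)
  (EFin \o g) _ _ _ ig'; rewrite integral0; apply => //.
- by move=> n; apply/measurable_EFinP.
- by move=> x _; apply/fine_cvgP; split; [exact: nearW|exact: h0].
- by move=> n x _; have /andP[a b] := hg n x; rewrite /= lee_fin ger0_norm.
Qed.

End Dominated.

Section RealSequences.
Variable R : realType.

(** Such a sequence is Cauchy; this carries convergence from a dense set of points to all points. *)
Lemma cvgn_approx (x : nat -> R) :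
  (forall e : R, 0 < e -> exists2 y : nat -> R, cvgn y & forall n, `|x n - y n| <= e) ->
  cvgn x.
Proof.
move=> H; apply/cauchy_cvgP; apply: cauchy_exP => e e0.
have e2 : 0 < e / 2 by rewrite divr_gt0.
have [y cy xy] := H _ e2; exists (limn y).
have /cvgrPdist_lt/(_ _ e2) yl : y @ \oo --> limn y by [].
rewrite /= /fmap /=; near=> n; rewrite /ball/= (_ : limn y - x n = (limn y - y n) - (x n - y n)); last by ring.
apply: le_lt_trans (ler_normB _ _) _; rewrite (splitr e); apply: ltr_leD => //.
by near: n.
Unshelve. all: by end_near. Qed.

Lemma cvg0_modc_ReIm (z : nat -> R[i]) (l : R[i]) :
  complex.Re (z n) @[n --> \oo] --> complex.Re l ->
  complex.Im (z n) @[n --> \oo] --> complex.Im l ->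
  modc (z n - l) @[n --> \oo] --> (0 : R).
Proof.
move=> /cvgrPdist_lt h1 /cvgrPdist_lt h2; apply/cvgr0Pnorm_lt => e e0.
have e2 : 0 < e / 2 by rewrite divr_gt0.
near=> n; rewrite ger0_norm ?modc_ge0//.
apply: le_lt_trans (modc_leReIm _) _; rewrite !ReImE (splitr e).
apply: ltrD; rewrite distrC; near: n; [exact: h1|exact: h2].
Unshelve. all: by end_near. Qed.

Lemma cvg_modc (z : nat -> R[i]) (l : R[i]) :
  modc (z n - l) @[n --> \oo] --> (0 : R) -> modc (z n) @[n --> \oo] --> modc l.
Proof.
move=> /cvgr0Pnorm_lt h; apply/cvgrPdist_lt => e e0; near=> n.
apply: (@le_lt_trans _ _ `|modc (z n - l)|); last by near: n; exact: h.
rewrite (ger0_norm (modc_ge0 _)) ler_norml; have := modcBB (z n) l.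
by have := modcBB l (z n); rewrite modcBC; lra.
Unshelve. all: by end_near. Qed.

Lemma modc_cvg_unique (z : nat -> R[i]) (a b : R[i]) :
  modc (z n - a) @[n --> \oo] --> (0 : R) -> modc (z n - b) @[n --> \oo] --> (0 : R) ->
  a = b.
Proof.
move=> /cvgr0Pnorm_lt ha /cvgr0Pnorm_lt hb; apply: contrapT => /eqP ab.
have d0 : 0 < modc (a - b) / 2 by rewrite divr_gt0// modc_gt0 subr_eq0.
have [n [h1 h2]] : exists n, modc (z n - a) < modc (a - b) / 2 /\ modc (z n - b) < modc (a - b) / 2.
  suff /filter_ex : \forall n \near \oo, modc (z n - a) < modc (a - b) / 2 /\
    modc (z n - b) < modc (a - b) / 2 by [].
  near=> n; rewrite -[X in X < _ /\ _](ger0_norm (modc_ge0 _)) -[X in _ /\ X < _](ger0_norm (modc_ge0 _)).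
  by split; near: n; [exact: ha|exact: hb].
have := modcB (z n - b) (z n - a); rewrite (_ : z n - b - (z n - a) = a - b); last by ring.
lra.
Unshelve. all: by end_near. Qed.

Lemma fatou_bound d (T : measurableType d) (mu : {measure set T -> \bar R})
  (h : nat -> T -> R) (f : T -> R) (M : \bar R) :
  (forall n, measurable_fun setT (h n)) -> (forall n x, 0 <= h n x) ->
  (forall x, h n x @[n --> \oo] --> f x) ->
  (forall n, (\int[mu]_x (h n x)%:E <= M)%E) -> (\int[mu]_x (f x)%:E <= M)%E.
Proof.
move=> mh h0 hf hM.
have := @fatou _ _ _ mu setT measurableT (fun n x => (h n x)%:E) _ _.
have -> : (\int[mu]_x limn_einf (fun n => (h n x)%:E) = \int[mu]_x (f x)%:E)%E.
  apply: eq_integral => x _.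
  have c : (h n x)%:E @[n --> \oo] --> (f x)%:E.
    by apply/fine_cvgP; split; [exact: nearW|exact: hf].
  rewrite is_cvg_limn_einfE; last by apply/cvg_ex; exists (f x)%:E.
  exact/cvg_lim.
move=> H; apply: le_trans (H _ _) _ => //.
- by move=> n; apply/measurable_EFinP.
- by move=> n x _; rewrite lee_fin.
- rewrite limn_einf_lim; apply: lime_le; first exact: is_cvg_einfs.
  apply: nearW => n; apply: le_trans (hM n).
  by apply: ereal_inf_lbound; exists n => /=.
Qed.

End RealSequences.

(** * Pointwise limits of bounded sequences in the Fock space *)

Section FockSubsequence.
Variables (R : realType) (alpha : {posnum R}).
Notation Pl := (measurableTypeR R * measurableTypeR R)%type.
Notation al := (alpha%:num).
Notation gauss := (gauss_measure alpha).
Notation onplane f := (fun x : R * R => f (plane x)).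

Lemma cmeas_cvg d (T : measurableType d) (g : nat -> T -> R[i]) (f : T -> R[i]) :
  (forall n, cmeas (g n)) ->
  (forall x, complex.Re (g n x) @[n --> \oo] --> complex.Re (f x)) ->
  (forall x, complex.Im (g n x) @[n --> \oo] --> complex.Im (f x)) -> cmeas f.
Proof.
move=> mg h1 h2; split.
  by apply: (@measurable_fun_cvg _ _ _ _ (fun n x => complex.Re (g n x))) => // m; have [] := mg m.
by apply: (@measurable_fun_cvg _ _ _ _ (fun n x => complex.Im (g n x))) => // m; have [] := mg m.
Qed.

(** Here [N] bounds the squared norm, whence the root. The rate [al / 2] is critical: for [N > 0]
    this function is not square integrable, but it is integrable against a reproducing kernel, which
    is what dominated convergence requires. *)
Definition pt_bound (N : R) (w : R[i]) : R :=
  2 * pt_const 2 * expR (al / 2 * modc w ^+ 2) * Num.sqrt N.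

Lemma fock_pt_bound (f : R[i] -> R[i]) (N : R) (w : R[i]) : 0 <= N ->
  fock alpha f -> (sqnorm alpha (onplane f) <= N%:E)%E -> modc (f w) <= pt_bound N w.
Proof.
move=> N0 [ef _] nf; rewrite -lee_fin.
have p2 : (1 : R) < 2 by rewrite ltr1n.
apply: le_trans (entire_pointwise alpha w p2 ef) _.
rewrite /pt_bound [leRHS]EFinM; apply: lee_wpmul2l.
  by rewrite lee_fin !mulr_ge0 ?expR_ge0// ltW// pt_const_gt0.
by apply/fnorm2_le; rewrite ?sqrtr_ge0// sqr_sqrtr.
Qed.

Lemma measurable_pt_bound (N : R) : measurable_fun setT (fun x : Pl => pt_bound N (plane x)).
Proof.
rewrite /pt_bound; apply: measurable_funM => //; apply: measurable_funM => //.
apply: measurableT_comp => //; apply: measurable_funM => //; apply: measurable_funX.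
exact: measurable_modc (cmeas_plane (entire_ccont (@entire_id R))).
Qed.

Lemma pt_bound_ge0 (N : R) w : 0 <= pt_bound N w.
Proof. by rewrite !mulr_ge0 ?expR_ge0 ?sqrtr_ge0// ltW// pt_const_gt0// ltr1n. Qed.

Lemma pt_bound_kernel_lty (N : R) (w : R[i]) : 0 <= N ->
  (\int[gauss]_x (pt_bound N (plane x) * modc (rker alpha (plane x) w))%:E < +oo)%E.
Proof.
move=> N0.
have c0 : 0 <= 2 * pt_const 2 * Num.sqrt N :> R.
  by rewrite !mulr_ge0 ?sqrtr_ge0// ltW// pt_const_gt0// ltr1n.
have E x : pt_bound N (plane x) * modc (rker alpha (plane x) w) =
   2 * pt_const 2 * Num.sqrt N * expR (al / 2 * sqn x + al * complex.Re (w * (plane x)^*)).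
  by rewrite /pt_bound modc_rker expRD sqnE; ring.
under eq_integral do rewrite E EFinM.
rewrite ge0_integralZl//; last first.
- apply: measurable_EFin; apply: measurableT_comp => //; apply: measurable_funD.
    by apply: measurable_funM => //; exact: measurable_sqn.
  apply: measurable_funM => //.
  have [m1 _] : cmeas (fun x : Pl => w * (plane x)^*).
    by apply: cmeasM; [exact: cmeas_cst|exact: cmeasJ (cmeas_plane (entire_ccont (@entire_id R)))].
  exact: m1.
rewrite (@integral_gauss_expR _ alpha _ (al / 2 * modc w ^+ 2) (al / 2) w) ?divr_gt0//.
  by rewrite -EFinM ltry.
move=> x; by rewrite !modcX2 sqnE modcX2 !ReImE; field.
Qed.

Lemma fock_cmeas (f : R[i] -> R[i]) : fock alpha f -> cmeas (fun x : Pl => f (plane x)).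
Proof. by move=> [ef _]; apply: cmeas_plane; exact: entire_ccont. Qed.

Lemma ktransB (f g : Pl -> R[i]) w : cmeas f -> cmeas g ->
  (sqnorm alpha f < +oo)%E -> (sqnorm alpha g < +oo)%E ->
  ktrans alpha f w - ktrans alpha g w =
  cint gauss (fun x => (f x - g x) * rker alpha (plane x) w).
Proof.
move=> mf mg nf ng; rewrite /ktrans -cintB; try exact: cintegrable_grker.
by apply: eq_cint => x; rewrite mulrBl.
Qed.

(** Fatou's lemma keeps the norm bound. Dominated convergence, with [pt_bound] times a kernel as
    majorant, passes the reproducing formula to the limit; so [f] equals its own kernel transform
    and is entire. *)
Lemma fock_limit (v : nat -> R[i] -> R[i]) (f : R[i] -> R[i]) (N : R) :
  (forall n, fock alpha (v n) /\ (sqnorm alpha (onplane (v n)) <= N%:E)%E) ->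
  (forall w, complex.Re (v n w) @[n --> \oo] --> complex.Re (f w)) ->
  (forall w, complex.Im (v n w) @[n --> \oo] --> complex.Im (f w)) ->
  fock alpha f /\ (sqnorm alpha (onplane f) <= N%:E)%E.
Proof.
move=> hv hR hI.
have vf w : modc (v n w - f w) @[n --> \oo] --> (0 : R) by exact: cvg0_modc_ReIm.
have N0 : 0 <= N by rewrite -lee_fin; exact: le_trans (sqnorm_ge0 alpha _) (hv 0%N).2.
have mv n : cmeas (fun x : Pl => v n (plane x)) by apply: fock_cmeas; case: (hv n).
have mf : cmeas (fun x : Pl => f (plane x)) by apply: cmeas_cvg mv _ _ => x.
have nf : (sqnorm alpha (onplane f) <= N%:E)%E.
  rewrite /sqnorm.
  apply: (@fatou_bound R _ Pl gauss (fun n x => modc (v n (plane x)) ^+ 2) (fun x => modc (f (plane x)) ^+ 2) N%:E) => //.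
  - by move=> n; apply: measurable_funX; exact: measurable_modc (mv n).
  - by move=> n x; rewrite sqr_ge0.
  - move=> x; have c := cvg_modc (vf (plane x)).
    rewrite expr2; under eq_fun do rewrite expr2; exact: cvgM.
  - by move=> n; have [] := hv n.
split=> //; apply/fockP; split; last by apply: le_lt_trans nf _; rewrite ltry.
have nf' : (sqnorm alpha (fun x : Pl => f (plane x)) < +oo)%E.
  by apply: le_lt_trans nf _; rewrite ltry.
suff -> : f = ktrans alpha (fun x : Pl => f (plane x)) by exact: entire_ktrans.
apply/funext => w; apply: modc_cvg_unique (vf w) _.
have bv n u : modc (v n u) <= pt_bound N u by have [h1 h2] := hv n; exact: fock_pt_bound.
have bf u : modc (f u) <= pt_bound N u.
  have c := cvg_modc (vf u).
  by rewrite -(cvg_lim _ c)//; apply: limr_le; [apply/cvg_ex; eexists; exact: c|exact: nearW].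
have B0 u : 0 <= pt_bound N u by exact: le_trans (modc_ge0 _) (bf u).
have mr : measurable_fun setT (fun x : Pl => modc (rker alpha (plane x) w)).
  exact: measurable_modc (cmeas_rker alpha w).
pose h n (x : Pl) := modc (v n (plane x) - f (plane x)) * modc (rker alpha (plane x) w).
have hto0 : (\int[gauss]_x (h n x)%:E)%E @[n --> \oo] --> 0%E.
  apply: (@dominated_to0 _ _ _ _ h (fun x => 2 * (pt_bound N (plane x) * modc (rker alpha (plane x) w)))).
  - by move=> n; apply: measurable_funM => //; apply: measurable_modc; exact: cmeasB.
  - apply: measurable_funM => //; apply: measurable_funM => //.
    exact: measurable_pt_bound.
  - move=> n x; rewrite /h mulr_ge0 ?modc_ge0//= mulrA ler_wpM2r ?modc_ge0//.
    apply: le_trans (modcB _ _) _; rewrite mulr_natl mulr2n; exact: lerD.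
  - move=> x; rewrite -(mul0r (modc (rker alpha (plane x) w))).
    by apply: cvgM; [exact: vf|exact: cvg_cst].
  - under eq_integral do rewrite EFinM.
    rewrite ge0_integralZl//; last 2 first.
    + by apply: measurable_EFin; apply: measurable_funM => //; exact: measurable_pt_bound.
    + by move=> x _; rewrite lee_fin mulr_ge0 ?modc_ge0 ?pt_bound_ge0.
    by rewrite lte_mul_pinfty// pt_bound_kernel_lty.
have hle n : ((modc (v n w - ktrans alpha (fun x : Pl => f (plane x)) w))%:E <=
   2%:E * \int[gauss]_x (h n x)%:E)%E.
  have [/fockP[_ nv] _] := hv n.
  rewrite -(fock_ktrans (hv n).1 w) ktransB//.
  apply: le_trans (modc_cint_le _ _) _.
    by apply: cmeasM; [exact: cmeasB|exact: cmeas_rker].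
  by under eq_integral do rewrite (modcM (_ - _)).
have : (2%:E * \int[gauss]_x (h n x)%:E)%E @[n --> \oo] --> 0%E.
  by rewrite -(mule0 2%:E); apply: cvgeZl.
move=> c; have /fine_cvgP[_] : ((modc (v n w - ktrans alpha (fun x : Pl => f (plane x)) w))%:E)
  @[n --> \oo] --> 0%E.
  apply: (squeeze_cvge _ (cvg_cst 0%E) c); apply: nearW => n.
  by rewrite lee_fin modc_ge0/=; exact: hle.
by [].
Qed.

Lemma l1_const_bound (f : Pl -> R[i]) (N c : R) : (sqnorm alpha f <= N%:E)%E ->
  l1_const alpha f c <= N + fine (exp_moment alpha c).
Proof.
move=> nf; rewrite lerD2r -lee_fin fineK// ge0_fin_numE ?sqnorm_ge0//.
by apply: le_lt_trans nf _; rewrite ltry.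
Qed.

(** The bounds [ub] and [ul] are uniform in [n], so this is an Arzela-Ascoli argument: diagonal
    extraction on a dense set, then equicontinuity. *)
Lemma fock_subsequence (u : nat -> R[i] -> R[i]) (N : R) :
  (forall n, fock alpha (u n) /\ (sqnorm alpha (onplane (u n)) <= N%:E)%E) ->
  exists2 s : nat -> nat, {homo s : m n / (m < n)%N} &
  exists f, [/\ fock alpha f, (sqnorm alpha (onplane f) <= N%:E)%E &
    forall w, modc (u (s n) w - f w) @[n --> \oo] --> (0 : R)].
Proof.
move=> hu; pose K c := N + fine (exp_moment alpha c).
have l1K n c : l1_const alpha (fun x : Pl => u n (plane x)) c <= K c.
  by apply: l1_const_bound; have [] := hu n.
have K0 c : 0 <= K c by exact: le_trans (l1_const_ge0 _ _ _) (l1K 0%N c).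
have mu n : cmeas (fun x : Pl => u n (plane x)) by apply: fock_cmeas; case: (hu n).
have nu n : (sqnorm alpha (fun x : Pl => u n (plane x)) < +oo)%E.
  by apply: le_lt_trans (hu n).2 _; rewrite ltry.
have ub n w : modc (u n w) <= 2 * K (al * modc w).
  rewrite -(fock_ktrans (hu n).1 w); apply: le_trans (ktrans_le (mu n) (nu n) w) _.
  by rewrite ler_pM2l.
have ul n w t : modc t <= 1 -> modc (u n (w + t) - u n w) <= modc t * (66 * K (2 * al + al * modc w)).
  move=> t1; rewrite -!(fock_ktrans (hu n).1); apply: le_trans (ktrans_lipschitz (mu n) (nu n) w t1) _.
  by rewrite mulrCA mulrA ler_wpM2l// mulr_ge0 ?modc_ge0.
pose part (b : bool) (z : R[i]) := if b then complex.Im z else complex.Re z.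
have partB b z z' : `|part b z - part b z'| <= modc (z - z').
  rewrite /part; case: b; rewrite -?ImN -?ImD -?ReN -?ReD; first exact: modc_Im.
  exact: modc_Re.
have part_le b z : `|part b z| <= modc z by rewrite /part; case: b; [exact: modc_Im|exact: modc_Re].
(* The real and imaginary parts at the [k]-th dense point are interleaved, at the indices [2 k] and
   [2 k + 1]. *)
have [s si sc] := @diagonal_subsequence R
  (fun j n => part (odd j) (u n (dense_seq R j./2))) (fun j => 2 * K (al * modc (dense_seq R j./2)))
  (fun j n => le_trans (part_le _ _) (ub _ _)).
exists s => //.
have cv b w : cvgn (fun n => part b (u (s n) w)).
  apply: cvgn_approx => e e0; pose L := 66 * K (2 * al + al * modc w).
  have L0 : 0 <= L by rewrite mulr_ge0.
  have d0 : 0 < Num.min 1 (e / (L + 1)) by rewrite lt_min ltr01 divr_gt0// ltr_wpDl.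
  have [k] := dense_seqP w d0; rewrite lt_min => /andP[k1 ke].
  exists (fun n => part b (u (s n) (dense_seq R k))).
    by have := sc (k.*2 + b)%N; rewrite oddD odd_double halfD doubleK odd_double/= oddb; case: b => /=; rewrite addn0.
  move=> n; apply: le_trans (partB _ _ _) _; rewrite modcBC.
  have := ul (s n) w (dense_seq R k - w) (ltW k1); rewrite (_ : w + (dense_seq R k - w) = dense_seq R k); last by ring.
  move=> /le_trans; apply.
  have : modc (dense_seq R k - w) * (L + 1) <= e by rewrite -ler_pdivlMr ?ltr_wpDl// ltW.
  by have := modc_ge0 (dense_seq R k - w); rewrite -/L; nra.
pose f w := limn (fun n => complex.Re (u (s n) w)) +i* limn (fun n => complex.Im (u (s n) w)).
have fR w : complex.Re (u (s n) w) @[n --> \oo] --> complex.Re (f w) by exact: (cv false w).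
have fI w : complex.Im (u (s n) w) @[n --> \oo] --> complex.Im (f w) by exact: (cv true w).
exists f; have [f1 f2] := @fock_limit (fun n => u (s n)) f N (fun n => hu (s n)) fR fI.
by split=> // w; exact: cvg0_modc_ReIm.
Qed.

End FockSubsequence.

(** * Schur's test and compact kernels *)

Section Schur.
Context d1 d2 (T1 : measurableType d1) (T2 : measurableType d2) (R : realType).
Variables (m1 : {sigma_finite_measure set T1 -> \bar R})
          (m2 : {sigma_finite_measure set T2 -> \bar R}).

Lemma measurable_integral2 (f : T1 * T2 -> R) : measurable_fun setT f ->
  (forall xy, 0 <= f xy) -> measurable_fun setT (fun y => (\int[m1]_x (f (x, y))%:E)%E).
Proof.
move=> mf f0.
by apply: (measurable_fun_fubini_tonelli_G (fun xy => (f xy)%:E)) => //; exact: measurable_EFin.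
Qed.

(* Schur's test: [k] is dominated by [p q], Cauchy-Schwarz is applied to
   [p] and [a q], and [P] is the weight of the test. *)
Lemma schur_test (k p q : T1 * T2 -> R) (P : T2 -> R) (a : T1 -> R) (C : R) :
  measurable_fun setT k -> measurable_fun setT p -> measurable_fun setT q ->
  measurable_fun setT P -> measurable_fun setT a ->
  (forall z, 0 <= k z) -> (forall z, 0 <= p z) -> (forall z, 0 <= q z) ->
  (forall y, 0 <= P y) -> (forall x, 0 <= a x) -> (forall z, k z <= p z * q z) ->
  (forall y, (\int[m1]_x ((p (x, y)) ^+ 2)%:E <= (P y)%:E)%E) ->
  (forall x, (\int[m2]_y (P y * (q (x, y)) ^+ 2)%:E <= C%:E)%E) ->
  (\int[m2]_y ((\int[m1]_x (a x * k (x, y))%:E) * (\int[m1]_x (a x * k (x, y))%:E)) <=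
   C%:E * \int[m1]_x (a x ^+ 2)%:E)%E.
Proof.
move=> mk mp mq mP ma k0 p0 q0 P0 a0 kpq hP hC.
have ma1 : measurable_fun setT (fun z : T1 * T2 => a z.1) by apply: measurableT_comp.
have mP2 : measurable_fun setT (fun z : T1 * T2 => P z.2) by apply: measurableT_comp.
have mG : measurable_fun setT (fun z : T1 * T2 => a z.1 ^+ 2 * (P z.2 * q z ^+ 2)).
  apply: measurable_funM; first exact: measurable_funX.
  by apply: measurable_funM => //; exact: measurable_funX.
have G0 (z : T1 * T2) : 0 <= a z.1 ^+ 2 * (P z.2 * q z ^+ 2).
  by rewrite mulr_ge0 ?sqr_ge0// mulr_ge0 ?sqr_ge0.
have mI : measurable_fun setT (fun y => (\int[m1]_x (a x * k (x, y))%:E)%E).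
  apply: (measurable_integral2 (f := fun z => a z.1 * k z)) => [|z].
    exact: measurable_funM.
  exact: mulr_ge0.
have sec2 (h : T1 * T2 -> R) y : measurable_fun setT h -> measurable_fun setT (fun x => h (x, y)).
  by move=> mh; exact: (measurable_fun_pair1 y mh).
have sec1 (h : T1 * T2 -> R) x : measurable_fun setT h -> measurable_fun setT (fun y => h (x, y)).
  by move=> mh; exact: (measurable_fun_pair2 x mh).
apply: (@le_trans _ _ (\int[m2]_y \int[m1]_x (a x ^+ 2 * (P y * q (x, y) ^+ 2))%:E)%E).
  apply: ge0_le_integral => //.
  - by move=> y _; rewrite mule_ge0// integral_ge0// => x _; rewrite lee_fin mulr_ge0.
  - exact: emeasurable_funM.
  - exact: (measurable_integral2 mG).
  move=> y _.
  have mpy := sec2 p y mp; have mqy := sec2 q y mq; have mky := sec2 k y mk.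
  have I0 : (0 <= \int[m1]_x (a x * k (x, y))%:E)%E.
    by apply: integral_ge0 => x _; rewrite lee_fin mulr_ge0.
  have le1 : (\int[m1]_x (a x * k (x, y))%:E <= \int[m1]_x (p (x, y) * (a x * q (x, y)))%:E)%E.
    apply: ge0_le_integral => //.
    - by move=> x _; rewrite lee_fin mulr_ge0.
    - by apply: measurable_EFin; exact: measurable_funM.
    - by apply: measurable_EFin; apply: measurable_funM => //; exact: measurable_funM.
    - by move=> x _; rewrite lee_fin mulrCA ler_wpM2l.
  apply: le_trans (lee_pmul I0 I0 le1 le1) _.
  apply: le_trans (cauchy_schwarz m1 mpy (measurable_funM ma mqy) _ _) _.
  - by [].
  - by move=> x; rewrite mulr_ge0.
  have -> : (\int[m1]_x (a x ^+ 2 * (P y * q (x, y) ^+ 2))%:E =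
             (P y)%:E * \int[m1]_x ((a x * q (x, y)) ^+ 2)%:E)%E.
    rewrite -ge0_integralZl//; last 3 first.
    - by apply: measurable_EFin; apply: measurable_funX; exact: measurable_funM.
    - by move=> x _; rewrite lee_fin sqr_ge0.
    - by rewrite lee_fin.
    by apply: eq_integral => x _; rewrite -EFinM exprMn mulrCA.
  by apply: lee_pmul => //; apply: integral_ge0 => x _; rewrite lee_fin sqr_ge0.
rewrite -(@fubini_tonelli _ _ _ _ _ m1 m2 (fun z : T1 * T2 => (a z.1 ^+ 2 * (P z.2 * q z ^+ 2))%:E)); last 2 first.
- exact: measurable_EFin.
- by move=> z; rewrite lee_fin.
(* The sign of [C] follows from the last hypothesis only at a point of [T1]; the empty case is
   treated apart. *)
have C0 : forall x : T1, 0 <= C.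
  move=> x; rewrite -lee_fin; apply: le_trans (hC x).
  by apply: integral_ge0 => y _; rewrite lee_fin mulr_ge0 ?sqr_ge0.
have [[x0 _]|] := pselect (exists x : T1, True); last first.
  move=> /forallNP nx; have E : [set: T1] = set0 by apply/seteqP; split => x // _; case: (nx x).
  by rewrite E !integral_set0 mule0.
rewrite -ge0_integralZl//; last 3 first.
- by apply: measurable_EFin; exact: measurable_funX.
- by move=> x _; rewrite lee_fin sqr_ge0.
- by rewrite lee_fin (C0 x0).
apply: ge0_le_integral => //.
- by move=> x _; apply: integral_ge0 => y _; rewrite lee_fin (G0 (x, y)).
- by apply: (measurable_fun_fubini_tonelli_F (fun z : T1 * T2 => (a z.1 ^+ 2 * (P z.2 * q z ^+ 2))%:E)) => //; exact: measurable_EFin.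
- apply: emeasurable_funM => //; apply: measurable_EFin; exact: measurable_funX.
move=> x _ /=; under eq_integral do rewrite EFinM.
rewrite ge0_integralZl//; last 3 first.
- apply: measurable_EFin; apply: measurable_funM => //; apply: measurable_funX; exact: sec1.
- by move=> y _; rewrite lee_fin mulr_ge0 ?sqr_ge0.
- by rewrite lee_fin sqr_ge0.
by rewrite [leRHS]muleC; apply: lee_wpmul2l => //; rewrite lee_fin sqr_ge0.
Qed.

End Schur.

Lemma sqreD_le (R : realType) (x y : \bar R) : (0 <= x)%E -> (0 <= y)%E ->
  ((x + y) * (x + y) <= 2%:E * (x * x) + 2%:E * (y * y))%E.
Proof.
have yy : (2%:E * (+oo * +oo) = +oo :> \bar R)%E by rewrite mulyy gt0_muley// lte_fin.
case: x => [s||]//; last first.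
  move=> _ y0; rewrite (_ : 2%:E * (+oo * +oo) + 2%:E * (y * y) = +oo)%E ?leey//.
  rewrite yy addye// gt_eqF//; apply: (@lt_le_trans _ _ 0%E) => //.
  by rewrite mule_ge0// mule_ge0.
case: y => [t||]//; last first.
  move=> _ _; rewrite (_ : 2%:E * (s%:E * s%:E) + 2%:E * (+oo * +oo) = +oo)%E ?leey//.
  by rewrite yy addey.
rewrite !lee_fin => s0 t0; have := sqr_ge0 (s - t); nra.
Qed.

Section KernelOperator.
Variables (R : realType) (alpha : {posnum R}).
Notation Pl := (measurableTypeR R * measurableTypeR R)%type.
Notation al := (alpha%:num).
Notation gauss := (gauss_measure alpha).
Notation onplane f := (fun x : R * R => f (plane x)).

(** Caratheodory's criterion is applied twice, once for each real coordinate of the second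
    variable. *)
Lemma cmeas_kernel (H : R[i] -> R[i] -> R[i]) :
  (forall w, cmeas (fun x : Pl => H (plane x) w)) -> (forall u z, ccont (H u) z) ->
  cmeas (fun z : Pl * Pl => H (plane z.1) (plane z.2)).
Proof.
move=> mH cH.
have M (h : R[i] -> R) :
    (forall w, measurable_fun setT (fun x : Pl => h (H (plane x) w))) ->
    (forall u y, continuous (fun s => h (H u (s +i* y)))) ->
    (forall u x, continuous (fun t => h (H u (x +i* t)))) ->
    measurable_fun setT (fun z : Pl * Pl => h (H (plane z.1) (plane z.2)) : measurableTypeR R).
  move=> hw hx hy.
  pose f (t : (Pl * measurableTypeR R) * measurableTypeR R) : R := h (H (plane t.1.1) (t.1.2 +i* t.2)).
  have mf : measurable_fun setT (f : _ -> measurableTypeR R).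
    apply: (measurable_caratheodory (f := f)) => [y|x]; last exact: (hy (plane x.1) x.2).
    apply: (measurable_caratheodory (f := fun t : Pl * measurableTypeR R => h (H (plane t.1) (t.2 +i* y)))) => [s|x]; last exact: (hx (plane x) y).
    exact: (hw (s +i* y)).
  apply: (measurableT_comp mf (g := fun z : Pl * Pl => ((z.1, z.2.1), z.2.2))).
  apply: measurable_fun_pair; last by apply: measurableT_comp => //.
  by apply: measurable_fun_pair => //; apply: measurableT_comp.
split; apply: M => [w|u y|u x].
- by have [] := mH w.
- by have [] := ccurve_hline y (cH u).
- by have [] := ccurve_vline x (cH u).
- by have [] := mH w.
- by have [] := ccurve_hline y (cH u).
- by have [] := ccurve_vline x (cH u).
Qed.

Lemma measurable_disc (r : R) : measurable [set x : Pl | modc (plane x) <= r].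
Proof.
have m := measurable_modc (cmeas_plane (entire_ccont (@entire_id R))).
have -> : [set x : Pl | modc (plane x) <= r] = (fun x : Pl => modc (plane x)) @^-1` `]-oo, r].
  by apply/seteqP; split => x /=; rewrite in_itv.
by rewrite -[X in measurable X]setTI; apply: m => //; exact: measurable_itv.
Qed.

Definition disc_ind (r : R) (x : Pl) : R := if modc (plane x) <= r then 1 else 0.

Lemma disc_ind_ge0 r x : 0 <= disc_ind r x.
Proof. by rewrite /disc_ind; case: ifP. Qed.

Definition cut_in r (a : Pl -> R) x := a x * disc_ind r x.
Definition cut_out r (a : Pl -> R) x := a x * (1 - disc_ind r x).

Lemma measurable_disc_ind r : measurable_fun setT (disc_ind r).
Proof.
have -> : disc_ind r = \1_[set x : Pl | modc (plane x) <= r].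
  apply/funext => x; rewrite indicE /disc_ind; case: ifPn => h.
    by rewrite mem_set.
  by rewrite memNset//; exact/negP.
by apply: measurable_indic; exact: measurable_disc.
Qed.

(* [ck_decay] is the form in which the vanishing of [|| S_z 1 ||_p] is used, with
   [delta = alpha / 2 - alpha / p]. *)
Record compact_kernel (H : R[i] -> R[i] -> R[i]) (delta : R) : Prop := CompactKernel {
  ck_fock : forall u, fock alpha (H u);
  ck_meas : forall w, cmeas (fun x : Pl => H (plane x) w);
  ck_sqnorm : forall w, (sqnorm alpha (fun x : Pl => H (plane x) w) < +oo)%E;
  ck_delta : 0 < delta;
  ck_local : forall r : R, exists M : R, forall u, modc u <= r ->
    (sqnorm alpha (onplane (H u)) <= M%:E)%E;
  ck_decay : forall e : R, 0 < e -> exists r : R, forall u, r < modc u -> forall v,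
    modc (H u v) <= e * expR (al / 2 * modc u ^+ 2 + al / 2 * modc v ^+ 2 -
      delta * modc (u - v) ^+ 2) }.

Section kernel.
Variables (H : R[i] -> R[i] -> R[i]) (delta : R).
Hypothesis cH : compact_kernel H delta.

Let mH := cmeas_kernel (ck_meas cH) (fun u => entire_ccont (ck_fock cH u).1).
Let mmH : measurable_fun setT (fun z : Pl * Pl => modc (H (plane z.1) (plane z.2))) :=
  measurable_modc mH.

(** The operator with kernel [|H|], with extended values so that estimates can precede any proof of
    finiteness. *)
Definition abs_trans (a : Pl -> R) (y : Pl) : \bar R :=
  (\int[gauss]_x (a x * modc (H (plane x) (plane y)))%:E)%E.

Let ell (u v : R[i]) : R :=
  al / 2 * modc u ^+ 2 + al / 2 * modc v ^+ 2 - delta * modc (u - v) ^+ 2.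

Let mmod1 : measurable_fun setT (fun z : Pl * Pl => modc (plane z.1)).
Proof.
apply: (measurableT_comp (f := fun x : Pl => modc (plane x))) => //.
exact: measurable_modc (cmeas_plane (entire_ccont (@entire_id R))).
Qed.

Let mmod2 : measurable_fun setT (fun z : Pl * Pl => modc (plane z.2)).
Proof.
apply: (measurableT_comp (f := fun x : Pl => modc (plane x))) => //.
exact: measurable_modc (cmeas_plane (entire_ccont (@entire_id R))).
Qed.

Let mmodB : measurable_fun setT (fun z : Pl * Pl => modc (plane z.1 - plane z.2)).
Proof.
have mpl := cmeas_plane (entire_ccont (@entire_id R)).
apply: measurable_modc; apply: cmeasB.
  exact: (cmeas_comp (g := fst) measurable_fst mpl).
exact: (cmeas_comp (g := snd) measurable_snd mpl).
Qed.

Let mell : measurable_fun setT (fun z : Pl * Pl => ell (plane z.1) (plane z.2)).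
Proof.
apply: measurable_funB; first apply: measurable_funD.
all: by apply: measurable_funM => //; exact: measurable_funX.
Qed.

(** The exponent [ell] is halved between [p] and [q], and [al / 2 * |u|^2] is shifted from [q ^+ 2]
    to [p ^+ 2]. In both integrations the quadratic terms then cancel the Gaussian weight and only
    [- delta * |u - v|^2] is left to integrate, giving [al / delta] each time. *)
Lemma abs_trans_far (e r : R) (a : Pl -> R) :
  measurable_fun setT a -> (forall x, 0 <= a x) -> 0 < e ->
  (forall u, r < modc u -> forall v, modc (H u v) <= e * expR (ell u v)) ->
  (\int[gauss]_y (abs_trans (cut_out r a) y * abs_trans (cut_out r a) y) <=
   (e ^+ 2 * (al / delta) ^+ 2)%:E * \int[gauss]_x (a x ^+ 2)%:E)%E.
Proof.
move=> ma a0 e0 he; have d0 := ck_delta cH.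
pose k (z : Pl * Pl) := (1 - disc_ind r z.1) * modc (H (plane z.1) (plane z.2)).
pose p (z : Pl * Pl) := expR ((ell (plane z.1) (plane z.2) + al / 2 * modc (plane z.1) ^+ 2) / 2).
pose q (z : Pl * Pl) := e * expR ((ell (plane z.1) (plane z.2) - al / 2 * modc (plane z.1) ^+ 2) / 2).
pose P (y : Pl) := al / delta * expR (al / 2 * modc (plane y) ^+ 2).
have mpl : cmeas (fun x : Pl => plane x) := cmeas_plane (entire_ccont (@entire_id R)).
have i0 x : 0 <= 1 - disc_ind r x by rewrite /disc_ind; case: ifP; rewrite ?subrr ?subr0.
have m1 : measurable_fun setT (fun z : Pl * Pl => al / 2 * modc (plane z.1) ^+ 2).
  by apply: measurable_funM => //; exact: measurable_funX.
have mk : measurable_fun setT k.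
  apply: measurable_funM => //; apply: measurable_funB => //.
  apply: (measurableT_comp (f := disc_ind r)) => //; exact: measurable_disc_ind.
have mp : measurable_fun setT p.
  by apply: measurableT_comp => //; apply: measurable_funM => //; exact: measurable_funD.
have mq : measurable_fun setT q.
  apply: measurable_funM => //; apply: measurableT_comp => //.
  by apply: measurable_funM => //; exact: measurable_funB.
have mP : measurable_fun setT P.
  apply: measurable_funM => //; apply: measurableT_comp => //; apply: measurable_funM => //.
  by apply: measurable_funX; exact: measurable_modc (cmeas_plane (entire_ccont (@entire_id R))).
have -> : abs_trans (cut_out r a) = (fun y => \int[gauss]_x (a x * k (x, y))%:E)%E.
  by apply/funext => y; apply: eq_integral => x _; rewrite /k /cut_out mulrA.
apply: (@schur_test _ _ _ _ _ gauss gauss k p q P a) => //.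
- by move=> z; rewrite mulr_ge0 ?modc_ge0.
- by move=> z; rewrite expR_ge0.
- by move=> z; rewrite mulr_ge0 ?expR_ge0// ltW.
- by move=> y; rewrite mulr_ge0 ?expR_ge0// divr_ge0 ?ltW.
- move=> z; rewrite /p /q mulrCA -expRD -mulrDl.
  rewrite (_ : (_ + _) / 2 = ell (plane z.1) (plane z.2)); last by field.
  rewrite /k /disc_ind; case: (leP (modc (plane z.1)) r) => h; first by rewrite subrr mul0r mulr_ge0 ?expR_ge0// ltW.
  by rewrite subr0 mul1r; exact: he.
- move=> y; under eq_integral do rewrite /p expr2 -expRD -splitr.
  rewrite (@integral_gauss_expR _ alpha _ (al / 2 * modc (plane y) ^+ 2) delta (plane y)) => [|//|x].
    by rewrite /P lee_fin.
  by rewrite /ell sqnE; field.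
- move=> x; under eq_integral => y _ do
    rewrite /P /q exprMn [X in e ^+ 2 * X]expr2 -expRD -splitr mulrACA -expRD.
  have -> : (fun y : Pl => (al / delta * e ^+ 2 * expR (al / 2 * modc (plane y) ^+ 2 +
    (ell (plane x) (plane y) - al / 2 * modc (plane x) ^+ 2)))%:E) =
    (fun y => (al / delta * e ^+ 2)%:E *
      (expR (al * modc (plane y) ^+ 2 - delta * modc (plane y - plane x) ^+ 2))%:E)%E.
    apply/funext => y; rewrite -EFinM; congr (_ * expR _)%:E.
    by rewrite /ell modcBC; field.
  rewrite ge0_integralZl//; last 2 first.
  + apply: measurable_EFin; apply: measurableT_comp => //.
    apply: measurable_funB; apply: measurable_funM => //; apply: measurable_funX.
      exact: measurable_modc mpl.
    by apply: measurable_modc; apply: cmeasB => //; exact: cmeas_cst.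
  + by rewrite lee_fin mulr_ge0 ?sqr_ge0// divr_ge0// ltW.
  rewrite (@integral_gauss_expR _ alpha _ 0 delta (plane x)) => [|//|y].
    by rewrite expR0 mulr1 -EFinM lee_fin (_ : _ * _ = e ^+ 2 * (al / delta) ^+ 2)//; ring.
  by rewrite sqnE; ring.
Qed.

(** Schur's test with [p] and [P] equal to one is the Hilbert-Schmidt estimate. Since the indicator
    is idempotent it can stay on [a] too, so the bound sees [a] on the disc only. *)
Lemma abs_trans_near (r M : R) (a : Pl -> R) :
  measurable_fun setT a -> (forall x, 0 <= a x) ->
  (forall u, modc u <= r -> (sqnorm alpha (onplane (H u)) <= M%:E)%E) -> 0 <= M ->
  (\int[gauss]_y (abs_trans (cut_in r a) y * abs_trans (cut_in r a) y) <=
   M%:E * \int[gauss]_x (cut_in r a x ^+ 2)%:E)%E.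
Proof.
move=> ma a0 hM M0.
pose q (z : Pl * Pl) := disc_ind r z.1 * modc (H (plane z.1) (plane z.2)).
have mq : measurable_fun setT q.
  apply: measurable_funM => //.
  apply: (measurableT_comp (f := disc_ind r)) => //; exact: measurable_disc_ind.
have q0 z : 0 <= q z by rewrite mulr_ge0 ?disc_ind_ge0 ?modc_ge0.
have -> : abs_trans (cut_in r a) = (fun y => \int[gauss]_x (cut_in r a x * q (x, y))%:E)%E.
  apply/funext => y; apply: eq_integral => x _; congr (_%:E).
  by rewrite /cut_in /q /disc_ind; case: ifP => _; rewrite ?mulr0 ?mul0r ?mulr1 ?mul1r.
apply: (@schur_test _ _ _ _ _ gauss gauss q (cst 1) q (cst 1) (cut_in r a)) => //.
- by apply: measurable_funM => //; exact: measurable_disc_ind.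
- by move=> x; rewrite mulr_ge0 ?disc_ind_ge0.
- by move=> z; rewrite mul1r.
- move=> y; rewrite /cst/= expr1n (_ : (fun=> 1%:E) = cst (1%:E : \bar R))//.
  by rewrite (integral_cst gauss measurableT) mul1e; have := gauss_setT alpha; rewrite /= => ->.
- move=> x; under eq_integral do rewrite /= mul1r /q/= exprMn.
  rewrite /disc_ind; case: ifP => h.
    by under eq_integral do rewrite expr1n mul1r; exact: hM.
  by under eq_integral do rewrite expr0n mul0r; rewrite integral0 lee_fin.
Qed.

Lemma abs_trans_cut r (a : Pl -> R) y : measurable_fun setT a -> (forall x, 0 <= a x) ->
  abs_trans a y = (abs_trans (cut_in r a) y + abs_trans (cut_out r a) y)%E.
Proof.
move=> ma a0; have my := measurable_fun_pair1 y mmH.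
have i0 x : 0 <= 1 - disc_ind r x by rewrite /disc_ind; case: ifP; rewrite ?subrr ?subr0.
rewrite /abs_trans -ge0_integralD//.
- by apply: eq_integral => x _; rewrite -EFinD; congr (_%:E); rewrite /cut_in /cut_out; ring.
- by move=> x _; rewrite lee_fin !mulr_ge0 ?modc_ge0 ?disc_ind_ge0.
- apply: measurable_EFin; apply: measurable_funM => //.
  by apply: measurable_funM => //; exact: measurable_disc_ind.
- by move=> x _; rewrite lee_fin !mulr_ge0 ?modc_ge0.
- apply: measurable_EFin; apply: measurable_funM => //.
  by apply: measurable_funM => //; apply: measurable_funB => //; exact: measurable_disc_ind.
Qed.

Lemma measurable_abs_trans (a : Pl -> R) : measurable_fun setT a -> (forall x, 0 <= a x) ->
  measurable_fun setT (abs_trans a).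
Proof.
move=> ma a0.
apply: (measurable_integral2 gauss (f := fun z : Pl * Pl => a z.1 * modc (H (plane z.1) (plane z.2)))).
  apply: measurable_funM => //; exact: (measurableT_comp (f := a)).
by move=> z; rewrite mulr_ge0 ?modc_ge0.
Qed.

Lemma abs_trans_ge0 (a : Pl -> R) y : (forall x, 0 <= a x) -> (0 <= abs_trans a y)%E.
Proof. by move=> a0; apply: integral_ge0 => x _; rewrite lee_fin mulr_ge0 ?modc_ge0. Qed.

(** Compactness in quantitative form: up to an arbitrarily small multiple of the full norm, the
    image is controlled by the norm of [a] on a disc. *)
Lemma abs_trans_sqr (e : R) : 0 < e -> exists r M : R, 0 <= M /\
  forall a : Pl -> R, measurable_fun setT a -> (forall x, 0 <= a x) ->
  (\int[gauss]_y (abs_trans a y * abs_trans a y) <=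
   M%:E * \int[gauss]_x (cut_in r a x ^+ 2)%:E + e%:E * \int[gauss]_x (a x ^+ 2)%:E)%E.
Proof.
move=> e0; have d0 := ck_delta cH.
(* The solution of [2 * e' ^+ 2 * (al / delta) ^+ 2 = e]; the [2] comes from [sqreD_le]. *)
pose e' := Num.sqrt (e / 2) * (delta / al).
have e'0 : 0 < e' by rewrite mulr_gt0 ?sqrtr_gt0 ?divr_gt0.
have [r hr] := ck_decay cH e'0.
have [M0 hM0] := ck_local cH r.
(* If [r < 0] the disc is empty and [M0] could be negative. *)
pose M := Num.max M0 0.
have hM u : modc u <= r -> (sqnorm alpha (onplane (H u)) <= M%:E)%E.
  by move=> /hM0 /le_trans; apply; rewrite lee_fin le_max lexx.
have Mge0 : 0 <= M by rewrite le_max lexx orbT.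
exists r, (2 * M); split; first by rewrite mulr_ge0.
move=> a ma a0.
have i0 x : 0 <= 1 - disc_ind r x by rewrite /disc_ind; case: ifP; rewrite ?subrr ?subr0.
have ci0 x : 0 <= cut_in r a x by rewrite mulr_ge0 ?disc_ind_ge0.
have co0 x : 0 <= cut_out r a x by rewrite mulr_ge0.
have mci : measurable_fun setT (cut_in r a) by apply: measurable_funM => //; exact: measurable_disc_ind.
have mco : measurable_fun setT (cut_out r a).
  by apply: measurable_funM => //; apply: measurable_funB => //; exact: measurable_disc_ind.
have mi := measurable_abs_trans mci ci0; have mo := measurable_abs_trans mco co0.
have ii y := abs_trans_ge0 y ci0; have oo y := abs_trans_ge0 y co0.
have near := abs_trans_near ma a0 hM Mge0.
have far := abs_trans_far ma a0 e'0 hr.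
apply: (@le_trans _ _ (\int[gauss]_y (2%:E * (abs_trans (cut_in r a) y * abs_trans (cut_in r a) y) +
   2%:E * (abs_trans (cut_out r a) y * abs_trans (cut_out r a) y)))%E).
  apply: ge0_le_integral => //.
  - by move=> y _; rewrite mule_ge0// abs_trans_ge0.
  - by apply: emeasurable_funM; exact: measurable_abs_trans.
  - by apply: emeasurable_funD; apply: emeasurable_funM => //; exact: emeasurable_funM.
  move=> y _; rewrite (abs_trans_cut r y ma a0).
  exact: sqreD_le.
rewrite ge0_integralD//; last 4 first.
- by move=> y _; rewrite mule_ge0// mule_ge0.
- by apply: emeasurable_funM => //; exact: emeasurable_funM.
- by move=> y _; rewrite mule_ge0// mule_ge0.
- by apply: emeasurable_funM => //; exact: emeasurable_funM.
rewrite !ge0_integralZl//; last 4 first.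
- exact: emeasurable_funM.
- by move=> y _; rewrite mule_ge0.
- exact: emeasurable_funM.
- by move=> y _; rewrite mule_ge0.
apply: leeD.
  by rewrite EFinM -muleA; apply: lee_wpmul2l.
apply: le_trans (lee_wpmul2l _ far) _ => //.
rewrite muleA -EFinM (_ : 2 * _ = e)//.
rewrite /e' exprMn sqr_sqrtr ?divr_ge0 ?ltW//.
by field; rewrite !gt_eqF.
Qed.

End kernel.

End KernelOperator.

Lemma ge0_cvge0P (R : realType) T (F : set_system T) {FF : Filter F} (f : T -> \bar R) :
  (forall x, (0 <= f x)%E) ->
  f x @[x --> F] --> 0%E <-> forall e : R, 0 < e -> \forall x \near F, (f x <= e%:E)%E.
Proof.
move=> f0; split=> [/fine_cvgP[ff /cvgr0Pnorm_lt h] e e0|h].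
  near=> x; have fx : f x \is a fin_num by near: x.
  rewrite -(fineK fx) lee_fin; apply: le_trans (ler_norm _) _; apply: ltW.
  by near: x; exact: h.
apply/fine_cvgP; split.
  apply: filterS (h 1 ltr01) => x h1; rewrite ge0_fin_numE//.
  by apply: le_lt_trans h1 _; rewrite ltry.
apply/cvgr0Pnorm_le => e e0; apply: filterS (h e e0) => x he /=.
by rewrite ger0_norm ?fine_ge0// -lee_fin fineK// ge0_fin_numE// (le_lt_trans he)// ltry.
Unshelve. all: by end_near. Qed.

(** * The integral operator with a compact kernel *)

Section IntegralOperator.
Variables (R : realType) (alpha : {posnum R}).
Notation Pl := (measurableTypeR R * measurableTypeR R)%type.
Notation al := (alpha%:num).
Notation gauss := (gauss_measure alpha).
Notation onplane f := (fun x : R * R => f (plane x)).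

Lemma mul_le_sqreD (x : R) (y : \bar R) : 0 <= x -> (0 <= y)%E ->
  (x%:E * y <= (x ^+ 2)%:E + y * y)%E.
Proof.
move=> x0; case: y => [y||]// y0; last by rewrite mulyy addey ?leey.
by rewrite -!EFinM -EFinD lee_fin; move: y0; rewrite lee_fin => y0; nra.
Qed.

Lemma cintegrable_mul (f g : Pl -> R[i]) : cmeas f -> cmeas g ->
  (sqnorm alpha f < +oo)%E -> (sqnorm alpha g < +oo)%E ->
  cintegrable gauss (fun x => f x * g x).
Proof.
move=> mf mg nf ng.
have mf2 : measurable_fun setT (fun x => (modc (f x) ^+ 2)%:E).
  by apply: measurable_EFin; apply: measurable_funX; exact: measurable_modc.
have mg2 : measurable_fun setT (fun x => (modc (g x) ^+ 2)%:E).
  by apply: measurable_EFin; apply: measurable_funX; exact: measurable_modc.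
apply: (cintegrable_le (g := fun x => (modc (f x) ^+ 2)%:E + (modc (g x) ^+ 2)%:E)%E) => //.
- exact: cmeasM.
- move=> x; rewrite -EFinD lee_fin modcM.
  have := modc_ge0 (f x); have := modc_ge0 (g x); nra.
- exact: emeasurable_funD.
- rewrite ge0_integralD//; try by move=> x _; rewrite lee_fin sqr_ge0.
  exact: lte_add_pinfty.
Qed.

Lemma sqnorm_lin_le (a : R[i]) (f g : Pl -> R[i]) : cmeas f -> cmeas g ->
  (sqnorm alpha (fun x => a * f x + g x)%R <=
   (2 * modc a ^+ 2)%:E * sqnorm alpha f + 2%:E * sqnorm alpha g)%E.
Proof.
move=> mf mg.
have mf2 : measurable_fun setT (fun x => (modc (f x) ^+ 2)%:E).
  by apply: measurable_EFin; apply: measurable_funX; exact: measurable_modc.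
have mg2 : measurable_fun setT (fun x => (modc (g x) ^+ 2)%:E).
  by apply: measurable_EFin; apply: measurable_funX; exact: measurable_modc.
rewrite -!ge0_integralZl//; try by move=> x _; rewrite lee_fin sqr_ge0.
rewrite -ge0_integralD//; first last.
- exact: emeasurable_funM.
- by move=> x _; rewrite !mule_ge0// lee_fin ?sqr_ge0// mulr_ge0 ?sqr_ge0.
- exact: emeasurable_funM.
- by move=> x _; rewrite !mule_ge0// lee_fin ?sqr_ge0// mulr_ge0 ?sqr_ge0.
- apply: ge0_le_integral => //.
  - by move=> x _; rewrite lee_fin sqr_ge0.
  - apply: measurable_EFin; apply: measurable_funX; apply: measurable_modc.
    by apply: cmeasD => //; apply: cmeasM => //; exact: cmeas_cst.
- by apply: emeasurable_funD; exact: emeasurable_funM.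
move=> x _; rewrite -!EFinM -EFinD lee_fin.
have := modcD (a * f x) (g x); rewrite modcM.
have := modc_ge0 (a * f x + g x).
have := modc_ge0 (f x); have := modc_ge0 (g x); have := modc_ge0 a.
set A := modc a; set s := modc (_ + _); set F := modc (f x); set G := modc (g x) => A0 G0 F0 s0 h.
apply: (@le_trans _ _ ((A * F + G) ^+ 2)); first by rewrite ler_sqr ?nnegrE// addr_ge0// mulr_ge0.
  by rewrite -subr_ge0 (_ : _ - _ = (A * F - G) ^+ 2) ?sqr_ge0//; ring.
by rewrite lee_fin mulr_ge0 ?sqr_ge0.
Qed.

Lemma fock_lin (a : R[i]) (f g : R[i] -> R[i]) : fock alpha f -> fock alpha g ->
  fock alpha (fun w => a * f w + g w).
Proof.
move=> /[dup] ff /fockP[ef nf] /[dup] fg /fockP[eg ng]; apply/fockP; split.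
  exact: (entireD (entireM (@entire_cst R a) ef) eg).
apply: le_lt_trans (sqnorm_lin_le a (fock_cmeas ff) (fock_cmeas fg)) _.
by apply: lte_add_pinfty; apply: lte_mul_pinfty => //; rewrite lee_fin mulr_ge0 ?sqr_ge0.
Qed.

Lemma rker_sqnorm_lty (z : R[i]) : (sqnorm alpha (fun x : Pl => rker alpha (plane x) z) < +oo)%E.
Proof.
apply: le_lt_trans (exp_moment_lty alpha (al * modc z)).
apply: ge0_le_integral => //.
- by move=> x _; rewrite lee_fin sqr_ge0.
- apply: measurable_EFin; apply: measurable_funX.
  exact: measurable_modc (cmeas_rker alpha z).
- by apply: measurable_EFin; apply: measurable_funX; exact: measurable_expR_modc.
- by move=> x _; rewrite lee_fin ler_sqr ?nnegrE ?modc_ge0 ?expR_ge0// modc_rker_le.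
Qed.

Section kernel.
Variables (H : R[i] -> R[i] -> R[i]) (delta : R).
Hypothesis cH : compact_kernel alpha H delta.

Let mH := cmeas_kernel (ck_meas cH) (fun u => entire_ccont (ck_fock cH u).1).

Let mH2 : cmeas (fun z : Pl * Pl => H (plane z.2) (plane z.1)).
Proof.
have ms : measurable_fun setT (fun z : Pl * Pl => (z.2, z.1)) by exact: measurable_swap.
exact: (cmeas_comp ms mH).
Qed.

Definition kop (f : R[i] -> R[i]) (w : R[i]) : R[i] :=
  cint gauss (fun x => f (plane x) * H (plane x) w).

Lemma cintegrable_kop f w : fock alpha f -> cintegrable gauss (fun x => f (plane x) * H (plane x) w).
Proof.
move=> /[dup] ff /fockP[_ nf].
exact: (cintegrable_mul (fock_cmeas ff) (ck_meas cH w) nf (ck_sqnorm cH w)).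
Qed.

Lemma kop_lin a f g : fock alpha f -> fock alpha g ->
  kop (fun w => a * f w + g w) = (fun w => a * kop f w + kop g w).
Proof.
move=> ff fg; apply/funext => w; have cf := cintegrable_kop w ff; have cg := cintegrable_kop w fg.
rewrite /kop -cintZ// -cintD//; last exact: cintegrableZ.
by apply: eq_cint => x; ring.
Qed.

Section image.
Variable f : R[i] -> R[i].
Hypothesis ff : fock alpha f.
Let mf := fock_cmeas ff.
Let a (x : Pl) := modc (f (plane x)).
Let ma : measurable_fun setT a := measurable_modc mf.
Let a0 x : 0 <= a x := modc_ge0 _.
Let mT := measurable_abs_trans cH ma a0.
Let T0 y := abs_trans_ge0 alpha H y a0.

Lemma kop_le y : ((modc (kop f (plane y)))%:E <= 2%:E * abs_trans alpha H a y)%E.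
Proof.
apply: le_trans (modc_cint_le _ _) _.
  by apply: cintegrable_cmeas; exact: cintegrable_kop.
by under eq_integral do rewrite modcM.
Qed.

Lemma abs_trans_sqr_lty : (\int[gauss]_y (abs_trans alpha H a y * abs_trans alpha H a y) < +oo)%E.
Proof.
have [r [M [M0 h]]] := abs_trans_sqr cH ltr01.
have /fockP[_ nf] := ff.
apply: le_lt_trans (h _ ma a0) _; apply: lte_add_pinfty; apply: lte_mul_pinfty => //.
apply: le_lt_trans nf; apply: ge0_le_integral => //.
- by move=> x _; rewrite lee_fin sqr_ge0.
- apply: measurable_EFin; apply: measurable_funX; apply: measurable_funM => //.
  exact: measurable_disc_ind.
- by apply: measurable_EFin; exact: measurable_funX.
- move=> x _; rewrite lee_fin /cut_in /disc_ind /a; case: ifP => _; first by rewrite mulr1.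
  by rewrite mulr0 expr0n sqr_ge0.
Qed.

(** Measurability has to come from Fubini: that [kop f] is entire is deduced later from
    [entire_ktrans], which already asks for a measurable function. *)
Lemma cmeas_kop : cmeas (fun y : Pl => kop f (plane y)).
Proof.
have mF : cmeas (fun z : Pl * Pl => f (plane z.2) * H (plane z.2) (plane z.1)).
  apply: cmeasM; first exact: (cmeas_comp (g := snd) measurable_snd mf).
  exact: mH2.
have fin (h : R[i] -> R) : measurable_fun setT (fun z : Pl * Pl => h (f (plane z.2) * H (plane z.2) (plane z.1))) ->
    (forall z, `|h z| <= modc z) ->
    (\int[gauss]_x \int[gauss]_y `|(h (f (plane y) * H (plane y) (plane x)))%:E| < +oo)%E.
  move=> mh hz.
  (* The pointwise bound [T <= 1 + T^2] suffices, since the total mass is one. *)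
  apply: (@le_lt_trans _ _ (\int[gauss]_y (1%:E + abs_trans alpha H a y * abs_trans alpha H a y))%E).
    apply: ge0_le_integral => //.
    - by move=> x _; exact: integral_ge0.
    - apply: (measurable_fun_fubini_tonelli_F (fun z : Pl * Pl => `|(h (f (plane z.2) * H (plane z.2) (plane z.1)))%:E|%E)) => //.
      by apply: measurableT_comp => //; exact: measurable_EFin.
    - by apply: emeasurable_funD => //; exact: emeasurable_funM.
    move=> x _; apply: (@le_trans _ _ (abs_trans alpha H a x)).
      apply: ge0_le_integral => //.
      - apply: measurableT_comp => //; apply: measurable_EFin.
        exact: (measurable_fun_pair2 x mh).
      - apply: measurable_EFin; apply: measurable_funM => //.
        by apply: measurable_modc; exact: (ck_meas cH).
      - by move=> y _; rewrite /= lee_fin; apply: le_trans (hz _) _; rewrite modcM.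
    by have := mul_le_sqreD ler01 (T0 x); rewrite mul1e expr1n.
  rewrite ge0_integralD//; first last.
  - exact: emeasurable_funM.
  - by move=> y _; exact: mule_ge0.
  apply: lte_add_pinfty; last exact: abs_trans_sqr_lty.
  by rewrite (integral_cst gauss measurableT) mul1e; have := gauss_setT alpha; rewrite /= => ->; rewrite ltry.
split.
  apply: (measurable_Rintegral2 (f := fun z : Pl * Pl => complex.Re (f (plane z.2) * H (plane z.2) (plane z.1)))).
    by have [] := mF.
  by apply: fin; [have [] := mF|exact: modc_Re].
apply: (measurable_Rintegral2 (f := fun z : Pl * Pl => complex.Im (f (plane z.2) * H (plane z.2) (plane z.1)))).
  by have [] := mF.
by apply: fin; [have [] := mF|exact: modc_Im].
Qed.

Lemma sqnorm_kop_le : (sqnorm alpha (fun y : Pl => kop f (plane y)) <=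
  4%:E * \int[gauss]_y (abs_trans alpha H a y * abs_trans alpha H a y))%E.
Proof.
rewrite -ge0_integralZl//; last 2 first.
- exact: emeasurable_funM.
- by move=> y _; exact: mule_ge0.
apply: ge0_le_integral => //.
- by move=> x _; rewrite lee_fin sqr_ge0.
- by apply: measurable_EFin; apply: measurable_funX; apply: measurable_modc; exact: cmeas_kop.
- by apply: emeasurable_funM => //; exact: emeasurable_funM.
move=> y _; rewrite expr2 EFinM.
have h := kop_le y; have k0 : (0 <= (modc (kop f (plane y)))%:E)%E by rewrite lee_fin modc_ge0.
by apply: le_trans (lee_pmul k0 k0 h h) _; rewrite muleACA -EFinM -natrM.
Qed.

Lemma kop_sqnorm_lty : (sqnorm alpha (fun y : Pl => kop f (plane y)) < +oo)%E.
Proof. apply: le_lt_trans sqnorm_kop_le _; apply: lte_mul_pinfty => //; exact: abs_trans_sqr_lty. Qed.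

(** After Fubini the transform acts on each [H (plane x)], which lies in the Fock space and is
    reproduced. With [entire_ktrans] this makes [kop f] entire. *)
Lemma kop_ktrans z : ktrans alpha (fun y : Pl => kop f (plane y)) z = kop f z.
Proof.
pose F (t : Pl * Pl) := rker alpha (plane t.1) z * (f (plane t.2) * H (plane t.2) (plane t.1)).
have mr := cmeas_rker alpha z.
have mF : cmeas F.
  apply: cmeasM; first exact: (cmeas_comp (g := fst) measurable_fst mr).
  apply: cmeasM; first exact: (cmeas_comp (g := snd) measurable_snd mf).
  exact: mH2.
transitivity (cint gauss (fun y => cint gauss (fun x => F (y, x)))).
  apply: eq_cint => y; rewrite mulrC /kop -cintZ//.
  exact: cintegrable_kop.
rewrite cint_fubini//.
- apply: eq_cint => x; rewrite -(fock_ktrans (ck_fock cH (plane x)) z) /ktrans -cintZ.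
    by apply: eq_cint => y; rewrite /F/=; ring.
  apply: cintegrable_grker; first by apply: fock_cmeas; exact: (ck_fock cH).
  by have /fockP[] := ck_fock cH (plane x).
- by move=> y; exact: (cintegrableZ (rker alpha (plane y) z) (cintegrable_kop (plane y) ff)).
- move=> x; rewrite (_ : (fun y => F (y, x)) = (fun y => f (plane x) * (H (plane x) (plane y) * rker alpha (plane y) z))).
    apply: (@cintegrableZ _ _ _ _ (f (plane x))); apply: cintegrable_grker; first by apply: fock_cmeas; exact: (ck_fock cH).
    by have /fockP[] := ck_fock cH (plane x).
  by apply/funext => y; rewrite /F/=; ring.
apply: (@le_lt_trans _ _ (\int[gauss]_y ((modc (rker alpha (plane y) z) ^+ 2)%:E +
   abs_trans alpha H a y * abs_trans alpha H a y))%E).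
  have mr2 : measurable_fun setT (fun y : Pl => (modc (rker alpha (plane y) z) ^+ 2)%:E).
    by apply: measurable_EFin; apply: measurable_funX; exact: measurable_modc.
  apply: ge0_le_integral => //.
  - by move=> y _; apply: integral_ge0 => x _; rewrite lee_fin modc_ge0.
  - apply: (measurable_fun_fubini_tonelli_F (fun t => (modc (F t))%:E)) => [|t].
      exact: measurable_EFin (measurable_modc mF).
    by rewrite lee_fin modc_ge0.
  - by apply: emeasurable_funD => //; exact: emeasurable_funM.
  move=> y _; apply: le_trans (mul_le_sqreD (modc_ge0 _) (T0 y)).
  rewrite -ge0_integralZl//; last 3 first.
  - apply: measurable_EFin; apply: measurable_funM => //.
    by apply: measurable_modc; exact: (ck_meas cH).
  - by move=> x _; rewrite lee_fin mulr_ge0 ?modc_ge0.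
  - by rewrite lee_fin modc_ge0.
  rewrite le_eqVlt; apply/orP; left; apply/eqP; apply: eq_integral => x _.
  by rewrite /F -EFinM (modcM (rker _ _ _)) (modcM (f _)).
rewrite ge0_integralD//; first last.
- exact: emeasurable_funM.
- by move=> y _; exact: mule_ge0.
- by apply: measurable_EFin; apply: measurable_funX; exact: measurable_modc.
- by move=> x _; rewrite lee_fin sqr_ge0.
apply: lte_add_pinfty; last exact: abs_trans_sqr_lty.
exact: rker_sqnorm_lty.
Qed.

Lemma fock_kop : fock alpha (kop f).
Proof.
apply/fockP; split; last exact: kop_sqnorm_lty.
rewrite (_ : kop f = ktrans alpha (fun y : Pl => kop f (plane y))); last first.
  by apply/funext => z; rewrite kop_ktrans.
by apply: entire_ktrans; [exact: cmeas_kop|exact: kop_sqnorm_lty].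
Qed.

End image.

Lemma sqnorm_kop_to0 (v : nat -> R[i] -> R[i]) (N : R) :
  (forall n, fock alpha (v n) /\ (sqnorm alpha (onplane (v n)) <= N%:E)%E) ->
  (forall w, modc (v n w) @[n --> \oo] --> (0 : R)) ->
  forall e : R, 0 < e -> \forall n \near \oo,
    (sqnorm alpha (onplane (kop (v n))) <= e%:E)%E.
Proof.
move=> hv v0 e e0.
have N0 : 0 <= N by rewrite -lee_fin; exact: le_trans (sqnorm_ge0 alpha _) (hv 0%N).2.
(* After the factor [4] of [sqnorm_kop_le], the disc part and the remainder each take at most
   [e / 2]; [N + 1] avoids a zero denominator. *)
have e'0 : 0 < e / (8 * (N + 1)) by rewrite divr_gt0// mulr_gt0// ltr_wpDl.
have [r [M [M0 hM]]] := abs_trans_sqr cH e'0.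
pose c n (x : Pl) := cut_in r (fun y => modc (v n (plane y))) x ^+ 2.
have mv n : measurable_fun setT (fun y : Pl => modc (v n (plane y))).
  by apply: measurable_modc; apply: fock_cmeas; exact: (hv n).1.
have c0 : (\int[gauss]_x (c n x)%:E)%E @[n --> \oo] --> 0%E.
  (* The maximum of [pt_bound N] on the disc: a constant majorant, integrable for a probability
     measure. *)
  pose B := 2 * pt_const 2 * expR (al / 2 * r ^+ 2) * Num.sqrt N.
  have B0 : 0 <= B by rewrite !mulr_ge0 ?expR_ge0 ?sqrtr_ge0// ltW// pt_const_gt0// ltr1n.
  apply: (@dominated_to0 _ _ _ _ c (fun=> B ^+ 2)) => //.
  - move=> n; apply: measurable_funX; apply: measurable_funM => //.
    exact: measurable_disc_ind.
  - move=> n x; rewrite /c sqr_ge0/= /cut_in /disc_ind; case: ifP => h; last first.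
      by rewrite mulr0 expr0n sqr_ge0.
    rewrite mulr1 ler_sqr ?nnegrE ?modc_ge0//.
    apply: le_trans (fock_pt_bound (plane x) N0 (hv n).1 (hv n).2) _.
    rewrite /pt_bound /B ler_wpM2r ?sqrtr_ge0// ler_wpM2l//.
      by rewrite !mulr_ge0// ltW// pt_const_gt0// ltr1n.
    rewrite ler_expR ler_wpM2l// ler_sqr// nnegrE ?modc_ge0//.
    exact: le_trans (modc_ge0 _) h.
  - move=> x; rewrite /c; under eq_fun do rewrite expr2.
    rewrite -(mul0r (0 : R)); apply: cvgM.
      by rewrite -(mul0r (disc_ind r x)); apply: cvgM; [exact: v0|exact: cvg_cst].
    by rewrite -(mul0r (disc_ind r x)); apply: cvgM; [exact: v0|exact: cvg_cst].
  - by rewrite (integral_cst gauss measurableT); have := gauss_setT alpha; rewrite /= => ->; rewrite mule1 ltry.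
have M1 : 0 < e / (8 * (M + 1)) by rewrite divr_gt0// mulr_gt0// ltr_wpDl.
have near : \forall n \near \oo, (\int[gauss]_x (c n x)%:E <= (e / (8 * (M + 1)))%:E)%E.
  have I0 n : (0 <= \int[gauss]_x (c n x)%:E)%E.
    by apply: integral_ge0 => x _; rewrite lee_fin sqr_ge0.
  have [+ _] := @ge0_cvge0P R nat \oo _ (fun n => \int[gauss]_x (c n x)%:E)%E I0.
  by apply.
apply: filterS near => n hn.
apply: le_trans (sqnorm_kop_le (hv n).1) _.
have h4 := hM _ (mv n) (fun y => modc_ge0 _).
apply: (@le_trans _ _ (4%:E * (M%:E * (e / (8 * (M + 1)))%:E + (e / (8 * (N + 1)))%:E * N%:E)))%E.
  apply: lee_wpmul2l => //; apply: le_trans h4 _; apply: leeD.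
    exact: lee_wpmul2l.
  by apply: lee_wpmul2l; [rewrite lee_fin ltW|exact: (hv n).2].
rewrite -(EFinM M) -(EFinM _ N) -EFinD -EFinM lee_fin.
have frac (X : R) : 0 <= X -> X * (e / (8 * (X + 1))) <= e / 8.
  move=> X0; have X1 : 0 < X + 1 by rewrite ltr_wpDl.
  have -> : X * (e / (8 * (X + 1))) = e / 8 * (X / (X + 1)) by field; rewrite gt_eqF.
  by rewrite ler_piMr ?divr_ge0 ?(ltW e0)// ler_pdivrMr// mul1r lerDl.
have := frac _ M0; have := frac _ N0; rewrite [N * _]mulrC.
lra.
Qed.

Lemma kop_compact (u : nat -> R[i] -> R[i]) (M : R) :
  (forall n, fock alpha (u n) /\ (fnorm alpha 2 (u n) <= M%:E)%E) ->
  exists s : nat -> nat, {homo s : m n / (m < n)%N} /\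
  exists2 g, fock alpha g &
    fnorm alpha 2 (fun w => kop (u (s n)) w - g w) @[n --> \oo] --> 0%E.
Proof.
move=> hu.
have M0 : 0 <= M by rewrite -lee_fin; apply: le_trans (hu 0%N).2; exact: Lnorm_ge0.
have hu2 n : fock alpha (u n) /\ (sqnorm alpha (onplane (u n)) <= (M ^+ 2)%:E)%E.
  by have [h1 h2] := hu n; split => //; exact/fnorm2_le.
have [s si [f [ff nf sf]]] := fock_subsequence hu2.
exists s; split=> //; exists (kop f); first exact: fock_kop.
(* The difference is written in the shape [a * f + g] of [fock_lin], [kop_lin] and [sqnorm_lin_le];
   the last gives the bound [4 * M ^+ 2]. *)
pose v n w := (-1) * f w + u (s n) w.
have fv n : fock alpha (v n) by apply: fock_lin => //; exact: (hu _).1.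
have hv n : fock alpha (v n) /\ (sqnorm alpha (onplane (v n)) <= (4 * M ^+ 2)%:E)%E.
  split=> //; apply: le_trans (sqnorm_lin_le _ (fock_cmeas ff) (fock_cmeas (hu (s n)).1)) _.
  rewrite (_ : 4 * M ^+ 2 = 2 * modc (-1 : R[i]) ^+ 2 * M ^+ 2 + 2 * M ^+ 2); last first.
    by rewrite modcN modc1; ring.
  rewrite (EFinD (_ * _)); apply: leeD; rewrite [leRHS]EFinM; apply: lee_wpmul2l => //.
    by rewrite lee_fin mulr_ge0 ?sqr_ge0.
  exact: (hu2 _).2.
have v0 w : modc (v n w) @[n --> \oo] --> (0 : R).
  by under eq_fun do rewrite /v mulN1r addrC; exact: sf.
have E n : (fun w => kop (u (s n)) w - kop f w) = kop (v n).
  by rewrite kop_lin//; [apply/funext => w; rewrite mulN1r addrC|exact: (hu _).1].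
under eq_fun do rewrite E.
have K := sqnorm_kop_to0 hv v0.
have F n : (0 <= fnorm alpha 2 (kop (v n)))%E by exact: Lnorm_ge0.
apply/ge0_cvge0P => // e e0.
have e20 : 0 < e ^+ 2 by rewrite exprn_gt0.
apply: filterS (K _ e20) => n hn; apply/fnorm2_le => //; exact: ltW.
Qed.

End kernel.

End IntegralOperator.

(** * Operators with vanishing transforms *)

Section LocalBound.
Variable R : realType.

(** Bisection with the property of being bounded on a square plays the role of compactness of the
    disc. *)
Lemma locally_bounded_disc (phi : R[i] -> \bar R) :
  (forall z, exists2 rho : R, 0 < rho & exists M : R, forall u, modc (u - z) < rho ->
    (phi u <= M%:E)%E) ->
  forall r : R, exists M : R, forall u, modc u <= r -> (phi u <= M%:E)%E.
Proof.
move=> loc r.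
pose P (x y k : R) := exists M : R, forall u : R[i],
  x <= complex.Re u <= x + k -> y <= complex.Im u <= y + k -> (phi u <= M%:E)%E.
have max_le (M M' : R) u : (phi u <= M%:E)%E \/ (phi u <= M'%:E)%E -> (phi u <= (Num.max M M')%:E)%E.
  by case=> /le_trans; apply; rewrite lee_fin le_max lexx ?orbT.
have PP : forall x y k, 0 < k -> P x y k.
  apply: (@bisection R 1 1 P ltr01 ltr01) => [x y k k0|x0 y0].
    rewrite !mulr1 => -[M1 h1] [M2 h2] [M3 h3] [M4 h4].
    exists (Num.max (Num.max M1 M2) (Num.max M3 M4)) => u /andP[u1 u2] /andP[v1 v2].
    apply: (max_le); have [ux|ux] := leP (complex.Re u) (x + k / 2);
      have [vy|vy] := leP (complex.Im u) (y + k / 2).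
    - by left; apply: (max_le); left; apply: h1; apply/andP.
    - by right; apply: (max_le); left; apply: h3; apply/andP; split => //; lra.
    - by left; apply: (max_le); right; apply: h2; apply/andP; split => //; lra.
    - by right; apply: (max_le); right; apply: h4; apply/andP; split => //; lra.
  have [rho rho0 [M hM]] := loc (x0 +i* y0).
  exists (rho / 2) => [|x y k k0 kr]; first by rewrite divr_gt0.
  rewrite !mulr1 => hx hy; exists M => u hu hv; apply: hM.
  apply: le_lt_trans (modc_leReIm _) _; rewrite !ReImE /= (splitr rho).
  by apply: ltrD; rewrite ltr_norml; apply/andP; split; lra.
have r1 : 0 < 2 * (`|r| + 1) by rewrite mulr_gt0// ltr_wpDl.
have [M hM] := PP (- (`|r| + 1)) (- (`|r| + 1)) _ r1.
exists M => u ur; have rr := ler_norm r.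
have := le_trans (modc_Re u) ur; have := le_trans (modc_Im u) ur.
rewrite !ler_norml => /andP[a b] /andP[c d].
by apply: hM; apply/andP; split; lra.
Qed.

End LocalBound.

Section Main.
Variables (R : realType) (alpha : {posnum R}).
Notation Pl := (measurableTypeR R * measurableTypeR R)%type.
Notation al := (alpha%:num).
Notation gauss := (gauss_measure alpha).
Notation onplane f := (fun x : R * R => f (plane x)).

Lemma fdotE (f g : R[i] -> R[i]) :
  fdot alpha f g = cint gauss (fun x => f (plane x) * (g (plane x))^*%C).
Proof. by []. Qed.

Lemma fdot_rker (f : R[i] -> R[i]) w : fock alpha f -> fdot alpha f (rker alpha w) = f w.
Proof.
move=> ff; rewrite fdotE -(fock_ktrans ff w); apply: eq_cint => x.
by rewrite rkerJ.
Qed.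

Lemma conjcM (a b : R[i]) : (a * b)^*%C = a^*%C * b^*%C.
Proof. by apply: complex_ext; rewrite !ReImE; ring. Qed.

Lemma rker_spanE w : rker_span alpha (rker alpha w).
Proof.
exists 1%N, (fun=> 1), (fun=> w); apply/funext => z.
by rewrite big_ord1 mul1r.
Qed.

(** Near [z], [F u] is [conj t * q + (conj t * G + F z)] with [t = u - z] and [q] of norm at most
    one, since [q] is the difference between the quotient and its limit [G]. *)
Lemma conj_analytic_local (F : R[i] -> R[i] -> R[i]) : conj_analytic alpha F ->
  forall z, exists2 rho : R, 0 < rho & exists M : R, forall u, modc (u - z) < rho ->
    (sqnorm alpha (onplane (F u)) <= M%:E)%E.
Proof.
move=> [fF dF] z; have [G fG] := dF z.
move/ge0_cvge0P => /(_ _ 1 ltr01) h.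
have {h} /nbhs0_modc[rho rho0 hrho] : \forall t \near (0 : R[i]^o)^',
  (fnorm alpha 2 (fun w => ((F (z + t) w - F z w) / conjc t - G w)%R) <= 1%:E)%E.
  by apply: h => t; exact: Lnorm_ge0.
exists (Num.min rho 1); first by rewrite lt_min rho0 ltr01.
have fin f : fock alpha f -> sqnorm alpha (onplane f) \is a fin_num.
  by move=> /fockP[_ nf]; rewrite ge0_fin_numE// sqnorm_ge0.
pose nG := fine (sqnorm alpha (onplane G)); pose nF := fine (sqnorm alpha (onplane (F z))).
have nG0 : 0 <= nG by rewrite fine_ge0// sqnorm_ge0.
have nF0 : 0 <= nF by rewrite fine_ge0// sqnorm_ge0.
(* Two applications of [sqnorm_lin_le] with [|t| < 1]: [2 * 1] for [q], and [2 * (2 * nG + 2 * nF)]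
   for the rest. *)
exists (2 + (4 * nG + 4 * nF)) => u; rewrite lt_min => /andP[u1 u2].
pose t := u - z; have ut : u = z + t by rewrite /t; ring.
have [t0|t0] := eqVneq t 0.
  rewrite ut t0 addr0 -(fineK (fin _ (fF z))) lee_fin -/nF; lra.
have := hrho t t0 u1; rewrite -ut => /(fnorm2_le _ _ ler01).
set q := fun w => _ => hq.
have mq : cmeas q.
  rewrite /q.
  apply: cmeasB; last exact: (fock_cmeas fG).
  apply: cmeasM; last exact: cmeas_cst.
  exact: (cmeasB (fock_cmeas (fF u)) (fock_cmeas (fF z))).
have tc0 : t^*%C != 0 by rewrite -modc_gt0 modcJ modc_gt0.
have fGF := fock_lin t^*%C fG (fF z).
have E : onplane (F u) = (fun x : Pl => t^*%C * q x + (t^*%C * G (plane x) + F z (plane x))).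
  by apply/funext => x; rewrite /q; field.
have t2 : modc t^*%C ^+ 2 <= 1 by rewrite modcJ expr_le1// ?modc_ge0// ltW.
have hlin := sqnorm_lin_le alpha t^*%C mq (fock_cmeas fGF).
rewrite E; apply: (le_trans hlin).
rewrite (EFinD 2); apply: leeD.
  apply: (@le_trans _ _ ((2 * modc t^*%C ^+ 2)%:E * 1%:E)%E).
    by apply: lee_wpmul2l; [rewrite lee_fin mulr_ge0 ?sqr_ge0|rewrite expr1n in hq].
  by rewrite -EFinM lee_fin; lra.
apply: (@le_trans _ _ (2%:E * (2 * nG + 2 * nF)%:E)%E); last first.
  by rewrite -EFinM lee_fin; lra.
apply: lee_wpmul2l => //.
have hlin2 := sqnorm_lin_le alpha t^*%C (fock_cmeas fG) (fock_cmeas (fF z)).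
apply: (le_trans hlin2).
rewrite -(fineK (fin _ fG)) -(fineK (fin _ (fF z))) -/nG -/nF -!EFinM -EFinD lee_fin.
nra.
Qed.

Section operator.
Variable S : fock_operator alpha.
Hypothesis hS : standing S.

Let H (u : R[i]) : R[i] -> R[i] := op S (rker alpha u).

Let domr w : dom S (rker alpha w).
Proof. by case: hS => h _ _; apply: h; exact: rker_spanE. Qed.

Lemma op_fun0 : op S (fun=> 0) = (fun=> 0).
Proof.
have := op_lin (-1) (dom0 S) (dom0 S).
rewrite (_ : (fun _ => -1 * 0 + 0) = (fun=> 0)); last by apply/funext => w; ring.
by move=> ->; apply/funext => w; ring.
Qed.

Lemma op_scale (a : R[i]) f : dom S f -> op S (fun w => a * f w) = (fun w => a * op S f w).
Proof.
move=> df; have := op_lin a df (dom0 S); rewrite op_fun0.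
have E (g : R[i] -> R[i]) : (fun w => a * g w + 0) = (fun w => a * g w).
  by apply/funext => w; rewrite addr0.
by rewrite !E.
Qed.

(** The function [h w] is the adjoint applied to the kernel at [w]. Pairing [S f] with that kernel
    evaluates it at [w], so [S f w = fdot f (h w)]; the case of a kernel [f] identifies the
    conjugate of [h w u] with [H u w]. *)
Lemma adjoint_rker : exists2 h : R[i] -> R[i] -> R[i], (forall w, fock alpha (h w)) &
  (forall u w, H u w = (h w u)^*%C) /\
  (forall f w, dom S f -> op S f w = kop alpha H f w).
Proof.
have [_ hadj _] := hS.
have /choice[h hP] : forall w, exists h, fock alpha h /\
    forall f, dom S f -> fdot alpha (op S f) (rker alpha w) = fdot alpha f h.
  by move=> w; have [_ [h fh hf]] := hadj _ (rker_spanE w); exists h.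
have opE f w : dom S f -> op S f w = cint gauss (fun x => f (plane x) * (h w (plane x))^*%C).
  by move=> df; rewrite -(fdot_rker w (op_fock df)) (hP w).2.
have HE u w : H u w = (h w u)^*%C.
  rewrite /H opE// -(fock_ktrans (hP w).1 u) /ktrans -cintJ; last first.
    apply: cintegrable_grker; first by apply: fock_cmeas; exact: (hP w).1.
    by have /fockP[] := (hP w).1.
  by apply: eq_cint => x; rewrite conjcM rkerJ mulrC.
exists h; first by move=> w; exact: (hP w).1.
split=> // f w df; rewrite opE// /kop; apply: eq_cint => x; by rewrite HE.
Qed.

Lemma modc_rker_diag z : complex.Re (rker alpha z z) = expR (al * modc z ^+ 2).
Proof.
have := modcX2 z; rewrite rkerE /cexp => h2.
have -> : al%:C * z * z^*%C = (al * modc z ^+ 2)%:C.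
  by rewrite h2; apply: complex_ext; rewrite !ReImE/=; ring.
by rewrite !ReImE/= sin0 cos0; ring.
Qed.

(** The inner Weyl operator sends [1] to the normalized kernel at [z], the outer one composes with
    [z - w] and multiplies by that kernel again; the two normalizations give
    [expR (- al * modc z ^+ 2)]. *)
Lemma modc_conj_weyl z w : modc (conj_weyl S z (fun=> 1) w) =
  modc (H z (z - w)) * expR (al * complex.Re (w * z^*%C) - al * modc z ^+ 2).
Proof.
pose c := Num.sqrt (complex.Re (rker alpha z z)).
have c0 : 0 < c by rewrite sqrtr_gt0 modc_rker_diag expR_gt0.
have c2 : c ^+ 2 = expR (al * modc z ^+ 2).
  by rewrite sqr_sqrtr modc_rker_diag// expR_ge0.
have -> : conj_weyl S z (fun=> 1) w = (c%:C)^-1 * H z (z - w) * (rker alpha z w / c%:C).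
  rewrite /conj_weyl /weyl /nrker -/c.
  rewrite (_ : (fun w0 : R[i] => 1 * (rker alpha z w0 / c%:C)) = (fun w0 => (c%:C)^-1 * rker alpha z w0)).
    by rewrite op_scale.
  by apply/funext => v; rewrite mul1r mulrC.
rewrite (modcM (_ * _)) (modcM (_^-1)) (modcM (rker _ _ _)) !modcV modc_Creal gtr0_norm//.
rewrite modc_rker expRD expRN -c2.
by field; rewrite gt_eqF.
Qed.

Lemma entire_conj_weyl z : entire (conj_weyl S z (fun=> 1)).
Proof.
pose c := Num.sqrt (complex.Re (rker alpha z z)).
have eH : entire (H z) by have [] := op_fock (domr z).
have := entireM (entireM (@entire_cst R (c%:C)^-1) (entire_comp (@entire_affine R z (-1)) eH))
  (entireM (@entire_rker R alpha z) (@entire_cst R (c%:C)^-1)).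
congr entire; apply/funext => w.
rewrite /conj_weyl /weyl /nrker -/c /comp/= mulN1r.
rewrite (_ : (fun w0 : R[i] => 1 * (rker alpha z w0 / c%:C)) = (fun w0 => (c%:C)^-1 * rker alpha z w0)).
  by rewrite op_scale.
by apply/funext => v; rewrite mul1r mulrC.
Qed.

(** Conjugate analyticity gives [ck_fock] and [ck_local], the adjoint gives [ck_meas] and
    [ck_sqnorm], [2 < p] is [ck_delta], and the limit yields [ck_decay]. *)
Lemma standing_compact_kernel (p : R) : 2 < p ->
  fnorm alpha p (conj_weyl S z (fun=> 1)) @[z --> cinfty R] --> 0%E ->
  compact_kernel alpha H (al / 2 - al / p).
Proof.
move=> p2 lim0; have p0 : 0 < p by exact: lt_trans p2.
have p1 : 1 < p by apply: lt_trans p2; rewrite ltr1n.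
have [_ _ ca] := hS; have [h fh [HE _]] := adjoint_rker.
split.
- exact: ca.1.
- move=> w; have := cmeasJ (fock_cmeas (fh w)).
  by congr cmeas; apply/funext => x; rewrite HE.
- move=> w; have /fockP[_] := fh w; rewrite /sqnorm.
  by under eq_integral do rewrite -modcJ -HE.
- by rewrite subr_gt0 ltr_pM2l// ltf_pV2 ?posrE.
- exact: locally_bounded_disc (conj_analytic_local ca).
move=> e e0; have c0 := pt_const_gt0 p1.
(* Cancels the constant of [entire_pointwise]. *)
have t0 : 0 < e / (2 * pt_const p) by rewrite divr_gt0// mulr_gt0.
have F0 z : (0 <= fnorm alpha p (conj_weyl S z (fun=> 1%R)))%E by exact: Lnorm_ge0.
have [+ _] := @ge0_cvge0P R _ (cinfty R) _ _ F0.
move=> /(_ lim0 _ t0) [r0 [_ hr]].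
(* The neighbourhood of infinity provides the bound beyond any radius strictly larger than [r0]. *)
exists (r0 + 1) => u ur v.
have hu : (fnorm alpha p (conj_weyl S u (fun=> 1%R)) <= (e / (2 * pt_const p))%:E)%E.
  by apply: (hr (r0 + 1)) => //; rewrite ltrDl.
(* At the point [u - v] the reflected argument [u - (u - v)] is [v], so the value involves
   [H u v]. *)
have := entire_pointwise alpha (u - v) p1 (@entire_conj_weyl u).
have k0 : (0 <= (2 * pt_const p * expR (al / p * modc (u - v) ^+ 2))%:E)%E.
  rewrite lee_fin; apply: mulr_ge0; last exact: expR_ge0.
  by apply: mulr_ge0 => //; exact: ltW.
move=> /le_trans/(_ (lee_wpmul2l k0 hu)); rewrite -EFinM lee_fin modc_conj_weyl.
rewrite (_ : u - (u - v) = v); last by ring.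
rewrite (_ : 2 * pt_const p * _ * _ = e * expR (al / p * modc (u - v) ^+ 2)); last first.
  by field; rewrite gt_eqF.
rewrite -ler_pdivlMr ?expR_gt0// -expRN -(mulrA e) -expRD => /le_trans; apply.
(* The exponents coincide, by [Re ((u - v) conj u) - |u|^2 = (|u - v|^2 - |u|^2 - |v|^2) / 2]. *)
rewrite ler_pM2l// ler_expR le_eqVlt; apply/orP; left; apply/eqP.
by rewrite !modcX2 !ReImE; field; rewrite gt_eqF.
Qed.

End operator.
End Main.

Theorem theoremB (R : realType) (alpha : {posnum R}) (S : fock_operator alpha) :
  standing S ->
  (exists2 p : R, 2 < p &
     fnorm alpha p (conj_weyl S z (fun=> 1)) @[z --> cinfty R] --> 0%E) ->
  compact_on_fock S.
Proof.
move=> hS [p p2 lim0].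
have cH := standing_compact_kernel hS p2 lim0.
have [h _ [_ opE]] := adjoint_rker hS.
(* The extension is given by its kernel on the whole Fock space; by the adjoint identity [opE] it
   agrees with [S] on all of [dom S]. *)
pose T := @FockOperator R alpha (fock alpha) (kop alpha (fun u => op S (rker alpha u)))
  (fun f ff => ff) (dom_fock (dom0 S)) (fun a f g => @fock_lin R alpha a f g)
  (fock_kop cH) (kop_lin cH).
exists T; first by split; [exact: dom_fock|move=> f df; rewrite (funext (fun w => opE f w df))].
by split=> // u M; exact: kop_compact cH u M.
Qed.
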